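(* Let $d\ge3$, let $\mathcal X\subset\mathbb R^d$ be the $d$-dimensional pre-Sierpinski carpet with shortest path metric $d_{\mathcal X}$, Hausdorff dimension index $d_f$ and walk dimension $d_w$ (so $2<d_w<d_f$). Let $p>0$, $a(x)=1\vee d_{\mathcal X}(0,x)^p$, $m_a(dx)=a(x)^{-1}\mu(dx)$, and let $Y=Y^{(p)}$ be the time change of reflecting Brownian motion on $\mathcal X$ with generator $a\Delta$, i.e. the process associated with the Dirichlet form $(\mathcal E,\mathcal D_a)$ on $L^2(\mathcal X,m_a)$. Then: (i) $Y$ is stochastically complete if and only if $p\le d_w$. (ii) On the other hand, the volume growth condition (VGC) for $(\mathcal X,\varrho_a,m_a)$ holds if and only if $p\le2$ or $p>d_f$. In particular, for $p\in(2,d_w)$ the process $Y$ is stochastically complete but (VGC) fails.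
   Context: Pre-Sierpinski carpet. Let $F_0=[0,1]^d$. Divide $F_0$ into $3^d$ subcubes of side $3^{-1}$ and remove the (open) middle cube to get $F_1$; repeat in each remaining cube to obtain a decreasing sequence of compact sets $F_n$, $F_n$ being a union of $(3^d-1)^n$ cubes of side $3^{-n}$. Put $\widetilde F_n=3^nF_n$ and $\mathcal X=\bigcup_{n\ge0}\widetilde F_n$. $\mu$ is Lebesgue measure restricted to $\mathcal X$, $d_{\mathcal X}$ is the shortest path distance in $\mathcal X$, and $d_f=\log(3^d-1)/\log3$. Base form. $\mathcal E(f,f)=\int_{\mathcal X}|\nabla f|^2\,d\mu$ for $f\in H^1(\mathcal X)$; this is a regular local Dirichlet form on $L^2(\mathcal X,\mu)$ whose process $W$ is Brownian motion on $\mathcal X$ with normal reflection on $\partial\mathcal X$ and generator the Neumann Laplacian $\Delta$. Walk dimension. $d_w$ is the number such that the heat kernel $p_t(x,y)$ of $W$ satisfies two-sided bounds with space-time scaling function $\Psi(r)=r^2$ for $r\le1$, $\Psi(r)=r^{d_w}$ for $r>1$; that is, with $V(x,r)=\mu(B_{d_{\mathcal X}}(x,r))$ and $\Phi(R,t)=\sup_{s>0}(R/s-t/\Psi(s))$, $p_t(x,y)$ is bounded above, and (with other constants) below, by expressions of the form $V(x,\Psi^{-1}(c_1t))^{-1}\exp(-\Phi(c_2d_{\mathcal X}(x,y),t))$. It is known that such $d_w$ exists and that $2<d_w<d_f$ for $d\ge3$. Time change. With $A_t=\int_0^ta(W_s)^{-1}ds$ and $\tau$ the inverse of $A$, $Y_t=W_{\tau_t}$.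 $Y$ is symmetric with respect to $m_a$, and its Dirichlet form is $(\mathcal E,\mathcal D_a)$ on $L^2(\mathcal X,m_a)$, where $\mathcal D_a$ is the closure of $C_0^1(\mathcal X)$ with respect to $\mathcal E(f,f)+\|f\|^2_{L^2(m_a)}$. $Y$ is stochastically complete if its semigroup satisfies $P_t1=1$ $m_a$-a.e. for some (equivalently all) $t>0$. Intrinsic metric. $\varrho_a(x,y)=\sup\{u(x)-u(y):u\in\mathcal D_a\cap C(\mathcal X),\ |\nabla u|^2\le a^{-1}\}$, with balls $B_{\varrho_a}(x,r)=\{y:\varrho_a(x,y)<r\}$. (VGC) is the condition that, for some $x\in\mathcal X$, $\displaystyle\int_1^\infty\frac{r}{\log m_a(B_{\varrho_a}(x,r))}\,dr=\infty$, where the integrand is read as $0$ when $m_a(B_{\varrho_a}(x,r))=\infty$.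
   Formalization: In (VGC) the denominator log m_a(B) is replaced by max(1, log m_a(B)): read literally, (ii) fails for large p, since then m_a(X) < 1, every logarithm is negative and the integral is −∞ although p > d_f. *)

(* Defs.v *)
From HB Require Import structures.
From mathcomp Require Import all_boot all_order all_algebra.
From mathcomp Require Import all_classical all_reals all_analysis.
Set Implicit Arguments.
Unset Strict Implicit.
Unset Printing Implicit Defensive.
Import Order.TTheory GRing.Theory Num.Theory.
Import numFieldNormedType.Exports.
Local Open Scope classical_set_scope.
Local Open Scope ring_scope.

(* Points of R^d are row vectors. The library norm on 'rV[R]_d is the sup norm;
   it is only used through the topology it induces, and lengths of curves are
   measured with the Euclidean norm [eucl]. *)

Section lebesgue_measure_rV.
Variables (R : realType) (d : nat).
Local Open Scope ereal_scope.

(* [None] is the empty box, which would not be a product of intervals for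
   d = 0. *)
Definition box (c : option ('rV[R]_d * 'rV[R]_d)) : set 'rV[R]_d :=
  if c is Some ab then
    [set x | forall i, (ab.1 ord0 i <= x ord0 i <= ab.2 ord0 i)%R]
  else set0.

Definition box_vol (c : option ('rV[R]_d * 'rV[R]_d)) : \bar R :=
  if c is Some ab then
    (\prod_(i < d) Num.max 0 (ab.2 ord0 i - ab.1 ord0 i)%R)%:E
  else 0.

Definition box_cover (A : set 'rV[R]_d) :
    set (nat -> option ('rV[R]_d * 'rV[R]_d)) :=
  [set c | A `<=` \bigcup_k box (c k)].

Definition leb_outer (A : set 'rV[R]_d) : \bar R :=
  ereal_inf [set \sum_(k <oo) box_vol (c k) | c in box_cover A].

Lemma box_vol_ge0 c : 0 <= box_vol c.
Proof.
by case: c => [ab|//]; rewrite lee_fin; apply: prodr_ge0 => i _; rewrite le_max lexx.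
Qed.

Lemma leb_outer_ge0 A : 0 <= leb_outer A.
Proof.
by apply: le_ereal_inf_tmp => _ [c _ <-]; apply: nneseries_ge0 => *; exact: box_vol_ge0.
Qed.

Lemma leb_outer0 : leb_outer set0 = 0.
Proof.
apply/eqP; rewrite eq_le leb_outer_ge0 andbT.
apply: ereal_inf_lbound; exists (fun=> None) => //.
by rewrite eseries0.
Qed.

Lemma le_leb_outer : {homo leb_outer : A B / A `<=` B >-> A <= B}.
Proof.
move=> A B AB; apply: ereal_inf_le_tmp => _ [c cB <-].
by exists c => //; exact: subset_trans cB.
Qed.

Lemma leb_outer_sigma_subadditive : sigma_subadditive leb_outer.
Proof.
move=> A; have [[i ioo]|] := pselect (exists i, leb_outer (A i) = +oo).
  rewrite (eseries_pinfty _ _ ioo) ?leey// => n _.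
  by rewrite -ltNye (lt_le_trans _ (leb_outer_ge0 _)).
rewrite -forallNE => Aoo.
suff add2e (e : {posnum R}) :
    leb_outer (\bigcup_n A n) <= \sum_(i <oo) leb_outer (A i) + e%:num%:E.
  by apply/lee_addgt0Pr => _/posnumP[].
rewrite (le_trans _ (epsilon_trick _ _ _))//; last first.
  by move=> n; exact: leb_outer_ge0.
pose P n c := box_cover (A n) c /\
  \sum_(k <oo) box_vol (c k) <= leb_outer (A n) + (e%:num / (2 ^ n.+1)%:R)%:E.
have [G PG] : {G & forall n, P n (G n)}.
  apply: (@choice _ _ P) => n; rewrite /P /leb_outer.
  set S := (X in ereal_inf X); move infS : (ereal_inf S) => iS.
  case: iS infS => [r Sr|Soo|Soo].
  - have en1 : (0 < e%:num / (2 ^ n.+1)%:R)%R by [].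
    have /(lb_ereal_inf_adherent en1) : ereal_inf S \is a fin_num by rewrite Sr.
    move=> [x [c cA <-] xS].
    by exists c; split => //; rewrite -Sr; exact/ltW.
  - by have := Aoo n; rewrite /leb_outer Soo.
  - by have := leb_outer_ge0 (A n); rewrite /leb_outer -/S Soo.
pose vG (q : nat * nat) := box_vol (G q.1 q.2).
have vG0 q : 0 <= vG q by exact: box_vol_ge0.
have /card_esym/ppcard_eqP[f] := card_nat2.
apply: (@le_trans _ _ (\esum_(i in setT) vG i)).
  apply: ereal_inf_lbound; exists (fun k => G (f k).1 (f k).2).
    move=> t [n _ /(PG n).1 [k _ tk]].
    by exists (f^-1%FUN (n, k)) => //=; rewrite invK ?inE.
  rewrite -(esum_pred_image vG f xpredT) ?[fun=> _]set_true//.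
  by rewrite image_eq.
rewrite (_ : esum _ _ = \sum_(i <oo) \sum_(j <oo) vG (i, j)); last first.
  pose J : nat -> set (nat * nat) := fun i => [set (i, j) | j in setT].
  rewrite (_ : setT = \bigcup_k J k); last first.
    by rewrite predeqE => -[a b]; split => // _; exists a => //; exists b.
  rewrite esum_bigcupT //=; last first.
    apply/trivIsetP => i j _ _ ij.
    rewrite predeqE => -[n m] /=; split => //= -[] [_] _ [<-{n} _].
    by move=> [m' _] [] /esym/eqP; rewrite (negbTE ij).
  rewrite -(image_id [set: nat]) -fun_true esum_pred_image//; last first.
    by move=> n _; exact: esum_ge0.
  apply: eq_eseriesr => /= j _.
  rewrite -(esum_pred_image vG (pair j) predT)//=; last first.
    by move=> ? ? _ _; exact: (@can_inj _ _ _ snd).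
  by congr esum; rewrite predeqE => -[a b]; split; move=> [i _ <-]; exists i.
apply: lee_lim.
- by apply: is_cvg_nneseries => n *; apply: nneseries_ge0 => m *; exact: vG0.
- by apply: is_cvg_nneseries => n *; apply: adde_ge0 => //; exact: leb_outer_ge0.
- by near=> n; apply: lee_sum => i _; exact: (PG i).2.
Unshelve. all: by end_near. Qed.

HB.instance Definition _ := isOuterMeasure.Build R _ leb_outer
  leb_outer0 leb_outer_ge0 le_leb_outer leb_outer_sigma_subadditive.

Let leb_om : {outer_measure set 'rV[R]_d -> \bar R} := leb_outer.

(* R^d with its Lebesgue (that is, Caratheodory) measurable sets *)
Definition leb_space := caratheodory_type leb_om.
HB.instance Definition _ := Measurable.on leb_space.

Definition leb : set leb_space -> \bar R := leb_om.
HB.instance Definition _ := Measure.on leb.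

End lebesgue_measure_rV.

Section carpet.
Variables (R : realType) (d : nat).
Local Notation pt := 'rV[R]_d.
Local Notation lebT := (leb_space R d).
Local Notation lam := (@leb R d).

Definition eucl (x : pt) : R := Num.sqrt (\sum_(i < d) x ord0 i ^+ 2).

(* F_{n+1} is obtained from F_n by removing the open middle thirds of all the
   cubes 3^-n (k + [0,1]^d); for the cubes which are not part of F_n this
   removes nothing. *)
Fixpoint carpetF (n : nat) : set pt :=
  if n is m.+1 then
    carpetF m `\` [set x | exists k : 'I_d -> nat, forall i,
      3 ^- m * ((k i)%:R + 3^-1) < x ord0 i < 3 ^- m * ((k i)%:R + 2 / 3)]
  else [set x | forall i, 0 <= x ord0 i <= 1].

Definition carpet : set pt :=
  \bigcup_n [set (3 ^+ n : R) *: x | x in carpetF n].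

Definition curve_length (g : R -> pt) : \bar R :=
  ereal_sup [set (\sum_(k < size s)
      eucl (g (nth 0 s k) - g (nth 0 (0 :: s) k)))%:E
    | s in [set s | itv_partition 0 1 s]].

Definition curves (x y : pt) : set (R -> pt) :=
  [set g : R -> pt | [/\ {within `[0%R, 1%R], continuous g}, g 0 = x, g 1 = y &
               forall t, t \in `[0, 1] -> carpet (g t)]].

Definition dX (x y : pt) : R :=
  fine (ereal_inf [set curve_length g | g in curves x y]).

Definition dim_f : R := ln (3 ^+ d - 1) / ln 3.

Definition pderiv (i : 'I_d) (f : pt -> R) : pt -> R :=
  'D_(delta_mx ord0 i) f.

Definition C1 (f : pt -> R) : Prop :=
  (forall x, differentiable f x) /\ (forall i, continuous (pderiv i f)).

Definition supported_in (f : pt -> R) (K : set pt) : Prop :=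
  forall x, ~ K x -> f x = 0.

(* C_0^1(X), as restrictions to X of functions on R^d *)
Definition C1_0 : set (pt -> R) :=
  [set f | C1 f /\ exists2 K, compact K & supported_in f K].

Definition test_fun : set (pt -> R) :=
  [set f | C1 f /\ exists2 K, compact K /\ K `<=` carpet° & supported_in f K].

(* Functions on X are represented by functions on R^d, whose values outside X
   are irrelevant. *)
Definition L2norm2 (m : set lebT -> \bar R) (f : pt -> R) : \bar R :=
  \int[m]_(x in carpet) (f x ^+ 2)%:E.

Definition L2 (m : set lebT -> \bar R) : set (pt -> R) :=
  [set f | measurable_fun (carpet : set lebT) (f : lebT -> R) /\
           (L2norm2 m f < +oo)%E].

Definition weak_gradient (f : pt -> R) (g : 'I_d -> pt -> R) : Prop :=
  (forall i, L2 lam (g i)) /\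
  (forall phi i, test_fun phi ->
    \int[lam]_(x in carpet) (f x * pderiv i phi x) =
    - \int[lam]_(x in carpet) (g i x * phi x)).

Definition sqnorm (g : 'I_d -> pt -> R) (x : pt) : R := \sum_i g i x ^+ 2.

(* E(f,f), with value +oo if f has no square-integrable weak gradient. Weak
   gradients being unique up to null sets, the set below has at most one
   element. *)
Definition energy (f : pt -> R) : \bar R :=
  ereal_inf [set (\int[lam]_(x in carpet) (sqnorm g x)%:E)%E
            | g in weak_gradient f].

Section heat_kernel.
Variable p : R -> pt -> pt -> R.

Definition Pt (t : R) (f : pt -> R) (x : pt) : R :=
  \int[lam]_(y in carpet) (p t x y * f y).

(* p is the (continuous) heat kernel of the Dirichlet form (energy, H^1(X)) on
   L^2(X, mu). The last field says that this form is the one associated with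
   the semigroup: t^-1 <f - P_t f, f> tends to E(f,f) if f is in H^1(X), and to
   +oo if f is in L^2 but not in H^1(X). *)
Record heat_kernel : Prop := HeatKernel {
  hk_ge0 : forall t x y, 0 < t -> carpet x -> carpet y -> 0 <= p t x y ;
  hk_sym : forall t x y, 0 < t -> carpet x -> carpet y -> p t x y = p t y x ;
  hk_cont : forall t, 0 < t ->
    {within carpet `*` carpet, continuous (fun z => p t z.1 z.2)} ;
  hk_submarkov : forall t x, 0 < t -> carpet x ->
    (\int[lam]_(y in carpet) (p t x y)%:E <= 1)%E ;
  hk_semigroup : forall s t x y, 0 < s -> 0 < t -> carpet x -> carpet y ->
    (p (s + t) x y)%:E =
    (\int[lam]_(z in carpet) (p s x z * p t z y)%:E)%E ;
  hk_form : forall f, L2 lam f ->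
    (t^-1 * \int[lam]_(x in carpet) ((f x - Pt t f x) * f x))%:E
      @[t --> 0^'+] --> energy f }.

Section walk_dimension.
Variable dw : R.

Definition Psi (r : R) : R := if r <= 1 then r ^+ 2 else r `^ dw.
Definition Psi_inv (t : R) : R := if t <= 1 then Num.sqrt t else t `^ dw^-1.
Definition Phi (r t : R) : R :=
  sup [set r / s - t / Psi s | s in [set s | 0 < s]].
Definition vol (x : pt) (r : R) : R :=
  fine (lam (carpet `&` [set y | dX x y < r])).

Definition hk_bound (c1 c2 t : R) (x y : pt) : R :=
  (vol x (Psi_inv (c1 * t)))^-1 * expR (- Phi (c2 * dX x y) t).

Definition walk_dimension : Prop :=
  exists c1 c2 c3 c4 : R, [/\ 0 < c1, 0 < c2, 0 < c3, 0 < c4 &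
    forall t x y, 0 < t -> carpet x -> carpet y ->
      hk_bound c3 c4 t x y <= p t x y <= hk_bound c1 c2 t x y].

End walk_dimension.

Section process.
Context {dO : measure_display} {Omega : measurableType dO}.
Variables (P : pt -> probability Omega R) (W : R -> Omega -> pt).

Definition natural_filtration (s : R) : set (set Omega) :=
  <<s [set G | exists u C, [/\ 0 <= u <= s, open C & G = W u @^-1` C]] >>.

(* Reflecting Brownian motion on X: a Markov process with continuous paths in X
   and transition densities p with respect to mu, started from x under P x. *)
Record reflecting_BM : Prop := ReflectingBM {
  bm_hk : heat_kernel ;
  bm_meas : forall t (C : set pt), 0 <= t -> open C -> measurable (W t @^-1` C) ;
  bm_carpet : forall t w, 0 <= t -> carpet (W t w) ;
  bm_cont : forall w, {within `[0, +oo[, continuous (W ^~ w)} ;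
  bm_start : forall x, carpet x -> P x (W 0 @^-1` [set x]) = 1%E ;
  bm_markov : forall x s t (G : set Omega) (B : set pt),
    carpet x -> 0 <= s -> 0 < t -> natural_filtration s G -> <<s open >> B ->
    P x (G `&` W (s + t) @^-1` B) =
    (\int[P x]_(w in G) \int[lam]_(y in carpet `&` B) (p t (W s w) y)%:E)%E }.

Section time_change.
Variable a : pt -> R.

Definition additive_functional (t : R) (w : Omega) : \bar R :=
  (\int[lebesgue_measure]_(s in `[0%R, t]) ((a (W s w))^-1)%:E)%E.

Definition clock_passed (t : R) (w : Omega) : set R :=
  [set s | 0 <= s /\ (t%:E < additive_functional s w)%E].

Definition inverse_clock (t : R) (w : Omega) : R := inf (clock_passed t w).

(* [None] is the cemetery, reached at the lifetime A_oo *)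
Definition time_changed (t : R) (w : Omega) : option pt :=
  if clock_passed t w != set0 then Some (W (inverse_clock t w) w) else None.

Definition time_changed_semigroup (t : R) (f : pt -> R) (x : pt) : R :=
  \int[P x]_w (if time_changed t w is Some y then f y else 0).

End time_change.
End process.
End heat_kernel.

Section time_change_space.
Variable a : pt -> R.

Definition m_a (B : set lebT) : \bar R :=
  (\int[lam]_(x in carpet `&` B) ((a x)^-1)%:E)%E.

(* closure of C_0^1(X) for E(f,f) + |f|^2 in L^2(m_a) *)
Definition D_a : set (pt -> R) :=
  [set f | L2 m_a f /\ exists u : nat -> pt -> R,
    (forall n, C1_0 (u n)) /\
    (energy (u n \- f)%R + L2norm2 m_a (u n \- f)%R)%E @[n --> \oo] --> 0%E].

Definition rho_a (x y : pt) : \bar R :=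
  ereal_sup [set (u x - u y)%:E | u in
    [set u | [/\ D_a u, {within carpet, continuous u} &
      exists2 g, weak_gradient u g &
        {ae lam, forall z, carpet z -> sqnorm g z <= (a z)^-1}]]].

Definition rho_ball (x : pt) (r : R) : set pt :=
  carpet `&` [set y | (rho_a x y < r%:E)%E].

(* The logarithm is replaced by its maximum with 1, since the condition is about
   the divergence of the integral at infinity: log m is negative, or vanishes
   (which makes r / log m non-integrable nearby), when m <= 1. *)
Definition VGC_integrand (x : pt) (r : R) : R :=
  let m := m_a (rho_ball x r) in
  if m == +oo%E then 0 else r / Num.max 1 (ln (fine m)).

Definition VGC : Prop :=
  exists2 x, carpet x &
    (\int[lebesgue_measure]_(r in `[1%R, +oo[) (VGC_integrand x r)%:E)%E = +oo%E.

Definition stochastically_complete {dO : measure_display}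
    {Omega : measurableType dO} (P : pt -> probability Omega R)
    (W : R -> Omega -> pt) : Prop :=
  exists2 t, 0 < t & {ae m_a, forall x, carpet x ->
    time_changed_semigroup P W a t (cst 1) x = 1}.

End time_change_space.

Definition weight (p : R) (x : pt) : R := Num.max 1 (dX 0 x `^ p).

End carpet.

(* Main.v *)
(* Only the upper heat kernel bound is used. Write cell k for the part of the
   carpet in [0, 3^k]^d, N = 3^d - 1 and theta = 3^dw. The weight is of order
   3^(pk) on cell k.+1 outside cell k, so everything is read off cell by cell.

   Completeness. The kernel bound gives P_x (W_t in cell k) <= C N^k / t^(df/dw)
   for t >= theta^k, hence an expected occupation time of cell k at most
   C theta^k, and one which tends to 0, for fixed k, as x goes to infinity. If
   p > dw, summing 3^(-pk) theta^k shows that the expected total clock is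
   finite and tends to 0 at infinity, so that the clock started far away
   stays below any given level with positive probability. If p <= dw, then in
   the windows [theta^k, 2 theta^k], for fixed large l and all large k, the
   path is in cell (k + l) with probability close to 1, where it contributes a
   fixed amount to the clock; since the contribution of a window is also bounded,
   a first moment argument makes the clock pass any level.

   Volume growth. Testing the gradient bound against products of splines, an
   admissible function oscillates by at most C 3^(-pn/2) on a unit cell at
   distance 3^n. Going from cell n to a point of cell n.+1 through nested
   corners then costs O(3^(n (1 - p/2))), which is summable for p > 2, and the
   intrinsic metric is bounded. For p <= 2 the truncated functions
   c ln (1 + |x|^2) show that intrinsic balls of radius r lie in cells of size
   exp (C r). Finally m_a has finite mass if and only if p > df. *)
Require Import Defs.
From mathcomp Require Import all_boot all_order all_algebra.
From mathcomp Require Import all_classical all_reals all_analysis.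
From mathcomp Require Import measurable_realfun.
From mathcomp Require Import lra ring zify.
Set Implicit Arguments.
Unset Strict Implicit.
Unset Printing Implicit Defensive.
Import Order.TTheory GRing.Theory Num.Theory.
Import numFieldNormedType.Exports.
Local Open Scope classical_set_scope.
Local Open Scope ring_scope.

(** * Integrals and Lebesgue measure *)

(** An admissible function in the definition of [rho_a] has only an almost everywhere bound on a
    weak gradient, so nothing can be integrated along a given line. An increment between two points
    is instead a limit of differences of averages over shrinking bumps; such a difference is an
    integral against the derivative of an explicit compactly supported function, placed in an open
    unit cell so that its support lies in the interior of the carpet. Unit steps are then chained
    through corners of cells, around the holes. The exponents act through ratios: [theta < N], that
    is [dw < df], makes the time spent in a cell summable; [3 ^ p] against [theta] decides whether
    the total clock is finite, [3 ^ p] against [N] whether the mass is, and [3 ^ (p / 2)] against 3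
    whether the intrinsic diameter is. Volumes are infima over covers by boxes, so the lower bound
    for boxes is the one fact about them that takes work; [m_a] is a bare set function, and its
    integrals are compared as suprema over simple functions. *)

Section monotone_integral.
Context {dT : measure_display} {T : measurableType dT} {R : realType}.
Local Open Scope ereal_scope.
Import HBNNSimple.

(* No measurability is needed: the integral of a nonnegative function is a
   supremum over simple functions. *)
Lemma maxe_oppe0 (z : \bar R) : 0 <= z -> maxe (- z) 0 = 0.
Proof. by move=> z0; rewrite max_r// leeNl oppe0. Qed.

Lemma le_integral_restrict (mu : set T -> \bar R) (D E : set T) (f g : T -> \bar R) :
  (forall x, 0 <= (f \_ D) x <= (g \_ E) x) ->
  \int[mu]_(x in D) f x <= \int[mu]_(x in E) g x.
Proof.
move=> fg; rewrite /integral.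
have f0 x : 0 <= (f \_ D) x by have /andP[] := fg x.
have g0 x : 0 <= (g \_ E) x by have /andP[] := fg x; exact: le_trans.
have -> : (f \_ D)^\- = (g \_ E)^\-.
  by apply/funext => x; rewrite [LHS]funenegE ?[RHS]funenegE ?maxe_oppe0.
apply: leeB => //; apply: ereal_sup_le => _ [h hf <-]; exists h => // x; apply: le_trans (hf x) _.
by rewrite [leLHS]funeposE [leRHS]funeposE !max_l//; have /andP[] := fg x.
Qed.

Lemma le_integral_ge0 (mu : set T -> \bar R) (D E : set T) (f g : T -> \bar R) :
  D `<=` E -> (forall x, D x -> 0 <= f x <= g x) -> (forall x, E x -> 0 <= g x) ->
  \int[mu]_(x in D) f x <= \int[mu]_(x in E) g x.
Proof.
move=> DE fg g0; apply: le_integral_restrict => x; rewrite /patch.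
case: ifPn => [/set_mem Dx|_]; first by rewrite mem_set ?fg//; exact: DE.
by case: ifPn => [/set_mem /g0->|]; rewrite lexx.
Qed.

(** The sums [sintegral m h] are compared with those of [mu] level set by level set; [m set0 = 0]
    removes the values that are not taken. Used to bound integrals against [m_a] by Lebesgue
    integrals. *)
Lemma le_integral_set_function (m : set T -> \bar R) (mu : {measure set T -> \bar R})
    (D : set T) (f : T -> \bar R) :
  m set0 = 0 -> (forall A, measurable A -> m A <= mu A) -> (forall x, D x -> 0 <= f x) ->
  \int[m]_(x in D) f x <= \int[mu]_(x in D) f x.
Proof.
move=> m0 mmu f0; rewrite /integral.
have fD0 x : 0 <= (f \_ D) x by apply: erestrict_ge0.
have -> : (f \_ D)^\- = cst 0.
  by apply/funext => x; rewrite [LHS]funenegE ?[RHS]funenegE ?maxe_oppe0.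
set M1 := ereal_sup _; set M2 := ereal_sup _.
set N1 := ereal_sup _; set N2 := ereal_sup _.
have le_sint (h : {nnsfun T >-> R}) : sintegral m h <= sintegral mu h.
  have -> : sintegral m h = \sum_(x \in range h) x%:E * m (h @^-1` [set x]).
    rewrite (fsbig_widen (range h) setT)//= => x [_ Nfx] /=.
    by rewrite preimage10// m0 mule0.
  rewrite sintegralE.
  apply: lee_fsum => // r [t _ <-]; apply: lee_wpmul2l; first by rewrite lee_fin.
  exact: mmu.
have M20 : 0 <= M2.
  apply: ereal_sup_ubound; exists nnsfun0.
    by move=> x /=; rewrite lexx.
  rewrite /sintegral fsbig1// => r _ /=; rewrite preimage_cst.
  by case: ifPn => [/[!inE] <-|]; rewrite ?mul0e// m0 mule0.
have MN1 : M1 <= N1.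
  apply: ge_ereal_sup => _ [h hf <-]; apply: (le_trans (le_sint h)).
  by apply: ereal_sup_ubound; exists h.
(* Both integrals subtract the contribution of a zero negative part. For [m] this is only known to
   be nonnegative, which is the right direction. *)
have N20 : 0 = N2.
  apply/eqP; rewrite eq_le; apply/andP; split.
    apply: ereal_sup_ubound; exists nnsfun0; [by move=> x|exact: sintegral0].
  apply: ge_ereal_sup => _ [h hf <-].
  rewrite sintegralE fsbig1// => r [t _ <-].
  have -> : h t = 0%R by apply/eqP; rewrite eq_le fun_ge0 andbT -lee_fin hf.
  by rewrite mul0e.
by rewrite -N20; exact: leeB.
Qed.

End monotone_integral.

(** * Volume of boxes, measurable sets, translations *)

Section box_volume.
Context {R : realType}.
Local Open Scope ereal_scope.

Lemma integral_itv_cst (a b c : R) : (a <= b)%R ->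
  \int[lebesgue_measure]_(t in `[a, b]) c%:E = (c * (b - a))%:E.
Proof.
move=> ab; rewrite integral_cst// EFinM; congr (_ * _).
have := lebesgue_measure_itv `[a, b] => /= ->; rewrite lte_fin; case: ltP => h.
  by rewrite EFinB.
by have -> : a = b; [apply/eqP; rewrite eq_le ab h|rewrite subrr].
Qed.

(** Points are sequences of which only the first [n] terms count, so that the induction on the
    dimension does not change the type of points. *)
Definition in_box (n : nat) (l r x : nat -> R) : bool :=
  [forall i : 'I_n, (l i <= x i <= r i)%R].

(* Induction on the dimension: integrate over the last coordinate the
   inequality for the slices; the weights [w] absorb the condition that a
   slice meets a box. *)
Lemma weighted_box_cover (n : nat) (A B : nat -> R) (l r : nat -> nat -> R)
    (w : nat -> R) :
  (forall i, (A i <= B i)%R) -> (forall k, (0 <= w k)%R) ->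
  (forall x, in_box n A B x -> 1 <= \sum_(k <oo) (w k * (in_box n (l k) (r k) x)%:R)%:E) ->
  (\prod_(i < n) (B i - A i))%:E <=
    \sum_(k <oo) (w k * \prod_(i < n) Num.max 0 (r k i - l k i))%:E.
Proof.
move=> AB; elim: n w => [|n IH] w w0 cov.
  rewrite big_ord0; have := cov A; rewrite {1}/in_box.
  have -> : [forall i : 'I_0, (A i <= A i <= B i)%R] by apply/forallP => -[].
  move=> /(_ isT)/le_trans; apply; apply: lee_nneseries => k _.
    by rewrite lee_fin mulr_ge0.
  by rewrite big_ord0 lee_fin ler_wpM2l// lern1 leq_b1.
pose W t k : R := (w k * (l k n <= t <= r k n)%R%:R)%R.
have W0 t k : (0 <= W t k)%R by rewrite mulr_ge0.
have slice t : (A n <= t <= B n)%R -> (\prod_(i < n) (B i - A i))%:E <=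
    \sum_(k <oo) (W t k * \prod_(i < n) Num.max 0 (r k i - l k i))%:E.
  move=> tAB; apply: IH => // x xAB.
  pose y i := if i == n then t else x i.
  have yE (i : 'I_n) : y i = x i by rewrite /y ltn_eqF.
  have boxS (a b : nat -> R) : in_box n.+1 a b y = (a n <= t <= b n)%R && in_box n a b x.
    apply/forallP/andP => [h|[h1 /forallP h2] i].
      split; first by have := h ord_max; rewrite /= /y eqxx.
      by apply/forallP => i; have := h (widen_ord (leqnSn n) i); rewrite /= yE.
    have := ltn_ord i; rewrite ltnS leq_eqVlt => /orP[/eqP ->|li].
      by rewrite /y eqxx.
    by have := h2 (Ordinal li); rewrite /= /y ltn_eqF.
  have := cov y; rewrite boxS tAB xAB => /(_ isT) /le_trans; apply.
  rewrite le_eqVlt; apply/orP; left; apply/eqP.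
  apply: eq_eseriesr => k _; rewrite boxS /W.
  by case: (_ <= t <= _)%R; rewrite /= ?mulr1// !mulr0 mul0r.
set V := (\prod_(i < n) (B i - A i))%R.
pose v (k : nat) : R := (\prod_(i < n) Num.max 0 (r k i - l k i))%R.
have v0 k : (0 <= v k)%R by apply: prodr_ge0 => i _; rewrite le_max lexx.
have V0 : (0 <= V)%R by apply: prodr_ge0 => i _; rewrite subr_ge0.
rewrite big_ord_recr /= -/V.
have -> : (V * (B n - A n))%:E = \int[lebesgue_measure]_(t in `[A n, B n]) V%:E.
  by rewrite integral_itv_cst.
have mW k : measurable_fun `[A n, B n] (fun t => (W t k * v k)%:E).
  apply/measurable_EFinP; apply: measurable_funM => //; apply: measurable_funM => //.
  have -> : (fun t => ((l k n <= t <= r k n)%R%:R : R)) = \1_`[l k n, r k n].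
    apply/funext => t; rewrite indicE; congr ((nat_of_bool _)%:R); apply/idP/idP.
      by move=> h; rewrite mem_set//= in_itv.
    by move=> /set_mem/=; rewrite in_itv.
  exact: measurable_indic.
apply: (@le_trans _ _ (\int[lebesgue_measure]_(t in `[A n, B n])
    \sum_(k <oo) (W t k * v k)%:E)).
  apply: le_integral_ge0 => // t; rewrite /= in_itv/= => tAB.
    by rewrite lee_fin V0 slice.
  by apply: nneseries_ge0 => k _ _; rewrite lee_fin mulr_ge0.
rewrite integral_nneseries//; last by move=> k t _; rewrite lee_fin mulr_ge0.
apply: lee_nneseries => k _.
  by move=> _; apply: integral_ge0 => t _; rewrite lee_fin mulr_ge0.
rewrite big_ord_recr /= -/(v k).
apply: (@le_trans _ _ (\int[lebesgue_measure]_(t in `[l k n, r k n]) (w k * v k)%:E)).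
  apply: le_integral_restrict => t; rewrite /patch; case: ifPn => [_|_]; last first.
    by case: ifP; rewrite lexx ?lee_fin ?mulr_ge0.
  rewrite lee_fin mulr_ge0//= /W; case: ifPn.
    by rewrite inE/= in_itv/= => ->; rewrite mulr1.
  by rewrite notin_setE/= in_itv/= => /negP/negbTE ->; rewrite mulr0 mul0r.
have [h|h] := leP (l k n) (r k n).
  by rewrite integral_itv_cst// lee_fin mulrA max_r ?subr_ge0.
rewrite set_itv_ge ?bnd_simp -?ltNge// integral_set0.
by rewrite lee_fin !mulr_ge0// le_max lexx.
Qed.

End box_volume.

Section leb_basic.
Context {R : realType} {d : nat}.
Local Notation pt := 'rV[R]_d.
Local Notation lam := (@leb R d).
Local Open Scope ereal_scope.

Lemma le_leb (A B : set pt) : A `<=` B -> lam A <= lam B.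
Proof. exact: le_leb_outer. Qed.

Lemma leb_box_le (a b : pt) : lam (box (Some (a, b))) <= box_vol (Some (a, b)).
Proof.
apply: ereal_inf_lbound; exists (fun k : nat => if k == 0%N then Some (a, b) else None).
  by move=> x xab; exists 0%N.
rewrite (nneseries_split _ 1); last by move=> k _; exact: box_vol_ge0.
rewrite /= big_nat1 add0n eseries0 ?adde0//.
by case.
Qed.

(** The box covers itself, which gives the upper bound. The lower bound is [weighted_box_cover],
    with weight 0 on the empty members [None] of a cover and 1 on the others. *)
Lemma leb_box (a b : pt) : (forall i, (a ord0 i <= b ord0 i)%R) ->
  lam (box (Some (a, b))) = (\prod_(i < d) (b ord0 i - a ord0 i))%:E.
Proof.
move=> ab; apply/eqP; rewrite eq_le; apply/andP; split.
  apply: le_trans (leb_box_le a b) _; rewrite /box_vol lee_fin.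
  by apply: ler_prod => i _; rewrite max_r ?subr_ge0// ab lexx.
apply: le_ereal_inf_tmp => _ [c abc <-].
pose cr (x : pt) (i : nat) : R := if insub i is Some j then x ord0 j else 0%R.
have crE x (i : 'I_d) : cr x i = x ord0 i by rewrite /cr valK.
pose l k := cr (if c k is Some ab then ab.1 else a).
pose r k := cr (if c k is Some ab then ab.2 else b).
pose w k : R := if c k is Some _ then 1%R else 0%R.
have := @weighted_box_cover R d (cr a) (cr b) l r w.
under eq_bigr do rewrite !crE; move=> /(_ _ _ _)/le_trans; apply.
- by rewrite /cr => i; case: insub => // j; exact: ab.
- by move=> k; rewrite /w; case: (c k).
- move=> x /forallP xab.
  have [|k _] := abc (\row_j x j).
    by move=> i; rewrite mxE; have := xab i; rewrite !crE.
  move E : (c k) => [[l' r']|] // xk.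
  rewrite (nneseries_split _ k.+1); last by move=> j _; rewrite lee_fin mulr_ge0// /w; case: (c j).
  rewrite add0n big_nat_recr//=.
  apply: (@le_trans _ _ (w k * (in_box d (l k) (r k) x)%:R)%:E).
    rewrite /w E mul1r (_ : in_box _ _ _ _)//; apply/forallP => i.
    by rewrite /l /r E !crE; have := xk i; rewrite mxE.
  rewrite -[leLHS]adde0; apply: leeD; last first.
    by apply: nneseries_ge0 => j _ _; rewrite lee_fin mulr_ge0// /w; case: (c j).
  rewrite leeDr// sume_ge0// => j _; rewrite lee_fin mulr_ge0// /w; case: (c j) => //.
apply: lee_nneseries => k _.
  rewrite lee_fin mulr_ge0 ?prodr_ge0//; last by move=> *; rewrite le_max lexx.
  by rewrite /w; case: (c k).
rewrite /w /l /r; case: (c k) => [[l' r']|]; last by rewrite mul0r.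
by rewrite mul1r /= lee_fin; under eq_bigr do rewrite !crE.
Qed.

Lemma leb_translate_le (v : pt) (A : set pt) : lam [set x + v | x in A]%R <= lam A.
Proof.
apply: le_ereal_inf_tmp => _ [c Ac <-].
pose c' k := if c k is Some ab then Some (ab.1 + v, ab.2 + v)%R else None.
apply: ereal_inf_lbound; exists c'.
  move=> _ [x Ax <-]; have [k _ xk] := Ac _ Ax; exists k => //.
  rewrite /c'; case: (c k) xk => [[l r]|]//= xk i; rewrite !mxE.
  by have := xk i; rewrite !lerD2r.
apply: eq_eseriesr => k _; rewrite /c'; case: (c k) => [[l r]|]//=.
by congr (_%:E); apply: eq_bigr => i _; rewrite !mxE; congr Num.max; ring.
Qed.

Lemma leb_translate (v : pt) (A : set pt) : lam [set x + v | x in A]%R = lam A.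
Proof.
apply/eqP; rewrite eq_le leb_translate_le/=.
apply: le_trans (leb_translate_le (- v) [set x + v | x in A]%R).
apply: le_leb => x Ax; exists (x + v)%R; first by exists x.
by rewrite addrK.
Qed.

Lemma cut_length (p q c : R) :
  (Num.max 0 (Num.min c q - p) + Num.max 0 (q - Num.max c p) <= Num.max 0 (q - p))%R.
Proof.
have mx (x : R) : (Num.max 0 x = 0 /\ x <= 0 \/ Num.max 0 x = x /\ 0 <= x)%R.
  by case: (leP 0 x)%R => h; [right|left; split => //; exact: ltW].
have [[-> h1]|[-> h1]] := mx (Num.min c q - p)%R;
have [[-> h2]|[-> h2]] := mx (q - Num.max c p)%R;
have [[-> h3]|[-> h3]] := mx (q - p)%R; move: h1 h2 h3;
case: (leP c q) => h4; case: (leP c p) => h5; lra.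
Qed.

(** Caratheodory's condition, checked on covers: the hyperplane cuts each box into [gl] and [gr],
    whose volumes add up to at most the original one by [cut_length] in coordinate [i]. *)
Lemma measurable_coord_le (i : 'I_d) (c : R) :
  measurable ([set x : pt | x ord0 i <= c]%R : set (leb_space R d)).
Proof.
apply: le_caratheodory_measurable => X.
apply: le_ereal_inf_tmp => _ [g Xg <-].
pose cut (t : R) (z : pt) : pt := \row_j (if j == i then t else z ord0 j).
pose gl k := if g k is Some ab then Some (ab.1, cut (Num.min c (ab.2 ord0 i)) ab.2) else None.
pose gr k := if g k is Some ab then Some (cut (Num.max c (ab.1 ord0 i)) ab.1, ab.2) else None.
apply: (@le_trans _ _ (\sum_(k <oo) box_vol (gl k) + \sum_(k <oo) box_vol (gr k))).
  apply: leeD; apply: ereal_inf_lbound; [exists gl|exists gr] => //.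
    move=> x [/Xg[k _ xk] /= xc]; exists k => //.
    rewrite /gl; case: (g k) xk => [[a b]|]//= xk j; rewrite !mxE.
    have /andP[-> xb] := xk j; case: eqP => [ji|//]; subst j.
    by rewrite le_min xc.
  move=> x [/Xg[k _ xk] /= /negP]; rewrite -ltNge => xc; exists k => //.
  rewrite /gr; case: (g k) xk => [[a b]|]//= xk j; rewrite !mxE.
  have /andP[xa ->] := xk j; case: eqP => [ji|_]; last by rewrite xa.
  by subst j; rewrite ge_max xa ltW.
rewrite -nneseriesD//; [|by move=> *; exact: box_vol_ge0..].
apply: lee_nneseries => k _; first by rewrite adde_ge0//; exact: box_vol_ge0.
rewrite /gl /gr; case: (g k) => [[a b]|]/=; last by rewrite adde0.
have prodE (F : 'I_d -> R) : (\prod_j F j = F i * \prod_(j | j != i) F j)%R.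
  exact: bigD1.
rewrite -EFinD lee_fin !prodE !mxE eqxx.
under eq_bigr => j ji do rewrite mxE (negbTE ji).
under [X in (_ + _ * X)%R]eq_bigr => j ji do rewrite mxE (negbTE ji).
set Q := (\prod_(_ < d | _) _)%R.
have Q0 : (0 <= Q)%R by apply: prodr_ge0 => *; rewrite le_max lexx.
rewrite -mulrDl ler_wpM2r//.
exact: (cut_length (a ord0 i) (b ord0 i) c).
Qed.

Lemma measurable_coord (i : 'I_d) :
  measurable_fun setT ((fun x : pt => x ord0 i) : leb_space R d -> R).
Proof.
apply: (measurability _ (RGenOInfty.measurableE R)) => // _ [_ [c ->] <-].
rewrite setTI -[X in measurable X]setCK; apply: measurableC.
have -> : ~` ((fun x : pt => x ord0 i) @^-1` `]c, +oo[) = [set x | x ord0 i <= c]%R.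
  by apply/seteqP; split => x /=; rewrite in_itv/= andbT leNgt => /negP.
exact: measurable_coord_le.
Qed.

(** An open set is a countable union of balls with rational centres and radii [1 / n.+1]; in the sup
    norm such a ball is a finite intersection of conditions on one coordinate. *)
Lemma open_measurable_leb (U : set pt) : open U -> measurable (U : set (leb_space R d)).
Proof.
move=> oU; pose q2r (q : 'rV[rat]_d) : pt := map_mx ratr q.
pose I := ('rV[rat]_d * nat)%type.
pose B (k : I) : set pt := ball (q2r k.1) (k.2.+1%:R^-1)%R.
pose F (k : I) : set pt := if `[< B k `<=` U >] then B k else set0.
have -> : U = \bigcup_k F k.
  apply/seteqP; split => [x Ux|x [k _]]; last first.
    by rewrite /F; case: asboolP => // kU /kU.
  have /nbhs_ballP[e /= e0 xeU] := open_nbhs_nbhs (conj oU Ux).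
  have [n ne] : exists n : nat, (n.+1%:R^-1 < e / 2)%R.
    have e20 : (0 < e / 2)%R by rewrite divr_gt0.
    have [n] := ltr_add_invr (e20 : (0 < e / 2)%R).
    by rewrite add0r => ?; exists n.
  have n0 : (0 < n.+1%:R^-1 :> R)%R by [].
  have qi i : exists q : rat, ball (ratr q : R) (n.+1%:R^-1)%R (x ord0 i).
    have h : (x ord0 i - n.+1%:R^-1 < x ord0 i)%R by rewrite ltrBlDr ltrDl.
    have [q qx] := rat_in_itvoo h; exists q.
    rewrite /ball/= ltr_distl; apply/andP; split; first by rewrite (itvP qx).
    by rewrite (@lt_trans _ _ (x ord0 i))// ?(itvP qx)// ltrDl.
  pose q : 'rV[rat]_d := \row_i xget 0%R [set q : rat | ball (ratr q : R) (n.+1%:R^-1)%R (x ord0 i)].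
  have xq : B (q, n) x.
    split => // i j; rewrite [i]ord1 !mxE.
    by have [r rP] := qi j; exact: (@xgetPex _ 0%R [set q : rat | ball (ratr q : R) (n.+1%:R^-1)%R (x ord0 j)] (ex_intro _ r rP)).
  exists (q, n) => //; rewrite /F; case: asboolP => // -[] y yq; apply: xeU.
  have le2 : (n.+1%:R^-1 + n.+1%:R^-1 <= e)%R by move: (n.+1%:R^-1)%R ne => z ne; lra.
  apply: (le_ball le2).
  by apply: ball_triangle yq; exact: ball_sym.
apply: countable_bigcupT_measurable => [|k]; first exact: countableP.
rewrite /F; case: asboolP => // _.
have -> : B k = \bigcap_(i in [set: 'I_d])
    ((fun x : pt => x ord0 i) @^-1` ball (q2r k.1 ord0 i) (k.2.+1%:R^-1)%R).
  apply/seteqP; split => x; first by move=> [_ h] i _; exact: h.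
  by move=> h; split => // i j; rewrite ord1; exact: h.
apply: fin_bigcap_measurable => // i _.
rewrite -[X in measurable X]setTI; apply: measurable_coord => //.
exact: measurable_ball.
Qed.

Lemma continuous_measurable_leb (f : pt -> R) :
  continuous f -> measurable_fun setT (f : leb_space R d -> R).
Proof.
move=> cf; apply: (measurability _ (RGenOpens.measurableE R)) => // _ [_ [a [b ->]] <-].
rewrite setTI; apply: open_measurable_leb.
by apply: open_comp => [x _|]; [exact: cf|exact: interval_open].
Qed.

Lemma within_continuous_measurable_leb (D : set pt) (f : pt -> R) :
  measurable (D : set (leb_space R d)) ->
  {within D, continuous f} -> measurable_fun (D : set (leb_space R d)) (f : leb_space R d -> R).
Proof.
move=> mD /continuousP cf _; apply: (measurability _ (RGenOpens.measurableE R)) => //.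
move=> _ [_ [a [b ->]] <-].
have /open_subspaceP[V oV VD] := cf _ (@interval_open _ (BRight a) (BLeft b) isT isT).
by rewrite setIC -VD setIC; apply: measurableI => //; exact: open_measurable_leb.
Qed.

Lemma measurable_box (c : option (pt * pt)) :
  measurable (box c : set (leb_space R d)).
Proof.
case: c => [[a b]|]; last exact: measurable0.
have -> : box (Some (a, b)) = \bigcap_(i in [set: 'I_d])
    ((fun x : pt => x ord0 i) @^-1` `[a ord0 i, b ord0 i]).
  apply/seteqP; split => x /= h i; first by move=> _; rewrite /= in_itv/=; exact: h.
  by have := h i I; rewrite /= in_itv.
apply: fin_bigcap_measurable => // i _.
by rewrite -[X in measurable X]setTI; apply: measurable_coord.
Qed.

(** Caratheodory's condition for the preimage, tested on [X], becomes the condition for [A] tested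
    on the translate of [X], by invariance of the outer measure. *)
Lemma measurable_translate (v : pt) :
  measurable_fun setT ((fun x : pt => x + v)%R : leb_space R d -> leb_space R d).
Proof.
move=> _ A mA; rewrite setTI.
have cA : caratheodory_measurable (@leb_outer R d) A := mA.
have preC : ~` ((fun x : pt => x + v)%R @^-1` A) = (fun x : pt => x + v)%R @^-1` (~` A) by [].
change (caratheodory_measurable (@leb_outer R d) ((fun x : pt => x + v)%R @^-1` A)) => X.

have shiftI (B : set pt) : [set x + v | x in X `&` (fun x : pt => x + v)%R @^-1` B]%R =
    [set x + v | x in X]%R `&` B.
  apply/seteqP; split => [_ [x [Xx Bx] <-]|_ [[x Xx <-] Bx]].
    by split => //; exists x.
  by exists x.
have tr := leb_translate v; rewrite /leb in tr.
rewrite -[LHS]tr -[X in _ = X + _]tr -[X in _ = _ + X]tr shiftI.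
by rewrite preC shiftI; exact: cA.
Qed.

Lemma leb_preimage_translate (v : pt) (A : set pt) :
  lam ((fun x : pt => x + v)%R @^-1` A) = lam A.
Proof.
rewrite -(leb_translate v); congr (lam _); apply/seteqP; split => [_ [x Ax <-]//|x Ax].
by exists (x - v)%R; rewrite /= subrK.
Qed.

Lemma ge0_integral_translate (v : pt) (f : pt -> \bar R) :
  measurable_fun setT (f : leb_space R d -> \bar R) -> (forall x, 0 <= f x) ->
  \int[lam]_x f (x + v)%R = \int[lam]_x f x.
Proof.
move=> mf f0.
rewrite -(@ge0_integral_pushforward _ _ (leb_space R d) (leb_space R d) R
  (fun x : pt => x + v)%R (measurable_translate v) lam setT f)//.
have -> : pushforward lam (fun x : leb_space R d => (x : pt) + v : leb_space R d)%R = lam.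
  by apply/funext => A; exact: leb_preimage_translate.
by [].
Qed.

End leb_basic.

(** * Cells of the carpet *)

Section carpet_cells.
Context {R : realType} {d : nat}.
Local Notation pt := 'rV[R]_d.
Local Notation carpet := (@carpet R d).

(* The cubes removed from the unbounded carpet; those of side [3 ^ m]. *)
Definition hole (m : nat) : set pt := [set x | exists k : 'I_d -> nat, forall i,
  3 ^+ m * (3 * (k i)%:R + 1) < x ord0 i < 3 ^+ m * (3 * (k i)%:R + 2)].

Definition cell (n : nat) : set pt :=
  [set x | carpet x /\ forall i, x ord0 i <= 3 ^+ n].

Lemma exp3_gt0 n : 0 < 3 ^+ n :> R.
Proof. exact: exprn_gt0. Qed.

Lemma carpetFP n (y : pt) : carpetF n y <->
  (forall i, 0 <= y ord0 i <= 1) /\ forall m, (m < n)%N ->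
    ~ exists k : 'I_d -> nat, forall i,
      3 ^- m * ((k i)%:R + 3^-1) < y ord0 i < 3 ^- m * ((k i)%:R + 2 / 3).
Proof.
elim: n => [|n IH] /=; first by split => [h|[]//]; split.
split => [[/IH[y01 h] hn]|[y01 h]].
  split => // m; rewrite ltnS leq_eqVlt => /orP[/eqP ->//|]; exact: h.
split; first by apply/IH; split => // m mn; apply: h; exact: ltnW.
exact: h.
Qed.

(** Scaling by [3 ^+ n] turns the cubes removed at stage [n - m.+1] into the holes of side [3 ^+ m],
    whose positions no longer depend on [n]. *)
Lemma carpetF_scale n (y : pt) : carpetF n y <->
  (forall i, 0 <= (3 ^+ n *: y) ord0 i <= 3 ^+ n) /\
  forall m, (m < n)%N -> ~ hole m (3 ^+ n *: y).
Proof.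
have s3 := exp3_gt0.
have sc m (mn : (m < n)%N) (a t : R) : 3 ^+ n * (3 ^- (n - m.+1) * (a + t)) = 3 ^+ m * (3 * a + 3 * t).
  have -> : 3 ^+ n = 3 ^+ (n - m.+1) * (3 ^+ m * 3) :> R.
    by rewrite -exprSr -exprD subnK.
  field; exact: lt0r_neq0.
have e1 : 3 * 3^-1 = 1 :> R by rewrite mulfV.
have e2 : 3 * (2 / 3) = 2 :> R by rewrite mulrCA mulfV// mulr1.
rewrite carpetFP; split => -[y01 h]; split.
- move=> i; have /andP[a b] := y01 i; rewrite mxE mulr_ge0 ?(ltW (s3 n))//=.
  by rewrite ler_piMr// ltW.
- move=> m mn [k hk]; apply: (h (n - m.+1)%N); first by lia.
  exists k => i; have := hk i; rewrite mxE => hki.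
  rewrite -(ltr_pM2l (s3 n)) sc// -[X in _ && X](ltr_pM2l (s3 n)) sc//.
  by rewrite e1 e2.
- move=> i; have := y01 i; rewrite mxE pmulr_rge0//.
  by rewrite -[X in _ && (_ <= X)]mulr1 ler_pM2l.
- move=> m mn [k hk]; apply: (h (n - m.+1)%N); first by lia.
  have sc' (a t : R) : 3 ^+ n * (3 ^- m * (a + t)) = 3 ^+ (n - m.+1) * (3 * a + 3 * t).
    have em : (n - (n - m.+1).+1 = m)%N by lia.
    by rewrite -sc ?em//; lia.
  exists k => i; have /andP[h1 h2] := hk i; rewrite mxE; apply/andP; split.
    have : 3 ^+ n * (3 ^- m * ((k i)%:R + 3^-1)) < 3 ^+ n * y ord0 i by rewrite ltr_pM2l.
    by rewrite sc' e1.
  have : 3 ^+ n * y ord0 i < 3 ^+ n * (3 ^- m * ((k i)%:R + 2 / 3)) by rewrite ltr_pM2l.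
  by rewrite sc' e2.
Qed.

Lemma hole_gt m (x : pt) i : hole m x -> 3 ^+ m < x ord0 i.
Proof.
move=> [k /(_ i)/andP[h _]]; apply: le_lt_trans h.
by rewrite ler_peMr ?(ltW (exp3_gt0 _))// lerDr mulr_ge0.
Qed.

Hypothesis d_gt0 : (0 < d)%N.

Lemma hole_large m n (x : pt) : (n <= m)%N -> (forall i, x ord0 i <= 3 ^+ n) -> ~ hole m x.
Proof.
move=> nm xn /(hole_gt (Ordinal d_gt0)); apply/negP; rewrite -leNgt.
by rewrite (le_trans (xn _))// ler_weXn2l// ler1n.
Qed.

Lemma le_exp3_exists (x : pt) : exists n, forall i, x ord0 i <= 3 ^+ n.
Proof.
have s0 : 0 <= \sum_i `|x ord0 i| by apply: sumr_ge0.
have := archi_boundP s0; set n := Num.bound _ => xn; exists n => i.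
apply: (le_trans (ler_norm _)).
apply: (@le_trans _ _ (\sum_i `|x ord0 i|)).
  by rewrite (bigD1 i)//= lerDl sumr_ge0.
apply: (le_trans (ltW xn)); rewrite -natrX ler_nat.
by apply: ltnW; apply: ltn_expl.
Qed.

(** A hole of side [3 ^+ m] lies beyond [3 ^+ m] in every coordinate, so only the holes with [m < n]
    can meet the cube of side [3 ^+ n], and these are the ones removed in [carpetF n]. *)
Lemma carpetP (x : pt) : carpet x <-> (forall i, 0 <= x ord0 i) /\ forall m, ~ hole m x.
Proof.
split => [[n _ [y /carpetF_scale[y01 h] <-]]|[x0 h]].
  split => [i|m]; first by have /andP[] := y01 i.
  have [mn|nm] := ltnP m n; first exact: h.
  by apply: (hole_large nm) => i; have /andP[] := y01 i.
have [n xn] := le_exp3_exists x; exists n => //.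
have xE : 3 ^+ n *: (3 ^- n *: x) = x.
  by rewrite scalerA mulfV ?scale1r// lt0r_neq0// exp3_gt0.
exists (3 ^- n *: x) => //; apply/carpetF_scale; rewrite xE; split => // i.
by rewrite x0 xn.
Qed.

Lemma carpet_ge0 (x : pt) i : carpet x -> 0 <= x ord0 i.
Proof. by move=> /carpetP[]. Qed.

Lemma cellP n (x : pt) : cell n x <->
  (forall i, 0 <= x ord0 i <= 3 ^+ n) /\ forall m, (m < n)%N -> ~ hole m x.
Proof.
split => [[/carpetP[x0 h] xn]|[x0 h]]; first by split => // i; rewrite x0 xn.
split; last by move=> i; have /andP[] := x0 i.
apply/carpetP; split => [i|m]; first by have /andP[] := x0 i.
have [mn|nm] := ltnP m n; first exact: h.
by apply: (hole_large nm) => i; have /andP[] := x0 i.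
Qed.

Lemma cell_sub_carpet n (x : pt) : cell n x -> carpet x.
Proof. by case. Qed.

Lemma carpet_cell (x : pt) : carpet x -> exists n, cell n x.
Proof. by move=> cx; have [n xn] := le_exp3_exists x; exists n. Qed.

Lemma le_cell m n : (m <= n)%N -> cell m `<=` cell n.
Proof.
move=> mn x [cx xm]; split => // i; apply: (le_trans (xm i)).
by rewrite ler_weXn2l// ler1n.
Qed.

Lemma cell_monotone_cover (x y : pt) : carpet x -> carpet y -> exists n, cell n x /\ cell n y.
Proof.
move=> /carpet_cell[m mx] /carpet_cell[n ny]; exists (maxn m n).
by split; [apply: le_cell mx; rewrite leq_maxl|apply: le_cell ny; rewrite leq_maxr].
Qed.

Definition offset (j : 'I_d -> nat) (n : nat) : pt := \row_i (3 ^+ n * (j i)%:R).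

(** The positions of the [3 ^ d - 1] subcubes that are kept: the middle one, with all digits 1, is
    excluded. *)
Definition child_index (j : 'I_d -> nat) : Prop :=
  (forall i, j i <= 2)%N /\ exists i, j i != 1%N.

(** For [m < n] the offset is a multiple of [3 ^+ m.+1], the period of the holes of side [3 ^+ m].
    Nonnegativity of [y] keeps the shifted index [k - s] a natural number. *)
Lemma hole_shift m n (j : 'I_d -> nat) (y : pt) : (m < n)%N ->
  (forall i, 0 <= y ord0 i) -> hole m (offset j n + y) -> hole m y.
Proof.
move=> mn y0 [k hk].
pose s i := (3 ^ (n - m.+1) * j i)%N.
have sE i : 3 ^+ n * (j i)%:R = 3 ^+ m * (3 * (s i)%:R) :> R.
  rewrite /s natrM natrX !mulrA -exprSr -exprD; congr (3 ^+ _ * _); lia.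
have sk i : (s i <= k i)%N.
  rewrite leqNgt; apply/negP => ks; have /andP[_] := hk i.
  rewrite !mxE sE; apply/negP; rewrite -leNgt.
  apply: (@le_trans _ _ (3 ^+ m * (3 * (s i)%:R))); last by rewrite lerDl.
  rewrite ler_pM2l ?exp3_gt0//.
  have : (k i).+1%:R <= (s i)%:R :> R by rewrite ler_nat.
  rewrite -natr1; lra.
exists (fun i => k i - s i)%N => i; have := hk i; rewrite !mxE sE natrB//.
by rewrite -!ltrBlDl -?ltrBrDl !mulrDr !mulrN !mulrA; lra.
Qed.

Lemma hole_shiftV m n (j : 'I_d -> nat) (y : pt) : (m < n)%N ->
  hole m y -> hole m (offset j n + y).
Proof.
move=> mn [k hk].
pose s i := (3 ^ (n - m.+1) * j i)%N.
have sE i : 3 ^+ n * (j i)%:R = 3 ^+ m * (3 * (s i)%:R) :> R.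
  rewrite /s natrM natrX !mulrA -exprSr -exprD; congr (3 ^+ _ * _); lia.
exists (fun i => k i + s i)%N => i; have := hk i; rewrite !mxE sE natrD.
by rewrite !mulrDr !mulrA; lra.
Qed.

Lemma cell_child n (j : 'I_d -> nat) (y : pt) :
  child_index j -> cell n y -> cell n.+1 (offset j n + y).
Proof.
move=> [j2 [i0 ji0]] /cellP[y01 h]; apply/cellP; split => [i|m].
  have /andP[y0 y1] := y01 i; rewrite !mxE addr_ge0 ?mulr_ge0 ?exprn_ge0//=.
  rewrite exprS; have : (j i)%:R <= 2 :> R by rewrite (ler_nat _ _ 2).
  by have := exp3_gt0 n; move: (3 ^+ n) y1 => t y1 t0 ji; nra.
rewrite ltnS leq_eqVlt => /orP[/eqP ->|mn]; last first.
  move=> /(hole_shift mn)H; apply: (h _ mn); apply: H => i.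
  by have /andP[] := y01 i.
(* The hole of side [3 ^+ n] itself: in coordinate [i0], where the digit is not 1, the point is not
   in an open middle third. *)
move=> [k /(_ i0)]; have /andP[y0 y1] := y01 i0; rewrite !mxE => /andP[h1 h2].
have {h1 y1} h1 : 3 * (k i0)%:R + 1 < (j i0)%:R + 1 :> R.
  rewrite -(ltr_pM2l (exp3_gt0 n)); apply: (lt_le_trans h1).
  by rewrite mulrDr mulr1 lerD2l.
have {h2 y0} h2 : (j i0)%:R < 3 * (k i0)%:R + 2 :> R.
  by rewrite -(ltr_pM2l (exp3_gt0 n)); apply: le_lt_trans h2; rewrite lerDl.
move: h1 h2; rewrite ltrD2r -!natrM -natrD !ltr_nat.
have := j2 i0; move: ji0; lia.
Qed.

Lemma cell_parent n (x : pt) : cell n.+1 x ->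
  exists j, child_index j /\ cell n (x - offset j n).
Proof.
move=> /cellP[x01 h]; have t0 := exp3_gt0 n.
(* Ties at [3 ^+ n] and [2 * 3 ^+ n] go to the digits 0 and 2, so digit 1 means the open middle
   third, and all digits equal to 1 would put [x] in a hole. *)
pose j i := if x ord0 i <= 3 ^+ n then 0%N else if x ord0 i < 3 ^+ n * 2 then 1%N else 2%N.
have jx i : 0 <= x ord0 i - 3 ^+ n * (j i)%:R <= 3 ^+ n.
  have /andP[x0 x1] := x01 i; move: x1; rewrite /j exprS.
  have [|] := leP (x ord0 i) (3 ^+ n); first by rewrite mulr0 subr0 x0 => ->.
  by have [|] := ltP (x ord0 i) (3 ^+ n * 2) => ? ? ?; lra.
exists j; split.
  split => [i|]; first by rewrite /j; case: ifP => // _; case: ifP.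
  apply: contrapT => /forallNP all1; apply: (h n) => //; exists (fun=> 0%N) => i.
  have /negP/negbNE/eqP := all1 i; rewrite /j mulr0 !add0r mulr1.
  by case: (leP (x ord0 i)) => // xi; case: ifP => //; rewrite xi.
apply/cellP; split => [i|m mn]; first by rewrite !mxE; exact: jx.
move=> /(hole_shiftV j mn); rewrite addrC subrK; apply: h.
by rewrite (ltn_trans mn).
Qed.

(* [v] is the corner, nearest to the origin, of a copy [v + cell n] of
   [cell n] inside the carpet. *)
Inductive corner : nat -> pt -> Prop :=
| corner_origin n : corner n 0
| corner_child n v j : corner n.+1 v -> child_index j -> corner n (v + offset j n).

Lemma corner_carpet n v x : corner n v -> cell n x -> carpet (v + x).
Proof.
move=> cv; elim: cv x => {n v} [n x /cell_sub_carpet|n v j _ IH jP x xn].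
  by rewrite add0r.
by rewrite -addrA; apply: IH; exact: cell_child.
Qed.

Lemma corner_exists n (x : pt) : carpet x -> exists2 v, corner n v & cell n (x - v).
Proof.
move=> /carpet_cell[k xk].
suff gen m v y : corner (m + n) v -> cell (m + n) y ->
    exists2 w, corner n w & cell n (v + y - w).
  have [w w1 w2] := gen k 0 x (corner_origin _) (le_cell (leq_addr n k) xk).
  by exists w => //; move: w2; rewrite add0r.
elim: m v y => [|m IH] v y; rewrite ?addSn ?add0n => cv ym.
  by exists v => //; rewrite addrAC subrr add0r.
have [j [jP yj]] := cell_parent ym.
have [w w1 w2] := IH _ _ (corner_child cv jP) yj; exists w => //.
by move: w2; rewrite (_ : v + offset j (m + n) + (y - offset j (m + n)) = v + y)// addrACA subrr addr0.
Qed.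

Lemma cell0P (x : pt) : cell 0 x <-> forall i, 0 <= x ord0 i <= 1.
Proof. by rewrite cellP expr0; split => [[]|]. Qed.

End carpet_cells.

(** * Staircases through the kept subcubes *)

Section child_indices.
Context {d : nat}.
Hypothesis d_gt1 : (1 < d)%N.

Definition unit_index (i : 'I_d) : 'I_d -> nat := fun k => (k == i).

Lemma other_index (i : 'I_d) : exists k : 'I_d, k != i.
Proof.
case: (eqVneq i (Ordinal (ltnW d_gt1))) => [->|h]; last by exists (Ordinal (ltnW d_gt1)); rewrite eq_sym.
by exists (Ordinal d_gt1).
Qed.

Lemma child_index_axis c (i : 'I_d) : (c <= 2)%N -> child_index (fun k => c * unit_index i k)%N.
Proof.
move=> c2; split => [k|]; first by rewrite /unit_index; case: eqP => _; lia.
by have [k ki] := other_index i; exists k; rewrite /unit_index (negbTE ki) muln0.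
Qed.

(** One step towards the origin that avoids the middle cube: if lowering coordinate [i] would give
    digits all equal to 1, every other coordinate is 1 already, and lowering one of those is
    safe. *)
Lemma child_index_pred (j : 'I_d -> nat) : child_index j -> (exists i, 0 < j i)%N ->
  exists i, (0 < j i)%N /\ child_index (fun k => j k - unit_index i k)%N.
Proof.
move=> [j2 [i0 ji0]] [i ji].
have [h|h] := pselect (child_index (fun k => j k - unit_index i k)%N); first by exists i.
have all1 k : (j k - unit_index i k)%N = 1%N.
  apply: contrapT => /eqP hk; apply: h; split; last by exists k.
  by move=> l; rewrite (leq_trans (leq_subr _ _)).
have [k ki] := other_index i; exists k.
have jk : j k = 1%N by have := all1 k; rewrite /unit_index (negbTE ki) subn0.
split; first by rewrite jk.
split => [l|]; first by rewrite (leq_trans (leq_subr _ _)).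
exists i; rewrite /unit_index [i == k]eq_sym (negbTE ki) subn0.
by have := all1 i; rewrite /unit_index eqxx; lia.
Qed.

Lemma sum_child_index (j : 'I_d -> nat) : child_index j -> (\sum_i j i <= 2 * d)%N.
Proof.
move=> [j2 _]; apply: (@leq_trans (\sum_(i < d) 2)%N); first exact: leq_sum.
by rewrite sum_nat_const card_ord mulnC.
Qed.

End child_indices.

Section offsets.
Context {R : realType} {d : nat}.
Local Notation pt := 'rV[R]_d.
Hypothesis d_gt1 : (1 < d)%N.
Let d_gt0 : (0 < d)%N. Proof. exact: ltnW. Qed.

Lemma corner_in_carpet n (v : pt) : corner n v -> carpet v.
Proof.
move=> cv; rewrite -(addr0 v); apply: (corner_carpet d_gt0 cv); apply/(cellP d_gt0).
split => [i|m _ /(hole_gt (Ordinal d_gt0))]; rewrite mxE; first by rewrite lexx exprn_ge0.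
by apply/negP; rewrite -leNgt exprn_ge0.
Qed.

Lemma offsetD (j k : 'I_d -> nat) n : offset (fun i => j i + k i)%N n = offset j n + offset k n :> pt.
Proof. by apply/rowP => i; rewrite !mxE natrD mulrDr. Qed.

Lemma offset0 n : offset (fun=> 0%N) n = 0 :> pt.
Proof. by apply/rowP => i; rewrite !mxE mulr0. Qed.

Lemma eq_offset (j k : 'I_d -> nat) n : j =1 k -> offset j n = offset k n :> pt.
Proof. by move=> jk; apply/rowP => i; rewrite !mxE jk. Qed.

End offsets.

(* [S x y L] stands for: [x] and [y] are within cost [L] of each other; it is
   instantiated with lengths of curves and with increments of a function. *)
Section cell_chains.
Context {R : realType} {d : nat}.
Local Notation pt := 'rV[R]_d.
Hypothesis d_gt1 : (1 < d)%N.
Context (S : pt -> pt -> R -> Prop) (Reg : pt -> Prop) (K : R).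
Hypothesis K_ge0 : 0 <= K.
Hypothesis S_refl : forall x, carpet x -> S x x 0.
Hypothesis S_trans : forall x y z L M, S x y L -> S y z M -> S x z (L + M).
Hypothesis S_mono : forall x y L M, S x y L -> L <= M -> S x y M.
Hypothesis S_unit : forall w x, corner 0 w -> Reg w -> cell 0 x -> S w (w + x) K.

Let d_gt0 : (0 < d)%N. Proof. exact: ltnW. Qed.

(** [Reg] is the region where a unit cell costs at most [K]. It is everything when costs are
    lengths; for increments of an admissible function it is the part at distance at least [3 ^+ n]
    from the origin. *)
Hypothesis Reg_shift : forall v j n, Reg v -> Reg (v + offset j n).

(** An edge of length [3 ^+ n.+1] is made of three edges of the children with digits 0, 1, 2 on the
    axis and 0 elsewhere; all three are kept because there is a second coordinate. *)
Lemma edge_cost n v i : corner n v -> Reg v ->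
  S v (v + offset (unit_index i) n) (K * 3 ^+ n).
Proof.
elim: n v => [|n IH] v cv rv.
  rewrite expr0 mulr1; apply: S_unit => //; apply/(cell0P d_gt0) => k.
  by rewrite mxE expr0 mul1r /unit_index; case: eqP; rewrite /= ?lexx ?ler01.
have step c : (c <= 2)%N -> S (v + offset (fun k => c * unit_index i k)%N n)
    (v + offset (fun k => c.+1 * unit_index i k)%N n) (K * 3 ^+ n).
  move=> c2; have := IH _ (corner_child cv (child_index_axis d_gt1 i c2)) (Reg_shift _ _ rv).
  rewrite -addrA -offsetD; congr (S _ (_ + _) _); apply: eq_offset => k; lia.
have := S_trans (S_trans (step 0%N isT) (step 1%N isT)) (step 2%N isT).
rewrite (@eq_offset R d _ (fun=> 0%N)); last by move=> k; rewrite mul0n.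
rewrite offset0 addr0 exprS (_ : K * (3 * _) = K * 3 ^+ n + K * 3 ^+ n + K * 3 ^+ n); last by ring.
congr (S _ (_ + _) _); apply/rowP => k; rewrite !mxE natrM exprS; ring.
Qed.

(** Induction on the sum of the digits, along [child_index_pred]. The staircase stops at a unit
    index instead of the origin, so that only corners away from the origin have to lie in [Reg]. *)
Lemma stair_cost n v j : corner n.+1 v ->
  (forall k, (exists i, 0 < k i)%N -> Reg (v + offset k n)) ->
  child_index j -> (exists i, 0 < j i)%N ->
  exists i, S (v + offset (unit_index i) n) (v + offset j n) (K * 3 ^+ n * (\sum_i j i)%:R).
Proof.
move=> cv rv; move e : (\sum_i j i)%N => s.
elim: s j e => [|s IH] j e jP [i0 ji0].
  by move: e; rewrite (bigD1 i0)//=; lia.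
have [i [ji jP']] := child_index_pred d_gt1 jP (ex_intro _ i0 ji0).
pose k := (fun l => j l - unit_index i l)%N.
have jE l : j l = (k l + unit_index i l)%N.
  by rewrite /k /unit_index; case: eqP => [->|_]; lia.
have ks : (\sum_l k l = s)%N.
  move: e; rewrite (eq_bigr _ (fun l _ => jE l)) big_split/=.
  have -> : (\sum_l unit_index i l = 1)%N.
    rewrite (bigD1 i)//= /unit_index eqxx big1// => l li.
    by rewrite (negbTE li).
  by rewrite addn1; case.
rewrite (eq_offset _ jE) offsetD addrA.
have [[i1 ki1]|k0] := pselect (exists i, 0 < k i)%N; last first.
  exists i; have -> : offset k n = 0 :> pt.
    rewrite -(offset0 n); apply: eq_offset => l; apply/eqP; rewrite -leqn0 leqNgt.
    by apply/negP => kl; apply: k0; exists l.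
  rewrite addr0; apply: S_mono (_ : 0 <= _); last by rewrite !mulr_ge0// exprn_ge0.
  apply: S_refl; apply: (@corner_in_carpet R d d_gt1 n); apply: corner_child => //.
  rewrite (_ : unit_index i = fun l => 1 * unit_index i l)%N; last first.
    by apply/funext => l; rewrite mul1n.
  exact: (child_index_axis d_gt1).
have [i2 Si2] := IH k ks jP' (ex_intro _ i1 ki1); exists i2.
rewrite -[s.+1%:R]natr1 mulrDr mulr1; apply: S_trans Si2 _.
by apply: edge_cost; [exact: corner_child|apply: rv; exists i1].
Qed.

(** Reaching a point of cell [n.+1] takes a first edge, at most [2 * d] further edges, and a cell of
    the previous level: the constant closes since [1 + 2 d + 2 d <= 3 * (2 d)]. *)
Lemma cell_cost n v x : corner n v -> Reg v -> cell n x ->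
  S v (v + x) (K * (2 * d)%:R * 3 ^+ n).
Proof.
have d1 : 2 <= (2 * d)%:R :> R by rewrite (ler_nat _ 2); lia.
elim: n v x => [|n IH] v x cv rv cx.
  apply: S_mono (S_unit cv rv cx) _; rewrite expr0 mulr1 ler_peMr//; lra.
have [j [jP xj]] := cell_parent d_gt0 cx.
have cvj := corner_child cv jP.
have := IH _ _ cvj (Reg_shift j n rv) xj.
rewrite (_ : v + _ + (x - _) = v + x); last by rewrite addrACA subrr addr0.
have t0 : 0 <= K * 3 ^+ n by rewrite mulr_ge0// exprn_ge0.
have [j0|j0] := pselect (exists i, 0 < j i)%N; last first.
  have -> : offset j n = 0 :> pt.
    rewrite -(offset0 n); apply: eq_offset => l; apply/eqP; rewrite -leqn0 leqNgt.
    by apply/negP => kl; apply: j0; exists l.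
  rewrite addr0 => /S_mono; apply; rewrite exprS; nra.
have [i Si] := stair_cost cv (fun k _ => Reg_shift k n rv) jP j0.
have c0 := corner_child cv (@child_index_axis d d_gt1 0 i isT).
have := edge_cost i c0 (Reg_shift _ _ rv).
rewrite (@eq_offset R d _ (fun=> 0%N)); last by move=> k; rewrite mul0n.
rewrite offset0 addr0 => /S_trans-/(_ _ _ Si) /S_trans H /H /S_mono; apply.
have : (\sum_i j i)%:R <= (2 * d)%:R :> R by rewrite ler_nat sum_child_index.
move=> Tle; rewrite exprS -/(_ * _).
rewrite (_ : K * (2 * d)%:R * (3 * 3 ^+ n) = K * 3 ^+ n * (3 * (2 * d)%:R)); last by ring.
rewrite (_ : _ + _ = K * 3 ^+ n * (1 + (\sum_l j l)%:R + (2 * d)%:R)); last by ring.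
by apply: ler_wpM2l => //; lra.
Qed.

End cell_chains.

Section euclidean_norm.
Context {R : realType} {d : nat}.
Local Notation pt := 'rV[R]_d.

Lemma eucl_le_l1 (x : pt) : eucl x <= \sum_i `|x ord0 i|.
Proof.
have s0 : 0 <= \sum_i `|x ord0 i| by apply: sumr_ge0.
rewrite /eucl -[leRHS](ger0_norm s0) -sqrtr_sqr ler_sqrt ?sqr_ge0//.
rewrite expr2 mulr_suml; apply: ler_sum => i _.
rewrite -real_normK ?num_real// expr2 ler_wpM2l//.
by rewrite (bigD1 i)//= lerDl sumr_ge0.
Qed.

Lemma coord_le_eucl (x : pt) i : `|x ord0 i| <= eucl x.
Proof.
rewrite /eucl -sqrtr_sqr ler_sqrt; last by apply: sumr_ge0 => j _; exact: sqr_ge0.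
by rewrite (bigD1 i)//= lerDl sumr_ge0// => j _; exact: sqr_ge0.
Qed.

End euclidean_norm.

(** * Path metric and volume *)

Section path_metric.
Context {R : realType} {d : nat}.
Local Notation pt := 'rV[R]_d.
Hypothesis d_gt1 : (1 < d)%N.

Let d_gt0 : (0 < d)%N. Proof. exact: ltnW. Qed.

(* The l^1 norm makes the triangle inequality, hence concatenation, immediate. *)
Definition reach (x y : pt) (L : R) : Prop := 0 <= L /\
  exists g : R -> pt, [/\ g 0 = x, g L = y, (forall t, carpet (g t)) &
    forall s t, \sum_i `|g s ord0 i - g t ord0 i| <= `|s - t|].

Lemma reach_refl (x : pt) : carpet x -> reach x x 0.
Proof.
move=> cx; split => //; exists (fun=> x); split => // s t.
by rewrite big1// => i _; rewrite subrr normr0.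
Qed.

Lemma reach_trans (x y z : pt) (L M : R) : reach x y L -> reach y z M -> reach x z (L + M).
Proof.
move=> [L0 [g [g0 gL gc gl]]] [M0 [h [h0 hM hc hl]]]; split; first exact: addr_ge0.
exists (fun t => if t <= L then g t else h (t - L)); split.
- by rewrite L0.
- case: ifPn => [LM|_]; last by rewrite addrC addKr.
  have M00 : M = 0 by apply/eqP; rewrite eq_le M0 andbT; lra.
  by rewrite M00 addr0 gL -h0 -hM M00.
- by move=> t; case: ifP.
have side s t : s <= L -> L < t ->
    \sum_i `|g s ord0 i - h (t - L) ord0 i| <= `|s - t|.
  move=> sL Lt; apply: (@le_trans _ _ (\sum_i (`|g s ord0 i - g L ord0 i| +
      `|h 0 ord0 i - h (t - L) ord0 i|))).
    by apply: ler_sum => i _; rewrite gL -h0; exact: ler_distD.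
  rewrite big_split/=; apply: (le_trans (lerD (gl _ _) (hl _ _))).
  rewrite sub0r normrN (@ler0_norm _ (s - L)) ?subr_le0//.
  rewrite (@gtr0_norm _ (t - L)) ?subr_gt0// (@ler0_norm _ (s - t)); lra.
move=> s t; have [sL|Ls] := leP s L; have [tL|Lt] := leP t L.
- exact: gl.
- exact: side.
- rewrite distrC; under eq_bigr do rewrite distrC; exact: side.
- by apply: (le_trans (hl _ _)); rewrite (_ : s - L - (t - L) = s - t)//; ring.
Qed.

Lemma reach_sym (x y : pt) (L : R) : reach x y L -> reach y x L.
Proof.
move=> [L0 [g [g0 gL gc gl]]]; split => //; exists (fun t => g (L - t)); split => //.
- by rewrite subr0.
- by rewrite subrr.
- move=> s t; apply: (le_trans (gl _ _)).
  by rewrite (_ : L - s - (L - t) = t - s) 1?distrC//; ring.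
Qed.

Lemma min_lipschitz (a s t : R) : `|Num.min s a - Num.min t a| <= `|s - t|.
Proof.
have [sa|sa] := leP s a; have [ta|ta] := leP t a; rewrite ?subrr ?normr0//.
  by rewrite !ler0_norm ?subr_le0//; lra.
by rewrite !ger0_norm ?subr_ge0//; lra.
Qed.

Lemma reach_mono (x y : pt) (L M : R) : reach x y L -> L <= M -> reach x y M.
Proof.
move=> [L0 [g [g0 gL gc gl]]] LM; split; first exact: le_trans LM.
exists (fun t => g (Num.min t L)); split => //.
- by rewrite min_l.
- by rewrite min_r.
- by move=> s t; apply: (le_trans (gl _ _)); exact: min_lipschitz.
Qed.

Lemma segment_reach (x y : pt) (L : R) : 0 < L ->
  (forall s, 0 <= s <= 1 -> carpet (x + s *: (y - x))) ->
  \sum_i `|y ord0 i - x ord0 i| <= L -> reach x y L.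
Proof.
move=> L0 cxy xyL; split; first exact: ltW.
(* [t / L] clamped to [[0, 1]], written with minima so that [min_lipschitz] applies twice. *)
pose c (t : R) := - Num.min (- Num.min (t / L) 1) 0.
have c01 t : 0 <= c t <= 1.
  rewrite /c oppr_ge0 ge_min lexx orbT/=.
  rewrite lerNl le_min lerN2 ge_min lexx orbT/=; lra.
have cl s t : `|c s - c t| <= `|s - t| / L.
  have -> : c s - c t = Num.min (- Num.min (t / L) 1) 0 - Num.min (- Num.min (s / L) 1) 0.
    by rewrite /c; ring.
  rewrite (_ : `|s - t| / L = `|s / L - t / L|); last first.
    by rewrite -mulrBl normrM (@gtr0_norm _ L^-1)// invr_gt0.
  apply: (le_trans (min_lipschitz _ _ _)); rewrite -opprD normrN addrC distrC.
  by rewrite [- _ + _]addrC distrC [in X in _ <= X]distrC; exact: min_lipschitz.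
exists (fun t => x + c t *: (y - x)); split.
- have -> : c 0 = 0 by rewrite /c mul0r (min_l ler01) oppr0 minxx oppr0.
  by rewrite scale0r addr0.
- have -> : c L = 1 by rewrite /c divff ?gt_eqF// minxx (min_l (lerN10 R)) opprK.
  by rewrite scale1r addrC subrK.
- by move=> t; exact: cxy.
- move=> s t; rewrite (eq_bigr (fun i => `|c s - c t| * `|y ord0 i - x ord0 i|)).
    rewrite -mulr_sumr; apply: (le_trans (ler_pM _ _ (cl s t) xyL)) => //.
      by apply: sumr_ge0.
    by rewrite divfK ?gt_eqF.
  by move=> i _; rewrite !mxE -normrM; congr `| _ |; ring.
Qed.

Lemma unit_cell_reach (w x : pt) : corner 0 w -> cell 0 x -> reach w (w + x) d%:R.
Proof.
move=> cw /(cell0P d_gt0) x01; apply: segment_reach; first by rewrite ltr0n.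
  move=> s /andP[s0 s1]; apply: (corner_carpet d_gt0 cw); apply/(cell0P d_gt0) => i.
  have /andP[x0 x1] := x01 i; rewrite !mxE; apply/andP; split; nra.
rewrite (eq_bigr (fun i => x ord0 i)); last first.
  by move=> i _; rewrite mxE [w ord0 i + _]addrC addrK ger0_norm//; have /andP[] := x01 i.
apply: (@le_trans _ _ (\sum_(i < d) 1)); last by rewrite sumr_const card_ord.
by apply: ler_sum => i _; have /andP[] := x01 i.
Qed.

(** The factor [d] is the l^1 diameter of a unit cell, and [2 * d] is the factor of [cell_cost]. *)
Definition cell_diam : R := d%:R * (2 * d)%:R.

Lemma cell_reach n v (x : pt) : corner n v -> cell n x -> reach v (v + x) (cell_diam * 3 ^+ n).
Proof.
move=> cv cx; apply: (@cell_cost R d d_gt1 reach (fun=> True) d%:R) => //.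
- exact: reach_refl.
- exact: reach_trans.
- exact: reach_mono.
- by move=> w y cw _; exact: unit_cell_reach.
Qed.

Lemma cell_diam_gt0 : 0 < cell_diam.
Proof. by rewrite mulr_gt0// ltr0n ?muln_gt0. Qed.

Lemma reach_cell n v (x y : pt) : corner n v -> cell n (x - v) -> cell n (y - v) ->
  reach x y (2 * cell_diam * 3 ^+ n).
Proof.
move=> cv /(cell_reach cv) + /(cell_reach cv).
rewrite ![v + _]addrC !subrK => /reach_sym vx vy.
by rewrite -mulrA mulr2n mulrDl mul1r; exact: reach_trans vx vy.
Qed.

Lemma reach_exists (x y : pt) : carpet x -> carpet y -> exists L, reach x y L.
Proof.
move=> cx cy; have [n [xn yn]] := cell_monotone_cover cx cy.
by exists (2 * cell_diam * 3 ^+ n); apply: (@reach_cell n 0); rewrite ?subr0//; exact: corner_origin.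
Qed.

Lemma partition_sum (s : seq R) : itv_partition 0 1 s ->
  \sum_(k < size s) `|nth 0 s k - nth 0 (0 :: s) k| = 1.
Proof.
move=> [ps /eqP ls].
rewrite (eq_bigr (fun k : 'I_(size s) => nth 0 (0 :: s) k.+1 - nth 0 (0 :: s) k)); last first.
  move=> k _ /=; rewrite gtr0_norm// subr_gt0.
  by have /(pathP 0)/(_ k (ltn_ord k)) := ps.
rewrite -(big_mkord xpredT (fun k => nth 0 (0 :: s) k.+1 - nth 0 (0 :: s) k)).
by rewrite telescope_sumr// -last_nth ls subr0.
Qed.

Lemma lipschitz_continuous_rV (g : R -> pt) (L : R) : 0 <= L ->
  (forall s t, \sum_i `|g s ord0 i - g t ord0 i| <= L * `|s - t|) -> continuous g.
Proof.
move=> L0 gl t; apply/cvgrPdist_lt => e e0.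
have L1 : 0 < L + 1 by rewrite ltr_wpDl.
near=> s.
rewrite /Num.norm/= mx_normrE; apply/bigmax_ltP; split => // -[i j] _ /=.
rewrite [i]ord1 !mxE; apply: le_lt_trans (_ : L * `|t - s| < e).
  by apply: le_trans (gl t s); rewrite (bigD1 j)//= lerDl sumr_ge0.
have h : `|t - s| < e / (L + 1).
  near: s; exists (e / (L + 1)) => //=.
  exact: divr_gt0.
apply: (@le_lt_trans _ _ ((L + 1) * `|t - s|)); first by rewrite ler_wpM2r// lerDl.
by rewrite mulrC -ltr_pdivlMr.
Unshelve. all: by end_near. Qed.

Lemma reach_curve (x y : pt) (L : R) : reach x y L ->
  exists2 g, curves x y g & (curve_length g <= L%:E)%E.
Proof.
move=> [L0 [g [g0 gL gc gl]]]; exists (fun t => g (t * L)).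
  split; rewrite ?mul0r ?mul1r//.
  apply: continuous_subspaceT; apply: (lipschitz_continuous_rV L0) => s t.
  by apply: (le_trans (gl _ _)); rewrite -mulrBl normrM (ger0_norm L0) mulrC.
apply: ge_ereal_sup => _ [s /partition_sum s1 <-]; rewrite lee_fin.
rewrite -[leRHS]mul1r -s1 mulr_suml; apply: ler_sum => k _.
apply: (le_trans (eucl_le_l1 _)); rewrite (_ : `|nth 0 s k - nth 0 (0 :: s) k| * L = `|nth 0 s k * L - nth 0 (0 :: s) k * L|); last first.
  by rewrite -mulrBl normrM (ger0_norm L0).
by apply: le_trans (gl _ _); apply: ler_sum => i _; rewrite !mxE.
Qed.

Lemma curve_length_ge (x y : pt) g i : curves x y g ->
  (`|x ord0 i - y ord0 i|%:E <= curve_length g)%E.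
Proof.
move=> [_ g0 g1 _]; apply: le_ereal_sup_tmp; exists (eucl (g 1 - g 0))%:E.
  by exists [:: 1]; [split => //=; rewrite ?ltr01 ?eqxx|rewrite /= big_ord1].
rewrite lee_fin g0 g1; apply: le_trans (coord_le_eucl _ i).
by rewrite !mxE distrC.
Qed.

Lemma dX_reach (x y : pt) (L : R) : reach x y L -> dX x y <= L.
Proof.
move=> /reach_curve[g gxy gL]; rewrite /dX.
set I := ereal_inf _.
have IL : (I <= L%:E)%E by apply: le_trans gL; apply: ereal_inf_lbound; exists g.
have I0 : (0 <= I)%E.
  apply: le_ereal_inf_tmp => _ [h hxy <-].
  by apply: le_trans (curve_length_ge (Ordinal d_gt0) hxy); rewrite lee_fin.
have If : I \is a fin_num by rewrite fin_real// (lt_le_trans _ I0)//= (le_lt_trans IL) ?ltry.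
by rewrite -lee_fin fineK.
Qed.

(** A coordinate increment bounds the length of every curve from below. Existence of a curve of
    finite length makes the infimum finite; otherwise [fine] would turn [dX] into 0. *)
Lemma coord_le_dX (x y : pt) i : carpet x -> carpet y -> `|x ord0 i - y ord0 i| <= dX x y.
Proof.
move=> cx cy; have [L /reach_curve[g gxy gL]] := reach_exists cx cy; rewrite /dX.
set I := ereal_inf _.
have IL : (I <= L%:E)%E by apply: le_trans gL; apply: ereal_inf_lbound; exists g.
have I0 : (`|x ord0 i - y ord0 i|%:E <= I)%E.
  by apply: le_ereal_inf_tmp => _ [h hxy <-]; exact: curve_length_ge.
have If : I \is a fin_num.
  by rewrite fin_real// (lt_le_trans _ I0) ?ltNyr//= (le_lt_trans IL) ?ltry.
by rewrite -lee_fin fineK.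
Qed.

Lemma dX_cell n (x : pt) : cell n x -> dX 0 x <= cell_diam * 3 ^+ n.
Proof.
move=> xn; apply: dX_reach; rewrite -[x]add0r; apply: cell_reach => //.
exact: corner_origin.
Qed.

Lemma carpet0 : carpet (0 : pt).
Proof. exact: (corner_in_carpet d_gt1 (corner_origin 0)). Qed.

Lemma coord_le_dX0 (x : pt) i : carpet x -> x ord0 i <= dX 0 x.
Proof.
move=> cx; have := coord_le_dX i carpet0 cx; rewrite mxE sub0r normrN.
exact: le_trans (ler_norm _).
Qed.

Lemma dX0_ge0 (x : pt) : carpet x -> 0 <= dX 0 x.
Proof.
move=> cx; apply: le_trans (coord_le_dX0 (Ordinal d_gt0) cx).
exact: (carpet_ge0 d_gt0).
Qed.

End path_metric.

Section carpet_topology.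
Context {R : realType} {d : nat}.
Local Notation pt := 'rV[R]_d.

Lemma open_box (a b : 'I_d -> R) : open [set x : pt | forall i, a i < x ord0 i < b i].
Proof.
rewrite openE => x xab; apply: (@filter_forall _ _ _ (nbhs x)) => i.
have /andP[xa xb] := xab i.
have cx : (fun y : pt => y ord0 i) @ x --> x ord0 i by exact: coord_continuous.
have oab : open `]a i, b i[%classic by exact: interval_open.
have nb : nbhs (x ord0 i) `]a i, b i[%classic.
  by apply: open_nbhs_nbhs; split => //=; rewrite in_itv/= xa.
have := cx _ nb; rewrite /nbhs/= => h; near=> y.
have : `]a i, b i[%classic (y ord0 i) by near: y.
by rewrite /= in_itv.
Unshelve. all: by end_near. Qed.

Lemma open_hole m : open (@hole R d m).
Proof.
have -> : @hole R d m = \bigcup_k [set x | forall i,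
    3 ^+ m * (3 * (k i)%:R + 1) < x ord0 i < 3 ^+ m * (3 * (k i)%:R + 2)].
  by apply/seteqP; split => x [k]; [exists k|exists k].
by apply: bigcup_open => k _; exact: open_box.
Qed.

Hypothesis d_gt0 : (0 < d)%N.

Lemma measurable_carpet : measurable (@carpet R d : set (leb_space R d)).
Proof.
have -> : @carpet R d = (\bigcap_(i in [set: 'I_d]) ((fun x : pt => x ord0 i) @^-1` `[0, +oo[)) `&`
    ~` \bigcup_m @hole R d m.
  apply/seteqP; split => [x /(carpetP d_gt0)[x0 h]|x [x0 h]].
    split => [i _|[m _ /h]//]; by rewrite /= in_itv/= andbT x0.
  apply/(carpetP d_gt0); split => [i|m hm]; last by apply: h; exists m.
  by have := x0 i I; rewrite /= in_itv/= andbT.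
apply: measurableI.
  apply: fin_bigcap_measurable => // i _; rewrite -[X in measurable X]setTI.
  exact: measurable_coord.
apply: measurableC; apply: open_measurable_leb; apply: bigcup_open => m _; exact: open_hole.
Qed.

Lemma measurable_coord_ub (c : R) :
  measurable ([set x : pt | forall i, x ord0 i <= c] : set (leb_space R d)).
Proof.
have -> : [set x : pt | forall i, x ord0 i <= c] =
    \bigcap_(i in [set: 'I_d]) [set x : pt | x ord0 i <= c].
  by apply/seteqP; split => x h i; [move=> _; exact: h|exact: (h i I)].
by apply: fin_bigcap_measurable => // i _; exact: measurable_coord_le.
Qed.

Lemma measurable_coord_ltub (c : R) :
  measurable ([set x : pt | forall i, x ord0 i < c] : set (leb_space R d)).
Proof.
have -> : [set x : pt | forall i, x ord0 i < c] =
    \bigcap_(i in [set: 'I_d]) ((fun x : pt => x ord0 i) @^-1` `]-oo, c[).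
  apply/seteqP; split => x h i; first by move=> _; rewrite /= in_itv/=; exact: h.
  by have := h i I; rewrite /= in_itv.
apply: fin_bigcap_measurable => // i _; rewrite -[X in measurable X]setTI.
exact: measurable_coord.
Qed.

Lemma measurable_image_translate (v : pt) (A : set pt) :
  measurable (A : set (leb_space R d)) ->
  measurable ([set x + v | x in A] : set (leb_space R d)).
Proof.
move=> mA; have -> : [set x + v | x in A] = (fun x : pt => x + - v) @^-1` A.
  apply/seteqP; split => [_ [x xn <-]|x xn] /=; first by rewrite addrK.
  by exists (x - v) => //; rewrite subrK.
rewrite -[X in measurable X]setTI; exact: measurable_translate.
Qed.

Lemma measurable_cell n : measurable (@cell R d n : set (leb_space R d)).
Proof.
have -> : @cell R d n = @carpet R d `&` [set x | forall i, x ord0 i <= 3 ^+ n] by [].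
by apply: measurableI; [exact: measurable_carpet|exact: measurable_coord_ub].
Qed.

End carpet_topology.

(** * Volume of cells and of balls *)

Section carpet_volume.
Context {R : realType} {d : nat}.
Local Notation pt := 'rV[R]_d.
Local Notation lam := (@leb R d).
Hypothesis d_gt1 : (1 < d)%N.
Let d_gt0 : (0 < d)%N. Proof. exact: ltnW. Qed.

Definition children : R := 3 ^+ d - 1.

Definition child_set : {set {ffun 'I_d -> 'I_3}} := [set j : {ffun 'I_d -> 'I_3} | [exists i, (j i : nat) != 1%N]]%SET.

Lemma children_ge2 : 2 <= children.
Proof.
have : 3 ^+ 1 <= 3 ^+ d :> R by rewrite ler_weXn2l// ler1n.
by rewrite /children expr1; lra.
Qed.

Lemma children_gt0 : 0 < children.
Proof. by have := children_ge2; lra. Qed.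

Lemma card_child_set : #|child_set|%:R = children.
Proof.
pose one : {ffun 'I_d -> 'I_3} := [ffun=> inord 1].
have -> : child_set = finset.setC (finset.set1 one).
  apply/setP => j; rewrite !inE; apply/existsP/idP => [[i ji]|jone].
    by apply/negP => /eqP jE; move: ji; rewrite jE ffunE inordK.
  apply: contrapT => h; move/negP: jone; apply; apply/eqP/ffunP => i.
  apply/val_inj => /=; rewrite ffunE inordK//; apply/eqP/negPn/negP => ji.
  by apply: h; exists i.
rewrite cardsC1 card_ffun !card_ord -subn1 natrB ?expn_gt0//.
by rewrite /children natrX.
Qed.

Definition child_offset (j : {ffun 'I_d -> 'I_3}) n : pt := offset (fun i => j i : nat) n.

Lemma child_setP (j : {ffun 'I_d -> 'I_3}) : j \in child_set -> child_index (fun i => j i : nat).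
Proof.
rewrite inE => /existsP[i ji]; split; last by exists i.
by move=> k; have := ltn_ord (j k).
Qed.

Lemma sum_child_set (c : R) :
  (\sum_(j \in [set j | j \in child_set]) c%:E)%E = (children * c)%:E.
Proof.
have -> : [set j | j \in child_set] = [set` enum child_set].
  by apply/seteqP; split => j /=; rewrite mem_enum.
rewrite -fsbig_seq ?enum_uniq// big_enum/= sumEFin sumr_const; congr (_%:E).
by rewrite -card_child_set mulr_natl.
Qed.

Lemma leb_cell_le n : (lam (cell n) <= (children ^+ n)%:E)%E.
Proof.
elim: n => [|n IH].
  rewrite expr0; apply: (@le_trans _ _ (lam (box (Some (0, const_mx 1))))).
    apply: le_leb => x /(cell0P d_gt0) x01 i; rewrite !mxE; exact: x01.
  rewrite leb_box; last by move=> i; rewrite !mxE.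
  by rewrite lee_fin big1// => i _; rewrite !mxE subr0.
have finJ : finite_set [set j | j \in child_set] by exact: finite_finset.
pose F j := [set x + child_offset j n | x in @cell R d n].
have mF j : measurable (F j : set (leb_space R d)) by apply: measurable_image_translate; exact: measurable_cell.
apply: (le_trans (@content_sub_fsum _ _ _ lam _ _ _ F finJ _ _ _)) => //.
- exact: measurable_cell.
- move=> x /(cell_parent d_gt0)[j [[j2 [i0 ji0]] xj]].
  have jE : offset j n = child_offset [ffun i => inord (j i)] n :> pt.
    by apply/rowP => i; rewrite !mxE ffunE inordK// ltnS j2.
  exists [ffun i => inord (j i)].
    by rewrite /= inE; apply/existsP; exists i0; rewrite ffunE inordK ?ltnS.
  by rewrite /F -jE; exists (x - offset j n); rewrite ?subrK.
- apply: (@le_trans _ _ (\sum_(j \in [set j | j \in child_set]) (children ^+ n)%:E)%E).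
    by apply: lee_fsum => // j _; apply: (le_trans _ IH); rewrite -(leb_translate (child_offset j n) (cell n)).
  by rewrite sum_child_set exprS.
Qed.

(* Half-open, so that distinct children are disjoint. *)
Definition hcell n : set pt := @cell R d n `&` [set x | forall i, x ord0 i < 3 ^+ n].

(** The factor [2 ^- d] comes from the base case only, where a closed box of side 1/2 stands in for
    the half-open unit cube. The induction step adds up disjoint children without loss. *)
Lemma leb_hcell_ge n : ((2 ^- d * children ^+ n)%:E <= lam (hcell n))%E.
Proof.
elim: n => [|n IH].
  rewrite expr0 mulr1; apply: (@le_trans _ _ (lam (box (Some (0, const_mx (2^-1)))))).
    rewrite leb_box; last by move=> i; rewrite !mxE.
    rewrite lee_fin (eq_bigr (fun=> 2^-1)); last by move=> i _; rewrite !mxE subr0.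
    by rewrite prodr_const card_ord exprVn.
  apply: le_leb => x xb; split.
    by apply/(cell0P d_gt0) => i; have := xb i; rewrite !mxE => /andP[-> /le_trans]; apply; lra.
  by move=> i; have := xb i; rewrite !mxE expr0 => /andP[_ /le_lt_trans]; apply; lra.
have finJ : finite_set [set j | j \in child_set] by exact: finite_finset.
pose F j := [set x + child_offset j n | x in hcell n].
have mF j : measurable (F j : set (leb_space R d)).
  apply: measurable_image_translate; apply: measurableI; first exact: measurable_cell.
  exact: measurable_coord_ltub.
apply: (@le_trans _ _ (lam (\bigcup_(j in [set j | j \in child_set]) F j))); last first.
  apply: le_leb => _ [j /= /child_setP jP [x [xn xl] <-]]; split.
    by rewrite addrC; exact: cell_child.
  move=> i; rewrite !mxE exprS; have xi := xl i.
  have : (j i)%:R <= 2 :> R by rewrite (ler_nat _ _ 2); have [] := jP.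
  by move=> /(ler_wpM2l (ltW (exp3_gt0 (R := R) n))); lra.
rewrite measure_fin_bigcup//.
  apply: (@le_trans _ _ (\sum_(j \in [set j | j \in child_set]) (2 ^- d * children ^+ n)%:E)%E).
    by rewrite sum_child_set exprS mulrCA.
  by apply: lee_fsum => // j _; apply: (le_trans IH); rewrite le_eqVlt -(leb_translate (child_offset j n)) eqxx.
apply/trivIsetP => j k _ _ jk; apply/seteqP; split => // z [[x [xn xl] <-] [y [yn yl] xy]].
apply: (negP jk); apply/eqP/ffunP => i; apply/val_inj => /=.
have /(congr1 (fun z : pt => z ord0 i)) := xy; rewrite !mxE => xyi.
have x0 := carpet_ge0 d_gt0 i (cell_sub_carpet xn).
have y0 := carpet_ge0 d_gt0 i (cell_sub_carpet yn).
have xi := xl i; have yi := yl i; have t0 := exp3_gt0 (R := R) n.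
move: xyi x0 y0 xi yi t0; move: (3 ^+ n) (x ord0 i) (y ord0 i) => t a b e a0 b0 at_ bt t0.
have h1 : (j i)%:R < (k i)%:R + 1 :> R by rewrite -(ltr_pM2l t0) mulrDr mulr1; lra.
have h2 : (k i)%:R < (j i)%:R + 1 :> R by rewrite -(ltr_pM2l t0) mulrDr mulr1; lra.
by move: h1 h2; rewrite !natr1 !ltr_nat !ltnS => h1 h2; apply/eqP; rewrite eqn_leq h1.
Qed.

(** The ball lies in a box of half-side [r], so its measure is finite and survives [fine] in
    [vol]. *)
Lemma vol_lower_bound (x : pt) (r v : R) (A : set pt) : carpet x ->
  (forall y, A y -> carpet y /\ dX x y < r) -> (v%:E <= lam A)%E -> v <= vol x r.
Proof.
move=> cx Ar vA; rewrite /vol.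
set B := _ `&` _.
have AB : (v%:E <= lam B)%E by apply: le_trans vA _; apply: le_leb => y /Ar.
have Boo : (lam B < +oo)%E.
  apply: (@le_lt_trans _ _ (lam (box (Some (x - const_mx r, x + const_mx r))))).
    apply: le_leb => y [cy /= xyr] i; rewrite !mxE.
    have := coord_le_dX d_gt1 i cx cy; rewrite ler_distl => /andP[]; lra.
  by apply: le_lt_trans (leb_box_le _ _) _; rewrite /= ltry.
have Bf : lam B \is a fin_num by rewrite ge0_fin_numE.
by rewrite -lee_fin fineK.
Qed.

Lemma unit_cell_convex (v x y : pt) s : 0 <= s <= 1 -> corner 0 v ->
  cell 0 (x - v) -> cell 0 (y - v) -> carpet (x + s *: (y - x)).
Proof.
move=> /andP[s0 s1] cv /(cell0P d_gt0) x01 /(cell0P d_gt0) y01.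
have -> : x + s *: (y - x) = v + (x + s *: (y - x) - v) by rewrite [RHS]addrC subrK.
apply: (corner_carpet d_gt0 cv); apply/(cell0P d_gt0) => i.
have := x01 i; have := y01 i; rewrite !mxE => /andP[? ?] /andP[? ?].
by apply/andP; split; nra.
Qed.

(** A box of side [e] that contains [x] and stays in a unit cell around [x] lies in the ball, since
    segments inside the unit cell have l^1 length at most [d * e < c]. *)
Lemma vol_ge_small (c : R) : 0 < c -> exists2 k : R, 0 < k <= 1 &
  forall (x : pt) r, carpet x -> c <= r -> k <= vol x r.
Proof.
move=> c0; pose e := Num.min 1 (c / (2 * d%:R)).
have d0 : 0 < d%:R :> R by rewrite ltr0n.
have e0 : 0 < e by rewrite lt_min ltr01 divr_gt0// mulr_gt0.
have e1 : e <= 1 by rewrite ge_min lexx.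
have ed : d%:R * e < c.
  apply: (@le_lt_trans _ _ (c / 2)); last by lra.
  have : e <= c / (2 * d%:R) by rewrite ge_min lexx orbT.
  by rewrite invfM mulrA ler_pdivlMr// mulrC.
exists (e ^+ d) => [|x r cx cr]; first by rewrite exprn_gt0//= exprn_ile1// ltW.
have [v cv xv] := corner_exists d_gt0 0 cx.
have x01 := (cell0P d_gt0 _).1 xv.
(* Near an upper face of the unit cell the box is pushed back so as to stay inside while still
   containing [x]. *)
pose lo : pt := \row_i (v ord0 i + Num.min (x ord0 i - v ord0 i) (1 - e)).
apply: (@vol_lower_bound _ _ _ (box (Some (lo, lo + const_mx e)))) => //; last first.
  rewrite leb_box; last by move=> i; rewrite !mxE lerDl ltW.
  rewrite lee_fin (eq_bigr (fun=> e)); last by move=> i _; rewrite !mxE; ring.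
  by rewrite prodr_const card_ord.
move=> y ylo.
have loP i : [/\ v ord0 i <= lo ord0 i, lo ord0 i <= x ord0 i,
    x ord0 i <= lo ord0 i + e & lo ord0 i + e <= v ord0 i + 1].
  have := x01 i; rewrite !mxE => /andP[x0 x1].
  by case: (leP (x ord0 i - v ord0 i) (1 - e)) => h; split; lra.
have yv : cell 0 (y - v).
  apply/(cell0P d_gt0) => i; have [] := loP i; have := ylo i; rewrite !mxE/= => /andP[]; lra.
split.
  rewrite -(subrK v y) addrC; exact: (corner_carpet d_gt0 cv).
apply: (@le_lt_trans _ _ (d%:R * e)); last exact: lt_le_trans cr.
apply: (dX_reach d_gt1); apply: segment_reach; first exact: mulr_gt0.
  by move=> s s01; exact: (unit_cell_convex s01 cv).
apply: (@le_trans _ _ (\sum_(i < d) e)); last by rewrite sumr_const card_ord mulr_natl.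
apply: ler_sum => i _; have [] := loP i; have := ylo i; rewrite /= [(_ + const_mx e) _ _]mxE [const_mx e _ _]mxE.
by rewrite ler_distl => /andP[]; lra.
Qed.

(** [j] is such that a copy of cell [m - j] has diameter less than [c * 3 ^+ m]; the copy that
    contains [x] lies in the ball. For [m < j] the bound of [vol_ge_small] is enough. *)
Lemma vol_ge (c : R) : 0 < c -> exists2 k : R, 0 < k &
  forall m (x : pt) r, carpet x -> c * 3 ^+ m <= r -> k * children ^+ m <= vol x r.
Proof.
move=> c0; have [k /andP[k0 k1] ksmall] := vol_ge_small c0.
have D0 := @cell_diam_gt0 R d d_gt1.
have [j jc] : exists j, 2 * @cell_diam R d < c * 3 ^+ j.
  have h0 : 0 <= 2 * @cell_diam R d / c by rewrite divr_ge0 ?mulr_ge0// ltW.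
  exists (Num.bound (2 * @cell_diam R d / c)).
  rewrite [ltRHS]mulrC -ltr_pdivrMr//; apply: (lt_le_trans (archi_boundP h0)).
  by rewrite -natrX ler_nat ltnW// ltn_expl.
have N0 := children_gt0; have p2 : 0 < 2 ^- d :> R by rewrite invr_gt0 exprn_gt0.
have p21 : 2 ^- d <= 1 :> R by rewrite invf_le1 ?exprn_gt0// exprn_ege1// ler1n.
exists (k * 2 ^- d / children ^+ j) => [|m x r cx cr].
  by rewrite divr_gt0 ?exprn_gt0// mulr_gt0.
have [jm|mj] := leqP j m; last first.
  apply: (@le_trans _ _ k); last first.
    by apply: ksmall => //; apply: le_trans cr; rewrite ler_peMr ?(ltW c0)// exprn_ege1// ler1n.
  have q1 : children ^+ m / children ^+ j <= 1.
    rewrite ler_pdivrMr ?exprn_gt0// mul1r ler_weXn2l ?(ltnW mj)//.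
    by have := children_ge2; lra.
  rewrite (_ : _ * _ = k * (2 ^- d * (children ^+ m / children ^+ j))); last by ring.
  rewrite -[leRHS]mulr1 ler_wpM2l ?(ltW k0)//.
  by rewrite -[leRHS]mulr1 ler_pM// ?ltW ?mulr_gt0 ?invr_gt0 ?exprn_gt0.
have [v cv xv] := corner_exists d_gt0 (m - j) cx.
apply: (@vol_lower_bound _ _ _ [set y + v | y in cell (m - j)]) => //.
  move=> _ [y yc <-]; split; first by rewrite addrC; exact: (corner_carpet d_gt0 cv).
  apply: le_lt_trans (_ : 2 * @cell_diam R d * 3 ^+ (m - j) < r).
    by apply: (dX_reach d_gt1); apply: (reach_cell d_gt1 cv xv); rewrite addrK.
  apply: lt_le_trans cr; rewrite -[in ltRHS](subnK jm) addnC exprD mulrA.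
  by rewrite ltr_pM2r ?exprn_gt0.
rewrite leb_translate; apply: (@le_trans _ _ (2 ^- d * children ^+ (m - j))%:E).
  rewrite lee_fin -[in leLHS](subnK jm) exprD mulrACA mulrA divfK ?gt_eqF ?exprn_gt0//.
  rewrite ler_wpM2r ?exprn_ge0 ?(ltW N0)//.
  by rewrite -[leRHS]mul1r ler_wpM2r ?(ltW p2).
apply: (le_trans (leb_hcell_ge _)); apply: le_leb; exact: subIsetl.
Qed.

End carpet_volume.

(** * Geometric series, weights and total mass *)

Section series_bounds.
Context {R : realType}.

Lemma geometric_nneseries (a q : R) : 0 <= a -> 0 <= q < 1 ->
  (\sum_(k <oo) (a * q ^+ k)%:E <= (a / (1 - q))%:E)%E.
Proof.
move=> a0 /andP[q0 q1]; apply: lime_le.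
  by apply: is_cvg_nneseries => k _ _; rewrite lee_fin mulr_ge0// exprn_ge0.
apply: nearW => n; rewrite sumEFin lee_fin -mulr_sumr ler_wpM2l//.
have q10 : 0 < 1 - q by rewrite subr_gt0.
rewrite -div1r ler_pdivlMr// mulrC big_mkord.
have -> : (1 - q) * \sum_(i < n) q ^+ i = 1 - q ^+ n.
  by rewrite -opprB mulNr -subrX1 opprB.
by rewrite gerBl exprn_ge0.
Qed.

Lemma tail_nneseries (a q : R) n : 0 <= a -> 0 <= q < 1 ->
  (\sum_(k <oo) (a * q ^+ (n + k))%:E <= (a * q ^+ n / (1 - q))%:E)%E.
Proof.
move=> a0 q01; under eq_eseriesr do rewrite exprD mulrA.
by apply: geometric_nneseries => //; rewrite mulr_ge0// exprn_ge0//; case/andP: q01.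
Qed.

Lemma integral_scaled_indic {dT : measure_display} {T : measurableType dT}
    (mu : {measure set T -> \bar R}) (c : R) (A : set T) : 0 <= c -> measurable A ->
  (\int[mu]_x (c * \1_A x)%:E = c%:E * mu A)%E.
Proof.
move=> c0 mA; under eq_integral do rewrite EFinM.
rewrite ge0_integralZl_EFin//; last exact/measurable_EFinP/measurable_indic.
by rewrite integral_indic// setIT.
Qed.

End series_bounds.

Section weights.
Context {R : realType} {d : nat}.
Local Notation pt := 'rV[R]_d.
Local Notation lam := (@leb R d).
Local Notation N := (@children R d).
Hypothesis d_gt1 : (1 < d)%N.
Let d_gt0 : (0 < d)%N. Proof. exact: ltnW. Qed.

Lemma powR1E (p : R) : 1 `^ p = 1.
Proof. by rewrite powR1. Qed.

Lemma powR_exp3 (p : R) k : (3 ^+ k) `^ p = (3 `^ p) ^+ k.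
Proof. by rewrite -powR_mulrn// -powRrM mulrC powRrM powR_mulrn// powR_ge0. Qed.

Lemma powR3_gt0 (p : R) : 0 < 3 `^ p.
Proof. by rewrite powR_gt0. Qed.

Lemma powR3_ge1 (p : R) : 0 < p -> 1 <= 3 `^ p.
Proof. by move=> p0; rewrite -[leLHS](powR1E p) ge0_ler_powR ?nnegrE ?(ltW p0) ?ler1n. Qed.

Lemma weight_ge1 (p : R) (x : pt) : 1 <= weight p x.
Proof. by rewrite le_max lexx. Qed.

Lemma weight_gt0 (p : R) (x : pt) : 0 < weight p x.
Proof. exact: lt_le_trans (weight_ge1 p x). Qed.

Lemma weight_inv_ge0 (p : R) (x : pt) : 0 <= (weight p x)^-1.
Proof. by rewrite invr_ge0 ltW// weight_gt0. Qed.

Lemma weight_inv_le1 (p : R) (x : pt) : (weight p x)^-1 <= 1.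
Proof. by rewrite invf_le1 ?weight_ge1 ?weight_gt0. Qed.

Lemma le_weight (p q : R) (x : pt) : carpet x -> 0 < p -> p <= q -> weight p x <= weight q x.
Proof.
move=> cx p0 pq; rewrite /weight ge_max le_max lexx/= le_max.
have [d1|d1] := leP 1 (dX 0 x); first by rewrite ler_powR ?orbT.
apply/orP; left; rewrite -[leRHS](powR1E p) ge0_ler_powR ?nnegrE ?(ltW p0) ?(ltW d1)//.
exact: (dX0_ge0 d_gt1).
Qed.

Lemma weight_ge_coord (p : R) (x : pt) i k : 0 < p -> carpet x -> 3 ^+ k <= x ord0 i ->
  (3 `^ p) ^+ k <= weight p x.
Proof.
move=> p0 cx xi; rewrite -powR_exp3 le_max; apply/orP; right.
have h : 3 ^+ k <= dX 0 x by apply: le_trans xi _; exact: (coord_le_dX0 d_gt1).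
rewrite ge0_ler_powR ?nnegrE ?(ltW p0) ?exprn_ge0//.
exact: le_trans h.
Qed.

Lemma cell_diam_ge1 : 1 <= @cell_diam R d.
Proof. by rewrite /cell_diam -natrM (ler_nat _ 1) muln_gt0 d_gt0/= muln_gt0. Qed.

Definition weight_const (p : R) : R := @cell_diam R d `^ p.

Lemma weight_const_gt0 p : 0 < weight_const p.
Proof. by rewrite powR_gt0// (lt_le_trans ltr01)// cell_diam_ge1. Qed.

Lemma weight_le_cell (p : R) (x : pt) k : 0 < p -> cell k x ->
  weight p x <= weight_const p * (3 `^ p) ^+ k.
Proof.
move=> p0 xk; have D1 := cell_diam_ge1; have D0 : 0 <= @cell_diam R d by lra.
have k1 : 1 <= 3 ^+ k :> R by rewrite exprn_ege1// ler1n.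
rewrite -powR_exp3 /weight_const -powRM ?exprn_ge0// ge_max; apply/andP; split.
  rewrite -[leLHS](powR1E p) ge0_ler_powR ?nnegrE ?(ltW p0) ?mulr_ge0 ?exprn_ge0//.
  by rewrite -[X in X <= _]mulr1; apply: ler_pM.
rewrite ge0_ler_powR ?nnegrE ?(ltW p0) ?mulr_ge0 ?exprn_ge0//.
  by apply: (dX0_ge0 d_gt1); exact: cell_sub_carpet xk.
exact: (dX_cell d_gt1).
Qed.

Lemma not_cell k (x : pt) : carpet x -> ~ cell k x -> exists i, 3 ^+ k < x ord0 i.
Proof.
move=> cx nk; apply: contrapT => /forallNP h; apply: nk; split => // i.
by rewrite leNgt; apply/negP; exact: h.
Qed.

(** For the least cell containing [x], of index [k.+1], some coordinate exceeds [3 ^+ k]. The factor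
    [3 ^ p] pays for the shift of the index and covers the case of cell 0. *)
Lemma weight_inv_cell (p : R) (x : pt) : 0 < p -> carpet x ->
  exists2 k, cell k x & (weight p x)^-1 <= 3 `^ p * (3 `^ p) ^- k.
Proof.
move=> p0 cx; have ex : exists k, `[< cell k x >].
  by have [k xk] := carpet_cell cx; exists k; apply/asboolP.
case: (ex_minnP ex) => k /asboolP xk kmin; exists k => //.
have B1 : 1 <= 3 `^ p :> R by exact: powR3_ge1.
case: k xk kmin => [|k] xk kmin.
  by rewrite expr0 invr1 mulr1; apply: le_trans (weight_inv_le1 p x) B1.
have [i xi] : exists i, 3 ^+ k < x ord0 i.
  apply: (not_cell cx) => xk'; have := kmin k; rewrite ltnn => H.
  by have := H (introT (asboolP _) xk').
have := weight_ge_coord p0 cx (ltW xi) => wk.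
rewrite exprS invfM mulrA divff ?gt_eqF ?powR3_gt0// mul1r.
by rewrite lef_pV2 ?posrE ?exprn_gt0 ?powR3_gt0 ?weight_gt0.
Qed.

(** The form in which integrals are read off cell by cell: the dominating series is measurable, and
    cell [e k] has volume at most [N ^+ e k]. *)
Lemma integral_le_cells (D : set pt) (f : pt -> \bar R) (c : nat -> R) (e : nat -> nat) :
  (forall k, 0 <= c k) ->
  (forall x, D x -> (0 <= f x <= \sum_(k <oo) (c k * \1_(cell (e k)) x)%:E)%E) ->
  (\int[lam]_(x in D) f x <= \sum_(k <oo) (c k * N ^+ e k)%:E)%E.
Proof.
move=> c0 fc.
have s0 x k : (0 <= (c k * \1_(@cell R d (e k)) x)%:E)%E by rewrite lee_fin mulr_ge0.
apply: (@le_trans _ _ (\int[lam]_x (\sum_(k <oo) (c k * \1_(@cell R d (e k)) x)%:E))%E).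
  by apply: le_integral_ge0 => // x _; apply: nneseries_ge0 => *; exact: s0.
have mI k : measurable_fun setT (\1_(cell (e k) : set (leb_space R d)) : leb_space R d -> R).
  by apply: measurable_indic; exact: measurable_cell.
have mi k : measurable_fun setT (fun x : leb_space R d => (c k * \1_(@cell R d (e k)) x)%:E).
  exact/measurable_EFinP/(measurable_funM (measurable_cst (c k)) (mI k)).
rewrite integral_nneseries//.
apply: lee_nneseries => k _; first by move=> _; apply: integral_ge0.
rewrite integral_scaled_indic//; last exact: measurable_cell.
by rewrite EFinM lee_wpmul2l ?lee_fin// leb_cell_le.
Qed.

Lemma nneseries_term (u : nat -> R) k : (forall j, 0 <= u j) ->
  ((u k)%:E <= \sum_(j <oo) (u j)%:E)%E.
Proof.
move=> u0; rewrite (nneseries_split _ k.+1); last by move=> *; rewrite lee_fin.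
rewrite add0n big_nat_recr//= -[leLHS]adde0; apply: leeD; last first.
  by apply: nneseries_ge0 => *; rewrite lee_fin.
by rewrite leeDr// sume_ge0// => *; rewrite lee_fin.
Qed.

Lemma m_a0 (a : pt -> R) : @m_a R d a set0 = 0%E.
Proof. by rewrite /m_a setI0 integral_set0. Qed.

Lemma le_m_a (a : pt -> R) (A B : set pt) : (forall x, 0 <= a x) -> A `<=` B ->
  (m_a a A <= m_a a B)%E.
Proof.
move=> a0 AB; apply: le_integral_ge0.
- by move=> x [cx /AB].
- by move=> x _; rewrite lee_fin invr_ge0 a0 lexx.
- by move=> x _; rewrite lee_fin invr_ge0 a0.
Qed.

Lemma m_a_le_leb (a : pt -> R) (A : set pt) : (forall x, 1 <= a x) ->
  measurable (A : set (leb_space R d)) -> (m_a a A <= lam A)%E.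
Proof.
move=> a1 mA; have a0 x : 0 < a x := lt_le_trans ltr01 (a1 x).
apply: (@le_trans _ _ (\int[lam]_(x in A) 1)%E); last by rewrite integral_cst ?mul1e.
apply: le_integral_ge0 => // x _.
by rewrite !lee_fin invr_ge0 ltW//= invf_le1.
Qed.

Lemma ln_children : ln N = dim_f R d * ln 3.
Proof. by rewrite /dim_f divfK// gt_eqF// ln_gt0// ltr1n. Qed.

Lemma powR3_dim : 3 `^ (dim_f R d) = N.
Proof.
by rewrite /powR gt_eqF// -ln_children lnK// posrE; exact: children_gt0.
Qed.

Lemma powR3_lt (p q : R) : p < q -> 3 `^ p < 3 `^ q.
Proof. by move=> pq; rewrite /powR !gt_eqF// ltr_expR ltr_pM2r// ln_gt0// ltr1n. Qed.

Lemma powR3_le (p q : R) : p <= q -> 3 `^ p <= 3 `^ q.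
Proof. by move=> pq; rewrite ler_powR ?ler1n. Qed.

Lemma m_a_carpet_lty (p : R) : 0 < p -> dim_f R d < p -> exists2 C : R, 0 <= C &
  forall A : set pt, (m_a (weight p) A <= C%:E)%E.
Proof.
move=> p0 dp; have NB : N < 3 `^ p by rewrite -powR3_dim powR3_lt.
have N0 := @children_gt0 R d d_gt1; have B0 := powR3_gt0 p.
exists (3 `^ p / (1 - N / 3 `^ p)) => [|A].
  by rewrite divr_ge0 ?(ltW B0)// subr_ge0 ler_pdivrMr// mul1r ltW.
apply: (@le_trans _ _ (\int[lam]_(x in @carpet R d) ((weight p x)^-1)%:E)%E).
  apply: le_integral_ge0.
  - by move=> x [].
  - by move=> x _; rewrite lee_fin weight_inv_ge0 lexx.
  - by move=> x _; rewrite lee_fin weight_inv_ge0.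
pose c k : R := 3 `^ p * (3 `^ p) ^- k.
have c0 k : 0 <= c k by rewrite mulr_ge0 ?invr_ge0 ?exprn_ge0 ?(ltW B0).
apply: (le_trans (@integral_le_cells _ _ c id c0 _)).
  move=> x cx; rewrite lee_fin weight_inv_ge0/=.
  have [k xk wk] := weight_inv_cell p0 cx.
  apply: le_trans (_ : (c k * \1_(@cell R d k) x)%:E <= _)%E.
    by rewrite lee_fin indicE mem_set// mulr1.
  by apply: (@nneseries_term (fun k => c k * \1_(@cell R d k) x)) => j; rewrite mulr_ge0.
rewrite (eq_eseriesr (g := fun k => (3 `^ p * (N / 3 `^ p) ^+ k)%:E)).
  apply: geometric_nneseries; first exact: ltW.
  by rewrite divr_ge0 ?(ltW N0) ?(ltW B0)//= ltr_pdivrMr// mul1r.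
by move=> k _; rewrite /c expr_div_n -mulrA [(3 `^ p) ^- k * _]mulrC.
Qed.

(* Pairwise disjoint translates of [hcell k], at distance of order [3 ^ k] from
   the origin. *)
Definition shell (i0 : 'I_d) k : set pt :=
  [set x + offset (fun i => 2 * unit_index i0 i)%N k | x in hcell k].

Lemma shell_sub i0 k (x : pt) : shell i0 k x -> cell k.+1 x /\ 2 * 3 ^+ k <= x ord0 i0.
Proof.
move=> [y [yk _] <-]; split.
  rewrite addrC; apply: (cell_child d_gt0) => //.
  exact: (child_index_axis d_gt1).
rewrite !mxE /unit_index eqxx muln1 mulrC lerDr.
by apply: (carpet_ge0 d_gt0); exact: cell_sub_carpet yk.
Qed.

Lemma leb_shell_ge i0 k : ((2 ^- d * N ^+ k)%:E <= lam (shell i0 k))%E.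
Proof. by rewrite /shell leb_translate; exact: leb_hcell_ge. Qed.

Lemma measurable_shell i0 k : measurable (shell i0 k : set (leb_space R d)).
Proof.
apply: measurable_image_translate; apply: measurableI; first exact: measurable_cell.
exact: measurable_coord_ltub.
Qed.

Lemma shell_disjoint i0 j k (x : pt) : shell i0 j x -> shell i0 k x -> j = k.
Proof.
suff H j' k' : shell i0 j' x -> shell i0 k' x -> (k' <= j')%N.
  by move=> xj xk; apply/eqP; rewrite eqn_leq !H.
move=> /shell_sub[[_ /(_ i0) xj] _] /shell_sub[_ xk]; rewrite leqNgt; apply/negP => jk.
have : 3 ^+ j'.+1 <= 3 ^+ k' :> R by rewrite ler_weXn2l// ler1n.
have := exp3_gt0 (R := R) k'; lra.
Qed.

(** Shell [k] has volume at least [2 ^- d * N ^+ k] and weight at most a multiple of [3 ^ (p k.+1)].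
    As [3 ^ p <= N], each shell carries mass at least [C], and [n] disjoint shells give [n C]. *)
Lemma m_a_carpet_infty (p : R) : 0 < p -> p <= dim_f R d ->
  m_a (weight p) (@carpet R d) = +oo%E.
Proof.
move=> p0 pd; have BN : 3 `^ p <= N by rewrite -powR3_dim powR3_le.
have N0 := @children_gt0 R d d_gt1; have B0 := powR3_gt0 p; have W0 := weight_const_gt0 p.
pose i0 := Ordinal d_gt0.
pose c k : R := (weight_const p * (3 `^ p) ^+ k.+1)^-1.
have c0 k : 0 <= c k by rewrite invr_ge0 mulr_ge0 ?exprn_ge0 ?ltW.
pose C : R := (weight_const p * 3 `^ p)^-1 * 2 ^- d.
have C0 : 0 < C by rewrite mulr_gt0 ?invr_gt0 ?exprn_gt0// mulr_gt0.
have mS k : measurable_fun setT (\1_(shell i0 k : set (leb_space R d)) : leb_space R d -> R).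
  by apply: measurable_indic; exact: measurable_shell.
have mi k : measurable_fun setT (fun x : leb_space R d => (c k * \1_(shell i0 k) x)%:E).
  exact/measurable_EFinP/(measurable_funM (measurable_cst (c k)) (mS k)).
have s0 k (x : pt) : (0 <= (c k * \1_(shell i0 k) x)%:E)%E by rewrite lee_fin mulr_ge0.
have key n : ((C *+ n)%:E <= m_a (weight p) (@carpet R d))%E.
  apply: (@le_trans _ _ (\int[lam]_x \sum_(k <- index_iota 0 n) (c k * \1_(shell i0 k) x)%:E)%E).
    rewrite ge0_integral_sum//.
    rewrite -[n in (C *+ n)](subn0 n) -sumr_const_nat -sumEFin; apply: lee_sum => k _.
    rewrite integral_scaled_indic//; last exact: measurable_shell.
    apply: (@le_trans _ _ ((c k)%:E * (2 ^- d * N ^+ k)%:E)%E); last first.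
      by apply: lee_wpmul2l; [rewrite lee_fin|exact: leb_shell_ge].
    rewrite -EFinM lee_fin /C /c exprS mulrA (invfM (_ * _)) -mulrA ler_pM2l ?invr_gt0 ?mulr_gt0//.
    rewrite mulrCA -[leLHS]mulr1 ler_pM2l ?invr_gt0 ?exprn_gt0//.
    by rewrite mulrC ler_pdivlMr ?exprn_gt0// mul1r lerXn2r ?nnegrE ?(ltW B0) ?(ltW N0).
  apply: le_integral_restrict => x; rewrite patch_setT /patch.
  rewrite sume_ge0//=.
  have zero : ~ @carpet R d x -> (\sum_(k <- index_iota 0 n) (c k * \1_(shell i0 k) x)%:E <= 0)%E.
    move=> ncx; rewrite big1// => k _; rewrite indicE memNset ?mulr0// => /shell_sub[xk _].
    by apply: ncx; exact: cell_sub_carpet xk.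
  case: ifPn => [/set_mem[cx _]|]; last first.
    by rewrite notin_setE => ncx; apply: zero => cx; apply: ncx.
  have [[j [jn xj]]|none] := pselect (exists j, (j < n)%N /\ shell i0 j x); last first.
    rewrite big_seq big1 ?lee_fin ?weight_inv_ge0// => k; rewrite mem_index_iota => /andP[_ kn].
    by rewrite indicE memNset ?mulr0// => xk; apply: none; exists k.
  rewrite big_mkord (bigD1 (Ordinal jn))//= big1 ?adde0.
    rewrite indicE mem_set// mulr1 lee_fin /c lef_pV2 ?posrE ?weight_gt0//.
      by apply: weight_le_cell => //; have [] := shell_sub xj.
    by rewrite mulr_gt0 ?exprn_gt0.
  move=> k kj; rewrite indicE memNset ?mulr0// => xk; move/negP: kj; apply.
  by apply/eqP/val_inj => /=; exact: shell_disjoint xk xj.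
apply/eqP; rewrite eq_le leey/= leNgt; apply/negP => moo.
have m0 : (0 <= m_a (weight p) (@carpet R d))%E by apply: (le_trans _ (key 0%N)); rewrite mulr0n.
have mf : m_a (weight p) (@carpet R d) \is a fin_num by rewrite ge0_fin_numE.
have := key (Num.bound (fine (m_a (weight p) (@carpet R d)) / C)).
rewrite -[X in (_ <= X)%E](fineK mf) lee_fin -mulr_natl leNgt => /negP; apply.
rewrite -ltr_pdivrMr//; apply: archi_boundP; rewrite divr_ge0 ?(ltW C0)//.
exact: fine_ge0.
Qed.

End weights.

(** * Test functions *)

Section partial_derivatives.
Context {R : realType} {d : nat}.
Local Notation pt := 'rV[R]_d.
Local Notation e_ i := (delta_mx ord0 i : pt).

Lemma line_coord (x : pt) i (s : R) j :
  (s *: e_ i + x) ord0 j = if j == i then x ord0 j + s else x ord0 j.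
Proof.
rewrite !mxE eqxx /=; case: eqP => _; rewrite ?mulr1 ?mulr0 ?add0r//.
by rewrite addrC.
Qed.

Lemma line_difference (f : pt -> R) (x : pt) i (s h : R) :
  h^-1 *: ((f \o +%R^~ (s *: e_ i + x)) (h *: e_ i) - f (s *: e_ i + x)) =
  h^-1 *: (((fun t : R => f (t *: e_ i + x)) \o +%R^~ s) (h *: 1) - f (s *: e_ i + x)).
Proof. by congr (_ *: (f _ - _)); rewrite /= [h *: 1]mulr1 scalerDl addrA. Qed.

Lemma is_derive_line (f : pt -> R) (x : pt) i (s : R) : differentiable f (s *: e_ i + x) ->
  is_derive s 1 (fun t : R => f (t *: e_ i + x)) (pderiv i f (s *: e_ i + x)).
Proof.
move=> df; have := @diff_derivable _ _ _ _ _ (e_ i) df.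
rewrite /pderiv /derive /derivable.
under eq_fun do rewrite line_difference.
by move=> cG; apply: DeriveDef.
Qed.

Lemma pderiv_line (f : pt -> R) (x : pt) i (l : R) :
  is_derive (0 : R) 1 (fun t : R => f (t *: e_ i + x)) l -> pderiv i f x = l.
Proof.
move=> [cG <-]; have := fun h => line_difference f x i 0 h.
rewrite scale0r add0r => E; rewrite /pderiv /derive.
by under eq_fun do rewrite E; rewrite scale0r add0r.
Qed.

Lemma C1_continuous (f : pt -> R) : C1 f -> continuous f.
Proof. by move=> [df _] x; exact: differentiable_continuous. Qed.

Lemma pderivM (f g : pt -> R) i : (forall x, differentiable f x) -> (forall x, differentiable g x) ->
  pderiv i (f \* g) = f \* pderiv i g \+ g \* pderiv i f.
Proof.
by move=> df dg; apply/funext => x; rewrite /pderiv deriveM//; exact: diff_derivable.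
Qed.

Lemma C1M (f g : pt -> R) : C1 f -> C1 g -> C1 (f \* g).
Proof.
move=> Cf Cg; have [df cf] := Cf; have [dg cg] := Cg.
split => [x|i]; first exact: differentiableM.
rewrite pderivM// => x.
have c1 : {for x, continuous (f \* pderiv i g)}.
  by apply: continuousM; [exact: C1_continuous|exact: cg].
have c2 : {for x, continuous (g \* pderiv i f)}.
  by apply: continuousM; [exact: C1_continuous|exact: cf].
exact: continuousD c1 c2.
Qed.

Lemma pderiv_cst (c : R) i : pderiv i (cst c : pt -> R) = cst 0.
Proof. by apply/funext => x; rewrite /pderiv derive_cst. Qed.

Lemma pderiv_off_support (f : pt -> R) (K : set pt) i : closed K ->
  supported_in f K -> supported_in (pderiv i f) K.
Proof.
move=> cK fK x Kx.
have oK : nbhs x (~` K) by apply: open_nbhs_nbhs; split => //; rewrite openC.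
rewrite /pderiv (near_eq_derive (g := cst 0)) ?derive_cst//.
by apply: filterS oK => y /fK.
Qed.

Lemma coord_le_norm (x : pt) i : `|x ord0 i| <= `|x|.
Proof.
rewrite [leRHS]/Num.norm/= mx_normrE; apply/bigmax_geP; right.
by exists (ord0, i).
Qed.

Lemma compact_sub_box (K : set pt) : compact K ->
  exists2 r : R, 0 < r & forall x i, K x -> `|x ord0 i| <= r.
Proof.
move=> /compact_bounded[M [Mr MK]]; exists (`|M| + 1) => [|x i Kx]; first by rewrite ltr_wpDl.
have := MK (`|M| + 1) _ x Kx; rewrite ltr_pwDr ?ler_norm// => /(_ isT); apply: le_trans.
exact: coord_le_norm.
Qed.

Lemma compact_box (a b : pt) : compact (box (Some (a, b))).
Proof.
have -> : box (Some (a, b)) = [set v : pt | forall i, `[a ord0 i, b ord0 i]%classic (v ord0 i)].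
  by apply/seteqP; split => x h i; have := h i; rewrite /= in_itv.
apply: (@rV_compact R d (fun i => `[a ord0 i, b ord0 i]%classic)) => i.
exact: segment_compact.
Qed.

Lemma bounded_supported (f : pt -> R) (K : set pt) : continuous f -> compact K ->
  supported_in f K -> exists2 M, 0 <= M & forall x, `|f x| <= M.
Proof.
move=> cf cK fK.
have /compact_bounded[M [Mr MK]] : compact (f @` K).
  by apply: continuous_compact => //; exact: continuous_subspaceT.
exists (`|M| + 1) => [|x]; first by rewrite addr_ge0.
have [Kx|/fK ->] := pselect (K x); last by rewrite normr0 addr_ge0.
by apply: (MK (`|M| + 1)); [rewrite ltr_pwDr// ler_norm|exists x].
Qed.

End partial_derivatives.

(** * Integration by parts and smooth functions *)

Section integration_generic.
Context {R : realType} {dT : measure_display} {T : measurableType dT}.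
Context (mu : {measure set T -> \bar R}).

Lemma integral_invariant (tau : T -> T) (f : T -> R) :
  (forall g : T -> \bar R, measurable_fun setT g -> (forall x, 0 <= g x)%E ->
    \int[mu]_x g (tau x) = \int[mu]_x g x)%E ->
  measurable_fun setT f ->
  (\int[mu]_x (f (tau x))%:E = \int[mu]_x (f x)%:E)%E.
Proof.
move=> H mf; have mEf : measurable_fun setT (EFin \o f) by exact/measurable_EFinP.
rewrite integralE [RHS]integralE; congr (_ - _)%E.
  rewrite -(H (EFin \o f)^\+%E) //; last exact: measurable_funepos.
  by apply: eq_integral => x _; rewrite !funeposE.
rewrite -(H (EFin \o f)^\-%E) //; last exact: measurable_funeneg.
by apply: eq_integral => x _; rewrite !funenegE.
Qed.

Lemma integrable_invariant (tau : T -> T) (f : T -> R) : measurable_fun setT tau ->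
  (forall g : T -> \bar R, measurable_fun setT g -> (forall x, 0 <= g x)%E ->
    \int[mu]_x g (tau x) = \int[mu]_x g x)%E ->
  mu.-integrable setT (EFin \o f) -> mu.-integrable setT (EFin \o (f \o tau)).
Proof.
move=> mt H /integrableP[mf foo]; apply/integrableP; split.
  exact: measurableT_comp mf mt.
rewrite (H (fun x => `|(f x)%:E|%E))//.
exact: measurableT_comp.
Qed.

Lemma integral_difference0 (c : R) (f g : T -> R) :
  mu.-integrable setT (EFin \o f) -> mu.-integrable setT (EFin \o g) ->
  (\int[mu]_x (f x)%:E = \int[mu]_x (g x)%:E)%E ->
  (\int[mu]_x (c * (f x - g x))%:E = 0)%E.
Proof.
move=> If Ig E; under eq_integral do rewrite EFinM EFinB.
rewrite integralZl//; last exact: integrableB.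
by rewrite integralB//= E subee ?mule0//; exact: integrable_fin_num.
Qed.

Lemma measurable_difference (c : R) (f g : T -> R) :
  measurable_fun setT f -> measurable_fun setT g ->
  measurable_fun setT (fun x => (c * (f x - g x))%:E).
Proof.
move=> mf mg; apply/measurable_EFinP; apply: measurable_funM => //.
exact: measurable_funB.
Qed.

Lemma integrable_scaled_indic (M : R) (A : set T) : measurable A -> (mu A < +oo)%E ->
  mu.-integrable setT (fun x => (M * \1_A x)%:E).
Proof.
move=> mA Aoo; under eq_fun do rewrite EFinM.
apply: integrableZl => //; apply/integrableP; split.
  exact/measurable_EFinP/measurable_indic.
by under eq_integral do rewrite gee0_abs ?lee_fin//; rewrite integral_indic ?setIT.
Qed.

Lemma limit_integral0 (q : nat -> T -> R) (l : T -> R) (M : R) (A : set T) :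
  measurable A -> (mu A < +oo)%E ->
  (forall n, measurable_fun setT (fun x => (q n x)%:E)) ->
  measurable_fun setT l ->
  (forall n, \int[mu]_x (q n x)%:E = 0)%E ->
  (forall x, q n x @[n --> \oo] --> l x) ->
  (forall n x, `|q n x| <= M * \1_A x) ->
  (\int[mu]_x (l x)%:E = 0)%E.
Proof.
move=> mA Aoo mq ml q0 ql bd.
have iM := integrable_scaled_indic M mA Aoo.
have ml' : measurable_fun setT (fun x => (l x)%:E) by exact/measurable_EFinP.
have cv : {ae mu, forall x, setT x -> ((q n x)%:E @[n --> \oo] --> (l x)%:E)%E}.
  by apply: aeW => x _; apply/cvg_EFin; [exact: nearW|exact: ql].
have bd' : {ae mu, forall x, forall n, setT x -> (`|(q n x)%:E| <= (M * \1_A x)%:E)%E}.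
  by apply: aeW => x n _ /=; rewrite lee_fin.
have [_ _] := dominated_convergence measurableT mq ml' cv iM bd'.
under eq_fun do rewrite q0.
move=> H; exact: (cvg_unique _ H (cvg_cst _)).
Qed.

End integration_generic.

Section integration_by_parts.
Context {R : realType} {d : nat}.
Local Notation pt := 'rV[R]_d.
Local Notation lam := (@leb R d).
Local Notation e_ i := (delta_mx ord0 i : pt).

Definition cube (r : R) : set pt := box (Some (const_mx (- r), const_mx r)).

Lemma cubeP r (x : pt) : cube r x <-> forall i, `|x ord0 i| <= r.
Proof. by split => h i; have := h i; rewrite /cube /box /= ?mxE ler_norml. Qed.

Lemma leb_cube_lty r : (lam (cube r) < +oo)%E.
Proof. by apply: le_lt_trans (leb_box_le _ _) _; rewrite ltry. Qed.

Lemma measurable_cube r : measurable (cube r : set (leb_space R d)).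
Proof. exact: measurable_box. Qed.

Lemma integrable_cube (M r : R) : lam.-integrable setT (fun x : leb_space R d => (M * \1_(cube r) x)%:E).
Proof. by apply: integrable_scaled_indic; [exact: measurable_cube|exact: leb_cube_lty]. Qed.

Lemma integrable_supported (f : pt -> R) (K : set pt) : continuous f -> compact K ->
  supported_in f K -> lam.-integrable setT (EFin \o (f : leb_space R d -> R)).
Proof.
move=> cf cK fK; have [M M0 fM] := bounded_supported cf cK fK.
have [r r0 Kr] := compact_sub_box cK.
apply: (le_integrable measurableT _ _ (integrable_cube M r)).
  exact/measurable_EFinP/continuous_measurable_leb.
move=> x _; rewrite /= lee_fin [leRHS]ger0_norm ?mulr_ge0//.
have [Kx|/fK ->] := pselect (K x); last by rewrite normr0 mulr_ge0.
by rewrite indicE mem_set ?mulr1//; apply/cubeP => i; exact: Kr.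
Qed.

Lemma mvt_line (f : pt -> R) (M h : R) (x : pt) i : C1 f -> (forall y, `|pderiv i f y| <= M) ->
  0 <= h -> `|f (h *: e_ i + x) - f x| <= M * h.
Proof.
move=> [df _] fM h0.
have [||c _] := @MVT_segment R (fun t => f (t *: e_ i + x)) (fun t => pderiv i f (t *: e_ i + x)) 0 h h0.
- by move=> t _; exact: is_derive_line.
- apply: continuous_subspaceT => t; apply: differentiable_continuous.
  by apply/derivable1_diffP; have [] := is_derive_line (df (t *: e_ i + x)).
rewrite scale0r add0r subr0 => ->; rewrite normrM (ger0_norm h0).
by apply: ler_wpM2r.
Qed.

(** The difference quotients have integral 0 by translation invariance; they converge to the
    derivative and are dominated by means of the mean value theorem. *)
Lemma integral_pderiv0 (f : pt -> R) (K : set pt) i : C1 f -> compact K ->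
  supported_in f K -> (\int[lam]_x (pderiv i f x)%:E = 0)%E.
Proof.
move=> Cf cK fK; have [df cdf] := Cf; have cf := C1_continuous Cf.
have clK : closed K by apply: compact_closed => //; exact: norm_hausdorff.
have dfK := pderiv_off_support i clK fK.
have [M M0 fM] := bounded_supported (cdf i) cK dfK.
have [r r0 Kr] := compact_sub_box cK.
pose h n : R := n.+1%:R^-1.
have h0 n : 0 < h n by rewrite invr_gt0.
have h1 n : h n <= 1 by rewrite invf_le1 ?ler1n.
have mf := continuous_measurable_leb cf.
have intf := integrable_supported cf cK fK.
pose q n (x : leb_space R d) : R := (h n)^-1 * (f ((x : pt) + h n *: e_ i) - f x).
have mft n := measurableT_comp mf (measurable_translate (h n *: e_ i)).
have mq n : measurable_fun setT (fun x => (q n x)%:E).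
  exact: (measurable_difference (h n)^-1 (mft n) mf).
have inv n := @ge0_integral_translate R d (h n *: e_ i).
have q0 n : (\int[lam]_x (q n x)%:E = 0)%E.
  have If := integrable_invariant (measurable_translate (h n *: e_ i)) (inv n) intf.
  have E := integral_invariant (mu := lam)
    (tau := (fun x : pt => x + h n *: e_ i) : leb_space R d -> leb_space R d) (inv n) mf.
  have := integral_difference0 (h n)^-1 If intf E.
  by apply.
have qcvg x : q n x @[n --> \oo] --> pderiv i f x.
  have := @diff_derivable _ _ _ _ _ (e_ i) (df x).
  rewrite /derivable => dfx.
  have hcv : h n @[n --> \oo] --> (0 : R)^'.
    move=> A hA; have hn : \forall n \near \oo, h n != 0 -> A (h n) := @cvg_harmonic R _ hA.
    have : \forall n \near \oo, A (h n) by apply: filterS hn => n; apply; rewrite gt_eqF.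
    by [].
  apply: cvg_trans (cvg_comp h _ hcv dfx); apply: near_eq_cvg; apply: nearW => n /=.
  by rewrite /q [x + _]addrC.
(* The steps [h n] are at most 1, so outside the cube of half-side [r + 1] both values of [f]
   vanish. *)
have bound n x : `|q n x| <= M * \1_(cube (r + 1)) x.
  rewrite /q normrM gtr0_norm ?invr_gt0// [(x : pt) + _]addrC.
  have [xr|xr] := pselect (cube (r + 1) x).
    rewrite indicE mem_set// mulr1 mulrC ler_pdivrMr//.
    by apply: mvt_line => //; exact: ltW.
  rewrite indicE memNset// mulr0 !fK ?subrr ?normr0 ?mulr0//.
    by move=> Kx; apply: xr; apply/cubeP => j; rewrite (le_trans (Kr _ j Kx))// lerDl.
  move=> Kx; apply: xr; apply/cubeP => j; have := Kr _ j Kx; rewrite line_coord.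
  case: eqP => _; last by move=> /le_trans; apply; rewrite lerDl.
  have := h1 n; have := h0 n => ? ?; rewrite !ler_norml; lra.
exact: (limit_integral0 (measurable_cube (r + 1)) (leb_cube_lty _) mq
  (continuous_measurable_leb (cdf i)) q0 qcvg bound).
Qed.

End integration_by_parts.

Section set_function.
Import HBNNSimple.
Context {dT : measure_display} {T : measurableType dT} {R : realType}.

(** Serves to evaluate [L2norm2 (m_a a)] at the zero function. *)
Lemma integral_set_function0 (m : set T -> \bar R) (D : set T) (f : T -> \bar R) : m set0 = 0%E ->
  (forall x, f x = 0%E) -> (\int[m]_(x in D) f x = 0)%E.
Proof.
move=> m0 f0; rewrite /integral.
have -> : f = (fun=> (0 : R)%:E) by apply/funext => x; rewrite f0.
have E0 : (fun _ : T => (0 : R)%:E) \_ D = cst 0%E.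
  by apply/funext => x; rewrite /patch; case: ifP.
have -> : ((fun _ : T => (0 : R)%:E) \_ D)^\-%E = cst 0%E.
  by rewrite E0; apply/funext => x; rewrite funenegE oppe0 maxxx.
have -> : ((fun _ : T => (0 : R)%:E) \_ D)^\+%E = cst 0%E.
  by rewrite E0; apply/funext => x; rewrite funeposE maxxx.
set M := ereal_sup _.
suff -> : M = 0%E by rewrite subee.
have s0 (h : {nnsfun T >-> R}) : (forall x, ((h x)%:E <= 0)%E) -> sintegral m h = 0%E.
  move=> h0; rewrite /sintegral fsbig1// => r _.
  have [->|r0] := eqVneq r 0; first by rewrite mul0e.
  rewrite preimage10 ?m0 ?mule0// => -[x _] /= hx.
  by move/negP : r0; apply; rewrite -hx eq_le fun_ge0 andbT -lee_fin h0.
apply/eqP; rewrite eq_le; apply/andP; split.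
  by apply: ge_ereal_sup => _ [h hf <-]; rewrite (s0 h).
apply: ereal_sup_ubound; exists nnsfun0; first by move=> x; rewrite lexx.
by rewrite s0// => x; rewrite lexx.
Qed.

Lemma integral_off (mu : {measure set T -> \bar R}) (D : set T) (f : T -> \bar R) :
  (forall x, ~ D x -> f x = 0%E) -> (\int[mu]_(x in D) f x = \int[mu]_x f x)%E.
Proof.
move=> f0; rewrite integral_mkcond; apply: eq_integral => x _; rewrite /patch.
by case: ifPn => //; rewrite notin_setE => /f0.
Qed.

Lemma Rintegral_parts (mu : {measure set T -> \bar R}) (D : set T) (f g : T -> R) :
  mu.-integrable setT (EFin \o f) -> mu.-integrable setT (EFin \o g) ->
  (forall x, ~ D x -> f x = 0) -> (forall x, ~ D x -> g x = 0) ->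
  (\int[mu]_x (f x + g x)%:E = 0)%E ->
  \int[mu]_(x in D) f x = - \int[mu]_(x in D) g x.
Proof.
move=> If Ig f0 g0 E; rewrite /Rintegral.
have -> : (\int[mu]_(x in D) (f x)%:E = \int[mu]_x (f x)%:E)%E.
  by apply: integral_off => x /f0 ->.
have -> : (\int[mu]_(x in D) (g x)%:E = \int[mu]_x (g x)%:E)%E.
  by apply: integral_off => x /g0 ->.
have := integralD measurableT If Ig; rewrite /= E.
have := integrable_fin_num measurableT If; have := integrable_fin_num measurableT Ig.
rewrite /comp; set a := (X in X \is a fin_num); set b := (X in _ -> X \is a fin_num -> _).
by move=> ga gb /(congr1 fine); rewrite fineD//= => h; lra.
Qed.

End set_function.

Section smooth_functions.
Context {R : realType} {d : nat}.
Local Notation pt := 'rV[R]_d.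
Local Notation lam := (@leb R d).

Lemma supportedM (f g : pt -> R) (K : set pt) : supported_in g K -> supported_in (f \* g) K.
Proof. by move=> gK x /gK /= ->; rewrite mulr0. Qed.

Lemma supportedM_l (f g : pt -> R) (K : set pt) : supported_in f K -> supported_in (f \* g) K.
Proof. by move=> fK x /fK /= ->; rewrite mul0r. Qed.

Lemma compact_closed_rV (K : set pt) : compact K -> closed K.
Proof. by apply: compact_closed; exact: norm_hausdorff. Qed.

(** Leibniz's rule and [integral_pderiv0] for the product of [u] and [phi]. The support of [phi]
    lies in the carpet, so integrals over the carpet and over the whole space agree. *)
Lemma weak_gradient_C1 (u : pt -> R) : C1_0 u -> weak_gradient u (fun i => pderiv i u).
Proof.
move=> [Cu [K cK uK]]; have [du cu] := Cu; have clK := compact_closed_rV cK; split.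
  move=> i; have duK := pderiv_off_support i clK uK.
  split; first exact/measurable_funTS/continuous_measurable_leb/cu.
  have [M M0 uM] := bounded_supported (cu i) cK duK.
  have [r r0 Kr] := compact_sub_box cK.
  apply: (@le_lt_trans _ _ (\int[lam]_x (M ^+ 2 * \1_(cube r) x)%:E)%E).
    apply: le_integral_ge0 => // [x _|x _]; last by rewrite lee_fin mulr_ge0// sqr_ge0.
    rewrite !lee_fin sqr_ge0 /=; have [Kx|/duK ->] := pselect (K x); last first.
      by rewrite expr0n mulr_ge0// sqr_ge0.
    rewrite indicE mem_set ?mulr1; last by apply/cubeP => j; exact: Kr.
    by rewrite -[leLHS]real_normK ?num_real// ler_pXn2r// nnegrE.
  rewrite integral_scaled_indic ?sqr_ge0//; last exact: measurable_cube.
  by rewrite lte_mul_pinfty// ?lee_fin ?sqr_ge0//; exact: leb_cube_lty.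
move=> phi i [Cphi [L [cL Lc] phiL]].
have dphi := Cphi.1; have cphi := Cphi.2.
have oL := supported_in phi L; have clL := compact_closed_rV cL.
have dphiL := pderiv_off_support i clL phiL.
have sub (f : pt -> R) : supported_in f L -> forall x : pt, ~ carpet x -> f x = 0.
  by move=> fL x cx; rewrite fL// => /Lc /interior_subset.
have c1 : continuous (u \* pderiv i phi).
  by move=> x; apply: continuousM; [exact: C1_continuous|exact: cphi].
have c2 : continuous (phi \* pderiv i u).
  by move=> x; apply: continuousM; [exact: C1_continuous|exact: cu].
have i1 := integrable_supported c1 cL (supportedM u dphiL).
have i2 := integrable_supported c2 cL (supportedM_l (pderiv i u) phiL).
have := integral_pderiv0 i (C1M Cu Cphi) cL (supportedM u phiL).
rewrite pderivM// => E.
have -> : (fun x => pderiv i u x * phi x) = phi \* pderiv i u.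
  by apply/funext => x /=; rewrite mulrC.
by apply: (Rintegral_parts i1 i2 (sub _ (supportedM u dphiL)) (sub _ (supportedM_l _ phiL))).
Qed.

Lemma C1_cst (c : R) : C1 (cst c : pt -> R).
Proof. by split => [x|i]; [exact: differentiable_cst|rewrite pderiv_cst; exact: cst_continuous]. Qed.

Lemma C1_0_cst0 : C1_0 (cst 0 : pt -> R).
Proof. by split; [exact: C1_cst|exists set0 => //; exact: compact0]. Qed.

Lemma energy_cst0 : energy (cst 0 : pt -> R) = 0%E.
Proof.
apply/eqP; rewrite eq_le; apply/andP; split.
  apply: ereal_inf_lbound; exists (fun i => pderiv i (cst 0 : pt -> R)).
    exact: weak_gradient_C1 C1_0_cst0.
  apply: integral0_eq => x _; rewrite /sqnorm big1// => i _.
  by rewrite pderiv_cst expr0n.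
apply: le_ereal_inf_tmp => _ [g _ <-]; apply: integral_ge0 => x _.
by rewrite lee_fin sumr_ge0// => i _; exact: sqr_ge0.
Qed.

(** The constant sequence [u] is the approximation; as [1 <= a], the norm for [m_a] is at most the
    one for Lebesgue measure. *)
Lemma D_a_C1 (a : pt -> R) (u : pt -> R) : (forall x, 1 <= a x) -> C1_0 u -> D_a a u.
Proof.
move=> a1 Cu; have cu := C1_continuous Cu.1; have [K cK uK] := Cu.2.
split; last first.
  exists (fun=> u); split => // ; have -> : (u \- u)%R = cst 0 by apply/funext => x /=; rewrite subrr.
  have -> : L2norm2 (m_a a) (cst 0) = 0%E.
    by apply: (integral_set_function0 _ (m_a0 a)) => x; rewrite /cst expr0n.
  by rewrite energy_cst0 add0e; exact: cvg_cst.
split; first exact/measurable_funTS/continuous_measurable_leb.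
have [M M0 uM] := bounded_supported cu cK uK.
have [r r0 Kr] := compact_sub_box cK.
apply: (@le_lt_trans _ _ (L2norm2 lam u)).
  apply: le_integral_set_function; [exact: m_a0| |by move=> x _; rewrite lee_fin sqr_ge0].
  by move=> A mA; exact: m_a_le_leb.
apply: (@le_lt_trans _ _ (\int[lam]_x (M ^+ 2 * \1_(cube r) x)%:E)%E).
  apply: le_integral_ge0 => // [x _|x _]; last by rewrite lee_fin mulr_ge0// sqr_ge0.
  rewrite !lee_fin sqr_ge0 /=; have [Kx|/uK ->] := pselect (K x); last first.
    by rewrite expr0n mulr_ge0// sqr_ge0.
  rewrite indicE mem_set ?mulr1; last by apply/cubeP => j; exact: Kr.
  by rewrite -[leLHS]real_normK ?num_real// ler_pXn2r// nnegrE.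
rewrite integral_scaled_indic ?sqr_ge0//; last exact: measurable_cube.
by rewrite lte_mul_pinfty// ?lee_fin ?sqr_ge0//; exact: leb_cube_lty.
Qed.

End smooth_functions.

Section product_functions.
Context {R : realType} {d : nat}.
Local Notation pt := 'rV[R]_d.
Local Notation e_ i := (delta_mx ord0 i : pt).

Definition tensor (F : 'I_d -> R -> R) (x : pt) : R := \prod_j F j (x ord0 j).

Lemma continuous_prod_coord (A : pred 'I_d) (F : 'I_d -> R -> R) : (forall j, continuous (F j)) ->
  continuous (fun x : pt => \prod_(j | A j) F j (x ord0 j)).
Proof.
move=> cF x; elim: (index_enum _) => [|j s IH].
  have -> : (fun y : pt => \prod_(j <- [::] | A j) F j (y ord0 j)) = cst 1.
      by apply/funext => y; rewrite big_nil.
    exact: cst_continuous.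
have cj : {for x, continuous (fun y : pt => F j (y ord0 j))}.
  apply: (@continuous_comp _ _ _ (fun y : pt => y ord0 j)); last exact: cF.
  exact: coord_continuous.
under eq_fun do rewrite big_cons; case: (A j) => //.
exact: continuousM cj IH.
Qed.

Lemma differentiable_tensor (F : 'I_d -> R -> R) : (forall j t, derivable (F j) t 1) ->
  forall x, differentiable (tensor F) x.
Proof.
move=> dF x; rewrite /tensor.
have D (s : seq 'I_d) : differentiable (fun y : pt => \prod_(j <- s) F j (y ord0 j)) x.
  elim: s => [|j s IH].
    by under eq_fun do rewrite big_nil; exact: differentiable_cst.
  under eq_fun do rewrite big_cons.
  apply: differentiableM => //; apply: (@differentiable_comp _ _ _ _ (fun y : pt => y ord0 j) (F j)).
    exact: differentiable_coord.
  exact/derivable1_diffP/dF.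
exact: D.
Qed.

Lemma pderiv_tensor (F : 'I_d -> R -> R) i (l : R) (x : pt) :
  is_derive (x ord0 i) 1 (F i) l ->
  pderiv i (tensor F) x = l * \prod_(j | j != i) F j (x ord0 j).
Proof.
move=> dF; apply: pderiv_line.
have -> : (fun t : R => tensor F (t *: e_ i + x)) =
    (fun t => (\prod_(j | j != i) F j (x ord0 j)) *: (F i \o (fun t => t + x ord0 i)) t).
  apply/funext => t; rewrite /tensor (bigD1 i)//= line_coord eqxx [x ord0 i + t]addrC mulrC.
  by congr (_ * _); apply: eq_bigr => j /negbTE ji; rewrite line_coord ji.
have H : is_derive (0 : R) 1 (F i \o (fun t => t + x ord0 i)) l.
  rewrite -[l]mulr1; apply: (@is_derive1_comp _ (F i) (fun t => t + x ord0 i)).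
    by rewrite add0r.
  exact: is_derive_shift.
have := is_deriveZ (\prod_(j | j != i) F j (x ord0 j)) H.
by rewrite mulrC.
Qed.

Lemma C1_tensor (F F' : 'I_d -> R -> R) : (forall j (t : R), is_derive t 1 (F j) (F' j t)) ->
  (forall j, continuous (F' j)) -> C1 (tensor F).
Proof.
move=> dF cF'; have cF j : continuous (F j).
  by move=> t; apply: differentiable_continuous; apply/derivable1_diffP; have [] := dF j t.
split; first by apply: differentiable_tensor => j t; have [] := dF j t.
move=> i; have -> : pderiv i (tensor F) =
    (fun x => F' i (x ord0 i)) \* (fun x => \prod_(j | j != i) F j (x ord0 j)).
  by apply/funext => x; rewrite (pderiv_tensor (dF i (x ord0 i))).
move=> x; apply: continuousM; last exact: continuous_prod_coord.
by apply: (@continuous_comp _ _ _ (fun y : pt => y ord0 i));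
  [exact: coord_continuous|exact: cF'].
Qed.

Lemma tensor_supported (F : 'I_d -> R -> R) (a b : pt) :
  (forall j s, ~~ (a ord0 j <= s <= b ord0 j) -> F j s = 0) ->
  supported_in (tensor F) (box (Some (a, b))).
Proof.
move=> F0 x; rewrite /box /= => /existsNP[j /negP ab].
by rewrite /tensor (bigD1 j)//= F0// mul0r.
Qed.

End product_functions.

(** * Splines and increments along an axis *)

Section splines.
Context {R : realType}.

(** A quadratic bound on the remainder can be checked across a knot by cases on signs, so piecewise
    polynomials are differentiated without a separate analysis at their knots. *)
Lemma is_derive_quadratic (f : R -> R) (x l C : R) :
  (forall h, `|f (h + x) - f x - l * h| <= C * h ^+ 2) -> is_derive x 1 f l.
Proof.
move=> H; have C0 : 0 <= C.
  by have := H 1; rewrite expr1n !mulr1; apply: le_trans.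
have cv : h^-1 *: (f (h *: 1 + x) - f x) @[h --> 0^'] --> l.
  apply/cvgrPdist_le => e e0; near=> h.
  have h0 : h != 0 by near: h; exact: nbhs_dnbhs_neq.
  have hp : 0 < `|h| by rewrite normr_gt0.
  have he : `|h| <= e / (C + 1).
    by near: h; apply: dnbhs0_le; rewrite divr_gt0// ltr_wpDl.
  rewrite [h *: 1]mulr1 distrC.
  have -> : h^-1 *: (f (h + x) - f x) - l = h^-1 * (f (h + x) - f x - l * h).
    by rewrite /GRing.scale/=; field.
  rewrite normrM normfV mulrC ler_pdivrMr//; apply: le_trans (H h) _.
  rewrite -[h ^+ 2]real_normK ?num_real// expr2 mulrA ler_wpM2r// .
  apply: le_trans (ler_wpM2l C0 he) _; rewrite mulrA ler_pdivrMr ?ltr_wpDl//.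
  by rewrite mulrC ler_wpM2l// ?(ltW e0)// lerDl.
by apply: DeriveDef; [apply/cvg_ex; exists l|apply: cvg_lim].
Unshelve. all: by end_near. Qed.

Definition pos (t : R) : R := Num.max 0 t.

Lemma is_derive_pos2 (t : R) : is_derive t 1 (fun t => pos t ^+ 2) (2 * pos t).
Proof.
apply: (@is_derive_quadratic _ _ _ 1) => h; rewrite /pos mul1r.
by case: (leP 0 t) => t0; case: (leP 0 (h + t)) => ht0; rewrite ler_norml; nra.
Qed.

Lemma is_derive_pos3 (t : R) : is_derive t 1 (fun t => pos t ^+ 3) (3 * pos t ^+ 2).
Proof.
have -> : (fun t => pos t ^+ 3) = (fun t : R => t : R) * (fun t => pos t ^+ 2).
  by apply/funext => s; rewrite /pos /= mulrfctE; case: leP => s0; rewrite ?exprS// !mul0r mulr0.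
apply: (is_derive_eq (is_deriveM (is_derive_id t 1) (is_derive_pos2 t))).
by rewrite /pos /GRing.scale/=; case: leP => s0; ring.
Qed.

Lemma pos_ge s : 0 <= s -> pos s = s.
Proof. by rewrite /pos; case: ltgtP. Qed.

Lemma pos_le s : s <= 0 -> pos s = 0.
Proof. by rewrite /pos; case: ltgtP. Qed.

Section cutoff.
Variable h : R.

(* The quadratic B-spline with knots [0, h, 2h, 3h] is C^1 and supported in
   [0, 3h]; [ispline] is its primitive. *)
Definition third_difference k (s : R) : R :=
  pos s ^+ k - 3 * pos (s - h) ^+ k + 3 * pos (s - 2 * h) ^+ k - pos (s - 3 * h) ^+ k.

Definition bspline (s : R) : R := third_difference 2 s.

Definition ispline (s : R) : R := 3^-1 * third_difference 3 s.

Lemma is_derive_third_difference k (x : R) :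
  (forall t : R, is_derive t 1 (fun t => pos t ^+ k.+1) (k.+1%:R * pos t ^+ k)) ->
  is_derive x 1 (third_difference k.+1) (k.+1%:R * third_difference k x).
Proof.
move=> H.
have S (c : R) : is_derive x 1 (fun t => pos (t - c) ^+ k.+1) (k.+1%:R * pos (x - c) ^+ k).
  have := @is_derive1_comp _ _ (fun t => t - c) x _ _ (H (x - c)) (is_derive_shift x 1 (- c)).
  by rewrite mulr1.
have D := is_deriveB (is_deriveD (is_deriveB (H x) (is_deriveZ 3 (S h)))
  (is_deriveZ 3 (S (2 * h)))) (S (3 * h)).
apply: (is_derive_eq D).
by rewrite /third_difference /GRing.scale/=; ring.
Qed.

Hypothesis h0 : 0 < h.

Lemma third_differenceE k s : third_difference k.+1 s =
  if s <= 0 then 0 else if s <= h then s ^+ k.+1 else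
  if s <= 2 * h then s ^+ k.+1 - 3 * (s - h) ^+ k.+1 else
  if s <= 3 * h then s ^+ k.+1 - 3 * (s - h) ^+ k.+1 + 3 * (s - 2 * h) ^+ k.+1 else
  s ^+ k.+1 - 3 * (s - h) ^+ k.+1 + 3 * (s - 2 * h) ^+ k.+1 - (s - 3 * h) ^+ k.+1.
Proof.
have hp := h0; rewrite /third_difference; case: (leP s 0) => a1.
  by rewrite !pos_le ?expr0n/=; lra.
rewrite (pos_ge (ltW a1)); case: (leP s h) => a2.
  by rewrite !pos_le ?expr0n/=; lra.
rewrite (@pos_ge (s - h)); last lra.
case: (leP s (2 * h)) => a3.
  by rewrite !pos_le ?expr0n/=; lra.
rewrite (@pos_ge (s - 2 * h)); last lra.
case: (leP s (3 * h)) => a4.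
  by rewrite !pos_le ?expr0n/=; lra.
by rewrite (@pos_ge (s - 3 * h)); last lra.
Qed.

Lemma bspline_bounds s : 0 <= bspline s <= 9 * h ^+ 2.
Proof.
rewrite /bspline third_differenceE; case: (leP s 0) => a1; first nra.
case: (leP s h) => a2; first nra.
case: (leP s (2 * h)) => a3; first nra.
case: (leP s (3 * h)) => a4; last nra.
have -> : s ^+ 2 - 3 * (s - h) ^+ 2 + 3 * (s - 2 * h) ^+ 2 = (3 * h - s) ^+ 2 by ring.
nra.
Qed.

Lemma bspline_ge s : h <= s <= 2 * h -> h ^+ 2 <= bspline s.
Proof.
have hp := h0; move=> /andP[b1 b2]; rewrite /bspline third_differenceE; case: (leP s 0) => a1; first lra.
case: (leP s h) => a2; first nra.
by case: (leP s (2 * h)) => a3; [nra|lra].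
Qed.

Lemma bspline_out s : ~~ (0 <= s <= 3 * h) -> bspline s = 0.
Proof.
rewrite /bspline third_differenceE; case: (leP s 0) => a1 //; case: (leP s h) => a2; first lra.
case: (leP s (2 * h)) => a3; first lra.
by case: (leP s (3 * h)) => a4; [lra|move=> _; ring].
Qed.

Lemma ispline_bounds s : 0 <= ispline s <= 2 * h ^+ 3.
Proof.
have hp := h0; have h3 : 0 < h ^+ 3 by rewrite exprn_gt0.
rewrite /ispline third_differenceE; case: (leP s 0) => a1; first by rewrite mulr0; lra.
case: (leP s h) => a2.
  have : 0 <= s ^+ 3 <= h ^+ 3 by rewrite exprn_ge0 ?ler_pXn2r ?nnegrE//; lra.
  lra.
case: (leP s (2 * h)) => a3.
  have u : 0 <= s - h by lra.
  have -> : s ^+ 3 - 3 * (s - h) ^+ 3 =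
    h ^+ 3 + 3 * h ^+ 2 * (s - h) + 3 * h * (s - h) ^+ 2 - 2 * (s - h) ^+ 3 by ring.
  have v : s - h <= h by lra.
  move: (s - h) u v => v v0 vh.
  have k1 : 0 <= (h - v) ^+ 2 * (h + 2 * v) by rewrite mulr_ge0 ?sqr_ge0//; lra.
  have k2 : 0 <= v * h ^+ 2 <= h ^+ 3 by rewrite mulr_ge0 ?sqr_ge0// exprS ler_wpM2r ?sqr_ge0.
  have k3 : 0 <= v ^+ 2 * (3 * h - 2 * v) by rewrite mulr_ge0 ?sqr_ge0//; lra.
  lra.
case: (leP s (3 * h)) => a4.
  have -> : s ^+ 3 - 3 * (s - h) ^+ 3 + 3 * (s - 2 * h) ^+ 3 = 6 * h ^+ 3 - (3 * h - s) ^+ 3 by ring.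
  have : 0 <= (3 * h - s) ^+ 3 <= h ^+ 3 by rewrite exprn_ge0 ?ler_pXn2r ?nnegrE//; lra.
  lra.
have -> : s ^+ 3 - 3 * (s - h) ^+ 3 + 3 * (s - 2 * h) ^+ 3 - (s - 3 * h) ^+ 3 = 6 * h ^+ 3 by ring.
lra.
Qed.

Lemma ispline_neg s : s <= 0 -> ispline s = 0.
Proof. by move=> s0; rewrite /ispline third_differenceE s0 mulr0. Qed.

(** All translates reach the same plateau, so the difference of two of them, the [i]-th factor of
    [ramp], has compact support. *)
Lemma ispline_large s : 3 * h <= s -> ispline s = 2 * h ^+ 3.
Proof.
have hp := h0; move=> b1; rewrite /ispline third_differenceE; case: (leP s 0) => a1; first lra.
case: (leP s h) => a2; first lra.
case: (leP s (2 * h)) => a3; first lra.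
case: (leP s (3 * h)) => a4; last by field.
by have -> : s = 3 * h by [lra|]; field.
Qed.

Lemma continuous_pos : continuous (pos : R -> R).
Proof.
have -> : (pos : R -> R) = (fun t => 2^-1 * (t + `|t|)).
  by apply/funext => t; rewrite /pos; case: (leP 0 t) => t0;
    rewrite ?(ger0_norm t0) ?(ltr0_norm t0); lra.
move=> t; have c : {for t, continuous (fun s : R => s + `|s|)}.
  by apply: continuousD; [exact: cvg_id|exact: norm_continuous].
have c2 : {for t, continuous (fun _ : R => 2^-1 : R)} by exact: cst_continuous.
exact: (continuousM c2 c).
Qed.

Lemma continuous_third_difference k : continuous (third_difference k).
Proof.
have P (c : R) : continuous (fun t : R => pos (t - c) ^+ k).
  move=> t; apply: (@continuous_comp _ _ _ (fun t => pos (t - c)) (fun s : R => s ^+ k)); last exact: exprn_continuous.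
  apply: (@continuous_comp _ _ _ (fun t => t - c)); last exact: continuous_pos.
  by apply: continuousB; [exact: cvg_id|exact: cst_continuous].
have P0 : continuous (fun t : R => pos t ^+ k) by have := P 0; under eq_fun do rewrite subr0.
move=> t; have c3 : {for t, continuous (fun _ : R => 3 : R)} by exact: cst_continuous.
have P3 c := continuousM c3 (P c t).
exact: (continuousB (continuousD (continuousB (P0 t) (P3 h)) (P3 (2 * h))) (P (3 * h) t)).
Qed.

Lemma is_derive_bspline (x : R) : is_derive x 1 bspline (2 * third_difference 1 x).
Proof. exact: (is_derive_third_difference x (@is_derive_pos2)). Qed.

Lemma is_derive_ispline (x : R) : is_derive x 1 ispline (bspline x).
Proof.
have := is_deriveZ 3^-1 (is_derive_third_difference x (@is_derive_pos3)).
by move/is_derive_eq; apply; rewrite /GRing.scale/= mulrA mulVf ?mul1r.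
Qed.

End cutoff.
End splines.

Section test_pair.
Context {R : realType} {dT : measure_display} {T : measurableType dT}.
Context (mu : {measure set T -> \bar R}).

Lemma bounded_integrable (B : set T) (f : T -> R) (c : R) : measurable B -> (mu B < +oo)%E ->
  measurable_fun B f -> (forall x, B x -> `|f x| <= c) -> mu.-integrable B (EFin \o f).
Proof.
move=> mB Boo mf fc; apply: measurable_bounded_integrable => //.
exists c; split; rewrite ?num_real // => r cr x Bx /=.
exact: le_trans (fc x Bx) (ltW cr).
Qed.

Lemma Rintegral_support (B D : set T) (f : T -> R) : B `<=` D -> (forall x, ~ B x -> f x = 0) ->
  (\int[mu]_(x in D) f x) = (\int[mu]_(x in B) f x).
Proof.
move=> BD f0; congr fine.
rewrite (integral_off mu (D := D)); last by move=> x Dx; rewrite f0// => /BD.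
by rewrite [RHS](integral_off mu)// => x Bx; rewrite f0.
Qed.

Lemma Rintegral_difference0 (B : set T) (f g : T -> R) :
  mu.-integrable setT (EFin \o f) -> mu.-integrable setT (EFin \o g) ->
  (forall x, ~ B x -> f x = 0) -> (forall x, ~ B x -> g x = 0) ->
  (\int[mu]_x (f x - g x)%:E = 0)%E ->
  (\int[mu]_(x in B) f x) = (\int[mu]_(x in B) g x).
Proof.
move=> If Ig f0 g0 E.
rewrite -(@Rintegral_support B setT f)// -(@Rintegral_support B setT g)//.
by apply/eqP; rewrite -subr_eq0 -RintegralB// /Rintegral E.
Qed.

Lemma average_close (B : set T) (u phi : T -> R) (u1 eps C : R) : measurable B -> (mu B < +oo)%E ->
  measurable_fun B u -> measurable_fun B phi -> 0 <= eps ->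
  (forall x, B x -> 0 <= phi x <= C) -> (forall x, B x -> `|u x - u1| * phi x <= eps * phi x) ->
  mu.-integrable B (EFin \o (u \* phi)) /\
  `|\int[mu]_(x in B) (u x * phi x) - u1 * \int[mu]_(x in B) phi x| <= eps * \int[mu]_(x in B) phi x.
Proof.
move=> mB Boo mu_ mphi e0 phiC uphi.
have C0 x : B x -> `|phi x| <= C.
  by move=> /phiC /andP[p0 pC]; rewrite ger0_norm.
have iphi := bounded_integrable mB Boo mphi C0.
have mup : measurable_fun B (u \* phi) by exact: measurable_funM.
have iup : mu.-integrable B (EFin \o (u \* phi)).
  apply: (bounded_integrable (c := (eps + `|u1|) * C) mB Boo mup) => x Bx /=.
  have /andP[p0 pC] := phiC _ Bx; rewrite normrM (ger0_norm p0).
  apply: (@le_trans _ _ ((eps + `|u1|) * phi x)).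
    rewrite mulrDl; apply: le_trans (lerD (uphi x Bx) (lexx _)).
    by rewrite -mulrDl ler_wpM2r//; have := ler_normD (u x - u1) u1; rewrite subrK.
  by rewrite ler_wpM2l// addr_ge0.
split => //.
have i1 : mu.-integrable B (EFin \o (fun x => u1 * phi x)).
  exact: (integrableZl mB u1 iphi).
rewrite -RintegralZl// -RintegralB//.
have mdiff : measurable_fun B (fun x => u x * phi x - u1 * phi x).
  by apply: measurable_funB => //; exact: measurable_funM.
have bd x : B x -> `|u x * phi x - u1 * phi x| <= eps * phi x.
  move=> Bx; have /andP[p0 pC] := phiC _ Bx.
  by rewrite -mulrBl normrM (ger0_norm p0) uphi.
have id : mu.-integrable B (EFin \o (fun x => u x * phi x - u1 * phi x)).
  apply: (bounded_integrable (c := eps * C) mB Boo mdiff) => x Bx.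
  by rewrite (le_trans (bd x Bx))// ler_wpM2l//; have /andP[] := phiC _ Bx.
apply: le_trans (le_normr_Rintegral mB id) _.
rewrite -RintegralZl//; apply: le_Rintegral => //.
- apply: (bounded_integrable (c := eps * C) mB Boo).
    exact: measurableT_comp.
  move=> x Bx; rewrite normr_id.
  by rewrite (le_trans (bd x Bx))// ler_wpM2l//; have /andP[] := phiC _ Bx.
- exact: (integrableZl mB eps iphi).
Qed.

(** Let [I] be the common mass of [phi1] and [phi0]. Up to [2 * eps * I], the number [(u1 - u0) * I]
    is the integral of [u (phi1 - phi0)], which the weak gradient identity turns into an integral of
    [g Phi], at most [M * K * L]. *)
Lemma test_pair_bound (B : set T) (u g phi1 phi0 Phi : T -> R) (u1 u0 eps C M K L : R) :
  measurable B -> (mu B <= L%:E)%E ->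
  measurable_fun B u -> measurable_fun B g -> measurable_fun B phi1 ->
  measurable_fun B phi0 -> measurable_fun B Phi -> 0 <= eps -> 0 <= M -> 0 <= K ->
  (forall x, B x -> 0 <= phi1 x <= C) -> (forall x, B x -> 0 <= phi0 x <= C) ->
  (forall x, B x -> `|u x - u1| * phi1 x <= eps * phi1 x) ->
  (forall x, B x -> `|u x - u0| * phi0 x <= eps * phi0 x) ->
  {ae mu, forall x, B x -> `|g x| <= M} -> (forall x, B x -> `|Phi x| <= K) ->
  (\int[mu]_(x in B) phi1 x) = (\int[mu]_(x in B) phi0 x) ->
  (\int[mu]_(x in B) (u x * (phi1 x - phi0 x))) = - (\int[mu]_(x in B) (g x * Phi x)) ->
  `|u1 - u0| * (\int[mu]_(x in B) phi1 x) <= 2 * eps * (\int[mu]_(x in B) phi1 x) + M * K * L.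
Proof.
move=> mB BL mu_ mg m1 m0 mP e0 M0 K0 b1 b0 c1 c0 gM PK E1 E2.
have Boo : (mu B < +oo)%E by apply: le_lt_trans BL _; rewrite ltry.
have [i1 h1] := average_close mB Boo mu_ m1 e0 b1 c1.
have [i0 h0] := average_close mB Boo mu_ m0 e0 b0 c0.
have h2 : `|\int[mu]_(x in B) (g x * Phi x)| <= M * K * L.
  have mgP : measurable_fun B (fun x => (g x * Phi x)%:E).
    by apply/measurable_EFinP; exact: measurable_funM.
  have MK0 : (0 <= (M * K)%:E)%E by rewrite lee_fin mulr_ge0.
  have aegP : {ae mu, forall x, B x -> (`|(g x * Phi x)%:E| <= (M * K)%:E)%E}.
    apply: filterS gM => x gx Bx; rewrite lee_fin normrM ler_pM//; first exact: gx.
    exact: PK.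
  have bb := integral_le_bound (M * K)%:E mB mgP MK0 aegP.
  have bb2 : (`|\int[mu]_(x in B) (g x * Phi x)%:E| <= (M * K * L)%:E)%E.
    apply: le_trans (le_abse_integral _ mB mgP) _; apply: le_trans bb _.
    by rewrite (EFinM (M * K) L); apply: lee_wpmul2l.
  rewrite /Rintegral; move: bb2; case: (\int[mu]_(x in B) _)%E => [r| |] //=.
have h3 : \int[mu]_(x in B) (u x * (phi1 x - phi0 x)) =
    (\int[mu]_(x in B) (u x * phi1 x)) - (\int[mu]_(x in B) (u x * phi0 x)).
  rewrite -RintegralB//; apply: eq_Rintegral => x _; exact: mulrBr.
move: h1 h0 h2 E2; rewrite h3 -E1.
have I0 : 0 <= \int[mu]_(x in B) phi1 x by apply: Rintegral_ge0 => x /b1 /andP[].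
move: I0; move: (\int[mu]_(x in B) (g x * Phi x)) (\int[mu]_(x in B) (u x * phi1 x))
 (\int[mu]_(x in B) (u x * phi0 x)) (\int[mu]_(x in B) phi1 x) => a b c I I0 h1 h0 h2 E2.
rewrite -{1}(ger0_norm I0) -normrM.
have -> : (u1 - u0) * I = (u1 * I - b) + (- a) + (c - u0 * I) by rewrite -E2; ring.
apply: le_trans (ler_normD _ _) _; apply: le_trans (lerD (ler_normD _ _) (lexx _)) _.
rewrite normrN [`|u1 * I - b|]distrC; lra.
Qed.

End test_pair.

Section axis_step.
Context {R : realType} {d : nat}.
Local Notation pt := 'rV[R]_d.
Local Notation lam := (@leb R d).
Local Notation e_ i := (delta_mx ord0 i : pt).

Lemma is_derive_sub (f : R -> R) (c s l : R) : is_derive (s - c) 1 f l ->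
  is_derive s 1 (fun s => f (s - c)) l.
Proof.
move=> H; have := @is_derive1_comp _ _ (fun t => t - c) s _ _ H (is_derive_shift s 1 (- c)).
by rewrite mulr1.
Qed.

Definition bump (h : R) (y : pt) : pt -> R := tensor (fun j s => bspline h (s - y ord0 j)).

Definition ramp_factor (h t : R) (y : pt) (i j : 'I_d) (s : R) : R :=
  if j == i then ispline h (s - (y ord0 i + t)) - ispline h (s - y ord0 i)
  else bspline h (s - y ord0 j).

(* Integrating [u] against the [i]-th derivative of the ramp compares the
   averages of [u] over two bumps at distance [t]. *)
Definition ramp (h t : R) (y : pt) (i : 'I_d) : pt -> R := tensor (ramp_factor h t y i).

Lemma continuous_sub (f : R -> R) (c : R) : continuous f -> continuous (fun s => f (s - c)).
Proof.
move=> cf t; apply: (@continuous_comp _ _ _ (fun t => t - c)); last exact: cf.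
by apply: continuousB; [exact: cvg_id|exact: cst_continuous].
Qed.

Lemma continuous_bump h y : continuous (bump h y).
Proof.
have H j : continuous (fun s => bspline h (s - y ord0 j)).
  exact/continuous_sub/continuous_third_difference.
exact: (@continuous_prod_coord R d xpredT (fun j s => bspline h (s - y ord0 j)) H).
Qed.

Section positive_scale.
Variables (h t : R).
Hypotheses (h0 : 0 < h) (t0 : 0 <= t).

Lemma ramp_C1 y i : C1 (ramp h t y i).
Proof.
apply: (C1_tensor (F' := fun j s => if j == i then bspline h (s - (y ord0 i + t)) - bspline h (s - y ord0 i)
  else 2 * third_difference h 1 (s - y ord0 j))) => j.
  move=> s; rewrite /ramp_factor; case: eqP => _.
    by apply: is_deriveB; apply: is_derive_sub; exact: is_derive_ispline.
  by apply: is_derive_sub; exact: is_derive_bspline.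
case: eqP => _ s.
  have c (a : R) := @continuous_sub (bspline h) a (@continuous_third_difference R h 2).
  exact: (continuousB (c _ s) (c _ s)).
have c2 : {for s, continuous (fun _ : R => 2 : R)} by exact: cst_continuous.
have c (a : R) := @continuous_sub (third_difference h 1) a (@continuous_third_difference R h 1).
exact: (continuousM c2 (c _ s)).
Qed.

Lemma pderiv_ramp y i x :
  pderiv i (ramp h t y i) x = bump h (t *: e_ i + y) x - bump h y x.
Proof.
have D : is_derive (x ord0 i) 1 (ramp_factor h t y i i)
    (bspline h (x ord0 i - (y ord0 i + t)) - bspline h (x ord0 i - y ord0 i)).
  rewrite /ramp_factor eqxx.
  by apply: is_deriveB; apply: is_derive_sub; exact: is_derive_ispline.
rewrite (pderiv_tensor D) mulrBl /bump /tensor [in RHS](bigD1 i)//= [X in _ = _ - X](bigD1 i)//=.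
rewrite line_coord eqxx; congr (_ * _ - _ * _); apply: eq_bigr => j ji;
  by rewrite /ramp_factor ?line_coord (negbTE ji).
Qed.

Definition ramp_top (y : pt) i : pt := t *: e_ i + (y + const_mx (3 * h)).

Lemma ramp_topE y i j : ramp_top y i ord0 j =
  if j == i then y ord0 j + 3 * h + t else y ord0 j + 3 * h.
Proof. by rewrite /ramp_top line_coord !mxE. Qed.

Lemma ramp_supported y i : supported_in (ramp h t y i) (box (Some (y, ramp_top y i))).
Proof.
have hp := h0; have tp := t0.
apply: tensor_supported => j s; rewrite ramp_topE /ramp_factor; case: eqP => [->|_ yh].
  case: (lerP (y ord0 i) s) => a1 /=; last first.
    by rewrite !ispline_neg ?subr0//; lra.
  rewrite -ltNge => a2; rewrite !ispline_large ?subrr//; lra.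
apply: bspline_out => //; apply: contra yh => /andP[]; lra.
Qed.

Lemma bump_supported0 y i : supported_in (bump h y) (box (Some (y, ramp_top y i))).
Proof.
have hp := h0; have tp := t0.
apply: tensor_supported => j s; rewrite ramp_topE => yh.
by apply: bspline_out => //; apply: contra yh; case: ifP => _ /andP[]; lra.
Qed.

Lemma bump_supported1 y i : supported_in (bump h (t *: e_ i + y)) (box (Some (y, ramp_top y i))).
Proof.
have hp := h0; have tp := t0.
apply: tensor_supported => j s; rewrite ramp_topE line_coord => yh.
by apply: bspline_out => //; apply: contra yh; case: ifP => _ /andP[]; lra.
Qed.

Lemma bump_bounds y x : 0 <= bump h y x <= (9 * h ^+ 2) ^+ d.
Proof.
have b j := bspline_bounds h0 (x ord0 j - y ord0 j).
rewrite /bump /tensor prodr_ge0 /=; last by move=> j _; have /andP[] := b j.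
rewrite -[X in _ ^+ X]card_ord -prodr_const.
by apply: ler_prod => j _; exact: b.
Qed.

Lemma ramp_bound y i x : `|ramp h t y i x| <= (9 * h ^+ 2) ^+ d.-1 * (2 * h ^+ 3).
Proof.
rewrite /ramp /tensor (bigD1 i)//= mulrC normrM; apply: ler_pM => //.
  have -> : d.-1 = #|[pred j : 'I_d | j != i]|.
    by have := cardC1 i; rewrite card_ord => <-; apply: eq_card.
  rewrite -prodr_const normr_prod; apply: ler_prod => j ji.
  rewrite normr_ge0 /= /ramp_factor (negbTE ji).
  by have /andP[b0 b1] := bspline_bounds h0 (x ord0 j - y ord0 j); rewrite ger0_norm.
rewrite /ramp_factor eqxx ler_norml.
have /andP[b0 b1] := ispline_bounds h0 (x ord0 i - (y ord0 i + t)).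
have /andP[c0 c1] := ispline_bounds h0 (x ord0 i - y ord0 i).
lra.
Qed.

Lemma leb_ramp_box y i : t + 3 * h <= 1 ->
  (lam (box (Some (y, ramp_top y i))) <= ((3 * h) ^+ d.-1)%:E)%E.
Proof.
move=> th; apply: le_trans (leb_box_le _ _) _; rewrite lee_fin.
have hp := h0; have tp := t0.
rewrite (bigD1 i)//= -[leRHS]mul1r; apply: ler_pM.
- by rewrite le_max lexx.
- by apply: prodr_ge0 => j _; rewrite le_max lexx.
- by rewrite ramp_topE eqxx ge_max ler01 /=; lra.
have -> : d.-1 = #|[pred j : 'I_d | j != i]|.
  by have := cardC1 i; rewrite card_ord => <-; apply: eq_card.
rewrite -prodr_const; apply: ler_prod => j ji.
by rewrite le_max lexx /= ramp_topE (negbTE ji) ge_max; apply/andP; split; lra.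
Qed.

(** On the middle third of its support in each coordinate the bump is at least [(h ^+ 2) ^+ d], and
    that box has volume [h ^+ d]. *)
Lemma bump_integral_ge y (B : set pt) : measurable (B : set (leb_space R d)) ->
  (forall x, box (Some (y, y + const_mx (3 * h))) x -> B x) ->
  ((h ^+ (3 * d))%:E <= \int[lam]_(x in B) (bump h y x)%:E)%E.
Proof.
move=> mB yB; have hp := h0.
pose A : set pt := box (Some (y + const_mx h, y + const_mx (2 * h))).
have AB x : A x -> B x.
  move=> Ax; apply: yB => j; have := Ax j; rewrite /= !mxE; move=> /andP[]; lra.
have -> : h ^+ (3 * d) = (h ^+ 2) ^+ d * h ^+ d by rewrite -exprM -exprD; congr (_ ^+ _); lia.
have lA : lam A = (h ^+ d)%:E.
  rewrite leb_box; last by move=> j; rewrite !mxE; lra.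
  congr (_%:E); rewrite -[in RHS](card_ord d) -prodr_const; apply: eq_bigr => j _.
  by rewrite !mxE; ring.
have c0 : (0 <= ((h ^+ 2) ^+ d)%:E)%E by rewrite lee_fin exprn_ge0// sqr_ge0.
have mA : measurable (A : set (leb_space R d)) by exact: measurable_box.
rewrite EFinM -lA -(@integral_cst _ (leb_space R d) R lam A mA).
apply: le_integral_ge0 => // x Ax; last by have /andP[] := bump_bounds y x.
rewrite /cst c0 /= lee_fin -[X in _ ^+ X](card_ord d) -prodr_const; apply: ler_prod => j _.
rewrite sqr_ge0 bspline_ge//; have := Ax j; rewrite /= !mxE => /andP[]; lra.
Qed.

End positive_scale.

Hypothesis d_gt0 : (0 < d)%N.

Definition open_cell (v : pt) : set pt := [set x | forall j, v ord0 j < x ord0 j < v ord0 j + 1].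

Lemma open_cell_carpet (v x : pt) : corner 0 v -> (forall j, v ord0 j <= x ord0 j <= v ord0 j + 1) ->
  carpet x.
Proof.
move=> cv xv; rewrite -(addrNK v x) addrC; apply: (corner_carpet d_gt0 cv).
apply/(cell0P d_gt0) => j; have := xv j; rewrite !mxE; lra.
Qed.

Lemma open_open_cell v : open (open_cell v).
Proof. exact: (@open_box R d (fun j => v ord0 j) (fun j => v ord0 j + 1)). Qed.

Lemma small_box (y : pt) (A : set pt) : nbhs y A ->
  exists2 e, 0 < e & forall x : pt, (forall j, y ord0 j <= x ord0 j < y ord0 j + e) -> A x.
Proof.
move=> /nbhs_ballP[e /= e0 eA]; exists e => // x xy; apply: eA; split=> // k j.
by rewrite (ord1 k) /ball/= distrC ger0_norm; have /andP[] := xy j; lra.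
Qed.

(** The bound [(9 h^2)^(d-1) * 2 h^3] of the ramp, times the volume [(3 h)^(d-1)] of its support
    box, divided by the mass [h^(3d)] of a bump: all powers of [h] cancel. *)
Definition step_const : R := 2 * 27 ^+ d.-1.

Lemma step_const_ge0 : 0 <= step_const.
Proof. by rewrite mulr_ge0// exprn_ge0. Qed.

Lemma step_const_scale (M h : R) :
  M * ((9 * h ^+ 2) ^+ d.-1 * (2 * h ^+ 3)) * (3 * h) ^+ d.-1 = step_const * M * h ^+ (3 * d).
Proof.
have -> : (3 * d = 3 * d.-1 + 3)%N by move: d_gt0; lia.
have E : (9 * h ^+ 2) ^+ d.-1 * (3 * h) ^+ d.-1 = 27 ^+ d.-1 * (h ^+ 3) ^+ d.-1.
  by rewrite -!exprMn; congr (_ ^+ _); ring.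
rewrite /step_const exprD exprM.
transitivity (M * 2 * h ^+ 3 * ((9 * h ^+ 2) ^+ d.-1 * (3 * h) ^+ d.-1)); first by ring.
by rewrite E; ring.
Qed.

(** [test_pair_bound] for the ramp between the two points, with [h] so small that [u] varies by at
    most [e / 2] over each bump. The estimate does not depend on [h], and [e] is arbitrary. *)
Lemma axis_step_pos (a u : pt -> R) (g : 'I_d -> pt -> R) (v y : pt) (i : 'I_d) (t M : R) :
  {within @carpet R d, continuous u} -> weak_gradient u g ->
  {ae lam, forall z, carpet z -> sqnorm g z <= (a z)^-1} ->
  corner 0 v -> 0 <= M -> (forall z, open_cell v z -> (a z)^-1 <= M ^+ 2) ->
  0 <= t -> open_cell v y -> open_cell v (t *: e_ i + y) ->
  `|u (t *: e_ i + y) - u y| <= step_const * M.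
Proof.
move=> cu [L2g wg] ga cv M0 aM t0 yv yv'; set y' := t *: e_ i + y in yv' *.
have /subspace_continuousP cu' := cu.
apply/ler_addgt0Pr => e e0.
have near_u z : open_cell v z -> nbhs z (fun x => open_cell v x /\ `|u x - u z| <= e / 2).
  move=> zv; have oz : nbhs z (open_cell v) by apply: open_nbhs_nbhs; split => //; exact: open_open_cell.
  have cz : carpet z by apply: (open_cell_carpet cv) => j; have := zv j; lra.
  have /cvgrPdist_le/(_ (e / 2) (divr_gt0 e0 (ltr0Sn _ _))) H := cu' z cz.
  near=> x; have xv : open_cell v x by near: x.
  split=> //; rewrite distrC.
  have cx : carpet x by apply: (open_cell_carpet cv) => j; have := xv j; lra.
  by move: cx; near: x.
have [e1 e10 h1] := small_box (near_u y yv).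
have [e2 e20 h2] := small_box (near_u y' yv').
(* The bumps have side [3 * h]; the quarter leaves room for the strict inequality in the
   neighbourhoods [h1] and [h2]. *)
pose h := Num.min e1 e2 / 4.
have h0 : 0 < h by rewrite divr_gt0// lt_min e10.
have he1 : 4 * h <= e1 by rewrite /h mulrC divfK// ge_min lexx.
have he2 : 4 * h <= e2 by rewrite /h mulrC divfK// ge_min lexx orbT.
have topE (z : pt) j : (z + const_mx (3 * h)) ord0 j = z ord0 j + 3 * h by rewrite !mxE.
have y'E j : y' ord0 j = if j == i then y ord0 j + t else y ord0 j by exact: line_coord.
pose B := box (Some (y, ramp_top h t y i)).
have BE x : B x <-> forall j, y ord0 j <= x ord0 j <= (if j == i then y ord0 j + 3 * h + t else y ord0 j + 3 * h).
  by split => H j; have := H j; rewrite /= ramp_topE.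
have top1 : open_cell v (y + const_mx (3 * h)) by apply: (h1 _ _).1 => j; rewrite topE; lra.
have top2 : open_cell v (y' + const_mx (3 * h)) by apply: (h2 _ _).1 => j; rewrite topE; lra.
have Bv x : B x -> open_cell v x.
  move=> /BE Bx j; have := Bx j; have := yv j; have := top1 j; have := top2 j.
  by rewrite !topE y'E; case: eqP => [->|_]; lra.
have Bc x : B x -> carpet x.
  by move=> /Bv xv; apply: (open_cell_carpet cv) => j; have := xv j; lra.
have mB : measurable (B : set (leb_space R d)) by exact: measurable_box.
have mc := measurable_carpet (R := R) d_gt0.
have mu_ : measurable_fun (B : set (leb_space R d)) (u : leb_space R d -> R).
  by apply: (measurable_funS mc) => //; exact: within_continuous_measurable_leb.
have mg : measurable_fun (B : set (leb_space R d)) (g i : leb_space R d -> R).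
  by apply: (measurable_funS mc) => //; have [] := L2g i.
have sP : supported_in (ramp h t y i) B by exact: ramp_supported.
have s0 : supported_in (bump h y) B by exact: bump_supported0.
have s1 : supported_in (bump h y') B by exact: bump_supported1.
have cB : compact B by exact: compact_box.
have tP : test_fun (ramp h t y i).
  split; [exact: ramp_C1|exists B => //; split=> // x Bx].
  apply: (@filterS _ (nbhs x) _ (open_cell v)).
    by move=> z zv; apply: (open_cell_carpet cv) => j; have := zv j; lra.
  by apply: open_nbhs_nbhs; split; [exact: open_open_cell|exact: Bv].
have pE : pderiv i (ramp h t y i) = (fun x => bump h y' x - bump h y x).
  by apply/funext => x; rewrite pderiv_ramp.
have W := wg _ i tP.
rewrite (@Rintegral_support R _ (leb_space R d) lam B (@carpet R d) _ Bc) in W; last first.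
  by move=> x Bx; rewrite pE s0// s1// subrr mulr0.
rewrite (@Rintegral_support R _ (leb_space R d) lam B (@carpet R d) _ Bc) in W; last first.
  by move=> x Bx; rewrite sP// mulr0.
rewrite pE in W.
have i0 := integrable_supported (@continuous_bump h y) cB s0.
have i1 := integrable_supported (@continuous_bump h y') cB s1.
have E0 := integral_pderiv0 i (ramp_C1 h t y i) cB sP; rewrite pE in E0.
have E1 := Rintegral_difference0 i1 i0 s1 s0 E0.
have mb z := measurable_funTS (D := (B : set (leb_space R d))) (continuous_measurable_leb (@continuous_bump h z)).
have mP := measurable_funTS (D := (B : set (leb_space R d))) (continuous_measurable_leb (C1_continuous (ramp_C1 h t y i))).
(* The support of the ramp lies in a unit cell, so its long side counts for at most 1 in the
   volume. *)
have th : t + 3 * h <= 1.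
  have := top2 i; have := yv i; have := yv' i; rewrite topE y'E eqxx; lra.
have e20' : 0 <= e / 2 by rewrite divr_ge0// ltW.
have K0 : 0 <= (9 * h ^+ 2) ^+ d.-1 * (2 * h ^+ 3).
  by apply: mulr_ge0; [apply/exprn_ge0/mulr_ge0 => //; exact: sqr_ge0|apply: mulr_ge0 => //; apply/exprn_ge0/ltW].
have close (z : pt) (f0 : pt -> R) : (forall x : pt, (forall j, z ord0 j <= x ord0 j < z ord0 j + 4 * h) ->
    open_cell v x /\ `|u x - u z| <= e / 2) -> f0 = bump h z -> forall x, B x -> `|u x - u z| * f0 x <= e / 2 * f0 x.
  move=> uz -> x Bx; have [b0 _] := andP (bump_bounds h0 z x).
  have [xz|xz] := pselect (forall j, z ord0 j <= x ord0 j <= z ord0 j + 3 * h).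
    by apply: ler_wpM2r => //; apply: (uz _ _).2 => j; have := xz j; lra.
  have -> : bump h z x = 0; last by rewrite !mulr0.
  move/existsNP : xz => [j /negP xj]; rewrite /bump /tensor (bigD1 j)//= bspline_out ?mul0r//.
  by apply: contra xj; lra.
have gM : {ae lam, forall x, B x -> `|g i x| <= M}.
  have [Z [mZ Z0 sZ]] := ga; exists Z; split => // x nx; apply: sZ => gx; apply: nx => Bx.
  rewrite -(ler_pXn2r (n := 2))// ?nnegrE//.
  apply: le_trans (aM _ (Bv _ Bx)); apply: le_trans (gx (Bc _ Bx)).
  rewrite real_normK ?num_real// /sqnorm (bigD1 i)//= lerDl sumr_ge0// => j _; exact: sqr_ge0.
have c1 (x : pt) : (forall j, y ord0 j <= x ord0 j < y ord0 j + 4 * h) ->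
    open_cell v x /\ `|u x - u y| <= e / 2.
  by move=> xy; apply: h1 => j; have := xy j; lra.
have c2 (x : pt) : (forall j, y' ord0 j <= x ord0 j < y' ord0 j + 4 * h) ->
    open_cell v x /\ `|u x - u y'| <= e / 2.
  by move=> xy; apply: h2 => j; have := xy j; lra.
have main := test_pair_bound mB (leb_ramp_box h0 t0 y i th) mu_ mg (mb y') (mb y) mP e20' M0 K0
  (fun x _ => bump_bounds h0 y' x) (fun x _ => bump_bounds h0 y x)
  (close y' _ c2 erefl) (close y _ c1 erefl) gM
  (fun x _ => ramp_bound t h0 y i x) E1 W.
have Bsub x : box (Some (y', y' + const_mx (3 * h))) x -> B x.
  have tp := t0; move=> Bx; apply/BE => j; have := Bx j; rewrite [fst _]/= [snd _]/= topE y'E.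
  by case: eqP => _; move: h0 tp; clear; lra.
have lower : h ^+ (3 * d) <= \int[lam]_(x in B) bump h y' x.
  have := bump_integral_ge h0 t0 mB Bsub; rewrite /Rintegral.
  have f1 : (\int[lam]_(x in B) (bump h y' x)%:E)%E \is a fin_num.
    by apply: integrable_fin_num => //; apply: integrableS i1.
  by rewrite -[X in (_ <= X)%E](fineK f1) lee_fin.
have h3 : 0 < h ^+ (3 * d) by rewrite exprn_gt0.
move: main lower; set I := Rintegral _ _ _ => main lower.
have I0 : 0 < I by exact: lt_le_trans lower.
rewrite -(ler_pM2r I0); apply: le_trans main _.
have -> : 2 * (e / 2) = e by field.
rewrite step_const_scale.
rewrite mulrDl addrC lerD2r; apply: ler_wpM2l lower.
by rewrite mulr_ge0// step_const_ge0.
Unshelve. all: by end_near. Qed.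

End axis_step.

(** * Intrinsic metric and volume growth *)

Section cell_oscillation.
Context {R : realType} {d : nat}.
Local Notation pt := 'rV[R]_d.
Local Notation lam := (@leb R d).
Local Notation e_ i := (delta_mx ord0 i : pt).
Hypothesis d_gt1 : (1 < d)%N.
Let d_gt0 : (0 < d)%N. Proof. exact: ltnW. Qed.

Definition osc_const : R := d%:R * @step_const R d.

Lemma osc_const_ge0 : 0 <= osc_const.
Proof. by rewrite mulr_ge0// step_const_ge0. Qed.

Section admissible.
Variables (a u : pt -> R) (g : 'I_d -> pt -> R).
Hypothesis cu : {within @carpet R d, continuous u}.
Hypothesis gu : weak_gradient u g.
Hypothesis ga : {ae lam, forall z, carpet z -> sqnorm g z <= (a z)^-1}.

Lemma axis_step (v y : pt) i t M : corner 0 v -> 0 <= M ->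
  (forall z, open_cell v z -> (a z)^-1 <= M ^+ 2) ->
  open_cell v y -> open_cell v (t *: e_ i + y) ->
  `|u (t *: e_ i + y) - u y| <= @step_const R d * M.
Proof.
move=> cv M0 aM yv yv'; have [t0|t0] := lerP 0 t.
  exact: (axis_step_pos d_gt0 cu gu ga cv M0 aM).
have yE : y = (- t) *: e_ i + (t *: e_ i + y) by rewrite addrA -scalerDl addNr scale0r add0r.
rewrite distrC {1}yE; apply: (axis_step_pos d_gt0 cu gu ga cv M0 aM) => //; first by rewrite oppr_ge0 ltW.
by rewrite -yE.
Qed.

(** The coordinates are changed one at a time; the intermediate points stay in the open cell, which
    is a product. Hence the factor [d] in [osc_const]. *)
Lemma open_cell_osc (v x y : pt) M : corner 0 v -> 0 <= M ->
  (forall z, open_cell v z -> (a z)^-1 <= M ^+ 2) ->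
  open_cell v x -> open_cell v y -> `|u x - u y| <= osc_const * M.
Proof.
move=> cv M0 aM xv yv.
pose z k : pt := \row_j (if (j < k)%N then x ord0 j else y ord0 j).
have zv k : open_cell v (z k) by move=> j; rewrite mxE; case: ifP.
have step k : (k <= d)%N -> `|u (z k) - u y| <= k%:R * (@step_const R d * M).
  elim: k => [|k IH] kd.
    have -> : z 0%N = y by apply/rowP => j; rewrite mxE.
    by rewrite subrr normr0 mul0r.
  have zE : z k.+1 = (x ord0 (Ordinal kd) - y ord0 (Ordinal kd)) *: e_ (Ordinal kd) + z k.
    apply/rowP => j; rewrite line_coord !mxE; case: eqP => [->|jk] /=.
      by rewrite ltnS leqnn ltnn addrC subrK.
    have jk' : (j : nat) != k by apply/eqP => jk'; apply: jk; exact: val_inj.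
    by rewrite ltnS leq_eqVlt (negbTE jk').
  have s1 : `|u (z k.+1) - u (z k)| <= @step_const R d * M.
    by rewrite zE; apply: axis_step cv M0 aM (zv k) _; rewrite -zE.
  have s2 := IH (ltnW kd).
  rewrite -natr1 mulrDl mul1r.
  have := ler_normD (u (z k.+1) - u (z k)) (u (z k) - u y); rewrite subrKA => s3; lra.
have <- : z d = x by apply/rowP => j; rewrite mxE ltn_ord.
by rewrite /osc_const -mulrA; exact: step.
Qed.

Lemma small_ball (y : pt) (A : set pt) : nbhs y A ->
  exists2 e, 0 < e & forall x : pt, (forall j, `|y ord0 j - x ord0 j| < e) -> A x.
Proof.
move=> /nbhs_ballP[e /= e0 eA]; exists e => // x xy; apply: eA; split=> // k j.
by rewrite (ord1 k); exact: xy.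
Qed.

(** The point [x] is moved a small fraction [s] of the way to the centre of its cell, which lands in
    the open cell, and [u] is continuous within the carpet. *)
Lemma cell_approx (v x : pt) eps : corner 0 v -> cell 0 (x - v) -> 0 < eps ->
  exists2 z, open_cell v z & `|u x - u z| <= eps.
Proof.
move=> cv /(cell0P d_gt0) xv eps0.
have xv' j : v ord0 j <= x ord0 j <= v ord0 j + 1 by have := xv j; rewrite !mxE; lra.
have cx : carpet x by exact: (open_cell_carpet d_gt0 cv).
have /subspace_continuousP cu' := cu.
have /cvgrPdist_le/(_ eps eps0) := cu' x cx.
move=> /small_ball[e e0 eA].
pose s := Num.min 1 e; have s0 : 0 < s by rewrite lt_min ltr01.
have s1 : s <= 1 by rewrite ge_min lexx. have se : s <= e by rewrite ge_min lexx orbT.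
pose z : pt := \row_j (x ord0 j + s * (v ord0 j + 1 / 2 - x ord0 j)).
have zv : open_cell v z.
  by move=> j; rewrite mxE; have := xv' j; nra.
exists z => //; apply: eA.
  move=> j; rewrite mxE opprD addrA subrr sub0r normrN normrM gtr0_norm//.
  have : `|v ord0 j + 1 / 2 - x ord0 j| <= 1 / 2 by rewrite ler_norml; have := xv' j; lra.
  nra.
by apply: (open_cell_carpet d_gt0 cv) => j; have := zv j; lra.
Qed.

Lemma unit_cell_osc (v x y : pt) M : corner 0 v -> 0 <= M ->
  (forall z, open_cell v z -> (a z)^-1 <= M ^+ 2) ->
  cell 0 (x - v) -> cell 0 (y - v) -> `|u x - u y| <= osc_const * M.
Proof.
move=> cv M0 aM xv yv; apply/ler_addgt0Pr => e e0.
have e20 : 0 < e / 2 by rewrite divr_gt0.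
have [x' xv' xx] := cell_approx cv xv e20; have [y' yv' yy] := cell_approx cv yv e20.
have xy := open_cell_osc cv M0 aM xv' yv'.
have := ler_normD (u x - u x') (u x' - u y); rewrite subrKA => t1.
have := ler_normD (u x' - u y') (u y' - u y); rewrite subrKA [`|u y' - u y|]distrC => t2.
lra.
Qed.

End admissible.

Section weighted_oscillation.
Variables (p : R) (u : pt -> R) (g : 'I_d -> pt -> R).
Hypothesis p2 : 2 < p.
Hypothesis cu : {within @carpet R d, continuous u}.
Hypothesis gu : weak_gradient u g.
Hypothesis ga : {ae lam, forall z, carpet z -> sqnorm g z <= (weight p z)^-1}.

Let p0 : 0 < p. Proof. by apply: lt_trans p2. Qed.

(** At distance [3 ^+ n] from the origin gradients are at most [q ^- n]; the assumption [2 < p] says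
    that this decays faster than cells grow. *)
Let q : R := 3 `^ (p / 2).

Let q2 : q ^+ 2 = 3 `^ p.
Proof. by rewrite expr2 -powRD; [congr (_ `^ _); field|apply/implyP; rewrite pnatr_eq0]. Qed.

Let q3 : 3 < q.
Proof.
rewrite -{1}[3]powRr1//; apply: powR3_lt; move: p2; lra.
Qed.

Let q0 : 0 < q. Proof. by apply: lt_trans q3. Qed.

Definition cost (x y : pt) (L : R) := `|u y - u x| <= L.

Definition far n (w : pt) : Prop := exists i, 3 ^+ n <= w ord0 i.

Lemma cost_refl x : carpet x -> cost x x 0.
Proof. by rewrite /cost subrr normr0. Qed.

Lemma cost_trans x y z L M : cost x y L -> cost y z M -> cost x z (L + M).
Proof.
rewrite /cost => xy yz; have := ler_normD (u z - u y) (u y - u x); rewrite subrKA; lra.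
Qed.

Lemma cost_mono x y L M : cost x y L -> L <= M -> cost x y M.
Proof. by move=> h LM; exact: le_trans LM. Qed.

Lemma far_shift n v j m : far n v -> far n (v + offset j m).
Proof.
move=> [i iv]; exists i; rewrite !mxE; apply: le_trans iv _.
by rewrite lerDl mulr_ge0// exprn_ge0.
Qed.

Lemma far_unit_cost n w x : corner 0 w -> far n w -> cell 0 x ->
  cost w (w + x) (osc_const * q ^- n).
Proof.
move=> cw [i iw] cx; apply: (unit_cell_osc cu gu ga cw).
- by rewrite invr_ge0 exprn_ge0// ltW.
- move=> z zw; have cz : carpet z.
    by apply: (open_cell_carpet d_gt0 cw) => j; have := zw j; lra.
  rewrite exprVn -exprM mulnC exprM q2 lef_pV2 ?posrE ?exprn_gt0 ?powR3_gt0 ?weight_gt0//.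
  by apply: (weight_ge_coord (i := i) d_gt1 p0 cz); have := zw i; lra.
- by rewrite addrAC subrr add0r.
- rewrite subrr; apply/(cell0P d_gt0) => j; rewrite mxE; lra.
Qed.

Let r : R := 3 / q.

(** The constant [osc_const] plus the sum of [4 d osc_const r^i] over [i < n]: passing from cell [i]
    to cell [i.+1] takes at most [2 d] edges and one [cell_cost] of factor [2 d], each worth
    [osc_const r^i]. *)
Definition osc_bound n : R :=
  osc_const + 4 * d%:R * osc_const * ((1 - r ^+ n) / (1 - r)).

Lemma cell_osc n x : cell n x -> cost 0 x (osc_bound n).
Proof.
have r1 : r < 1 by rewrite /r ltr_pdivrMr// mul1r.
have o0 := osc_const_ge0.
elim: n x => [|n IH] x cx.
  rewrite /osc_bound expr0 subrr mul0r mulr0 addr0 -[osc_const]mulr1 /cost.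
  apply: (unit_cell_osc cu gu ga (corner_origin 0)) => //; rewrite ?subr0//.
    by move=> z _; rewrite expr1n weight_inv_le1.
  by apply/(cell0P d_gt0) => j; rewrite mxE lexx ler01.
have [j [jP xj]] := cell_parent d_gt0 cx.
have TE : osc_bound n.+1 = osc_bound n + 4 * d%:R * osc_const * r ^+ n.
  by rewrite /osc_bound exprS; field; rewrite subr_eq0 gt_eqF.
have rn0 : 0 <= 4 * d%:R * osc_const * r ^+ n.
  by rewrite !mulr_ge0// exprn_ge0// divr_ge0// ltW.
have [j0|j0] := pselect (exists i, 0 < j i)%N; last first.
  have E : offset j n = 0 :> pt.
    rewrite -(offset0 n); apply: eq_offset => l; apply/eqP; rewrite -leqn0 leqNgt.
    by apply/negP => kl; apply: j0; exists l.
  by rewrite E subr0 in xj; apply: cost_mono (IH _ xj) _; rewrite TE lerDl.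
have K0 : 0 <= osc_const * q ^- n by rewrite mulr_ge0// invr_ge0 exprn_ge0// ltW.
have farj k : (exists i, 0 < k i)%N -> far n (0 + offset k n).
  move=> [i ki]; exists i; rewrite add0r mxE ler_peMr ?exprn_ge0//.
  by rewrite (ler_nat _ 1).
have [i Si] := stair_cost d_gt1 K0 cost_refl cost_trans cost_mono (@far_unit_cost n)
  (@far_shift n) (corner_origin n.+1) farj jP j0.
have cj : corner n ((0 : pt) + offset j n) by apply: corner_child => //; exact: corner_origin.
have Sx := cell_cost d_gt1 K0 cost_refl cost_trans cost_mono (@far_unit_cost n)
  (@far_shift n) cj (farj _ j0) xj.
(* The end of the [i]-th edge still belongs to cell [n], so the induction hypothesis covers the part
   near the origin and the staircase starts at distance [3 ^+ n]. *)
have ui : cell n ((0 : pt) + offset (unit_index i) n).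
  rewrite add0r; apply/(cellP d_gt0); split => [l|m mn hm].
    rewrite mxE /unit_index; case: eqP => _; rewrite ?mulr1 ?mulr0 lexx ?exprn_ge0//.
  have [l li] := other_index d_gt1 i.
  have := hole_gt l hm; rewrite mxE /unit_index (negbTE li) mulr0.
  by apply/negP; rewrite -leNgt exprn_ge0.
have := cost_trans (cost_trans (IH _ ui) Si) Sx.
rewrite add0r addrC subrK => /cost_mono; apply.
have jd : (\sum_i j i)%:R <= (2 * d)%:R :> R by rewrite ler_nat sum_child_index.
rewrite TE -addrA lerD2l.
have rE : osc_const / q ^+ n * 3 ^+ n = osc_const * r ^+ n.
  by rewrite /r expr_div_n; field; rewrite expf_neq0// gt_eqF.
have -> : osc_const / q ^+ n * (2 * d)%:R * 3 ^+ n = osc_const * r ^+ n * (2 * d)%:R.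
  by rewrite -rE; ring.
rewrite rE natrM in jd *.
have -> : 4 * d%:R * osc_const * r ^+ n = osc_const * r ^+ n * (2%:R * d%:R) + osc_const * r ^+ n * (2%:R * d%:R).
  by ring.
rewrite lerD2r; apply: ler_wpM2l => //.
by rewrite mulr_ge0// exprn_ge0// divr_ge0// ltW.
Qed.

Lemma osc_bound_le n : osc_bound n <= osc_const + 4 * d%:R * osc_const / (1 - r).
Proof.
have r1 : r < 1 by rewrite /r ltr_pdivrMr// mul1r.
have r0 : 0 <= r by rewrite divr_ge0// ltW.
rewrite lerD2l; apply: ler_wpM2l; first by rewrite !mulr_ge0// osc_const_ge0.
rewrite ler_pdivrMr ?subr_gt0// mulVf ?subr_eq0 ?gt_eqF//.
by rewrite lerBlDr lerDl exprn_ge0.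
Qed.

Lemma weighted_osc x : carpet x -> `|u x - u 0| <= osc_const + 4 * d%:R * osc_const / (1 - r).
Proof.
by move=> /carpet_cell[n /cell_osc]; move=> /le_trans; apply; exact: osc_bound_le.
Qed.

End weighted_oscillation.

Lemma rho_a_bounded (p : R) : 2 < p -> exists2 C : R, 0 <= C &
  forall x y : pt, carpet x -> carpet y -> (rho_a (weight p) x y <= C%:E)%E.
Proof.
move=> p2; set C := osc_const + 4 * d%:R * osc_const / (1 - 3 / 3 `^ (p / 2)).
have H u g : {within @carpet R d, continuous u} -> weak_gradient u g ->
  {ae lam, forall z, carpet z -> sqnorm g z <= (weight p z)^-1} ->
  forall x, carpet x -> `|u x - u 0| <= C.
  by move=> cu gu ga x cx; exact: (weighted_osc p2 cu gu ga).
exists (`|C| + `|C|) => [|x y cx cy]; first by rewrite addr_ge0.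
apply: ge_ereal_sup => _ [u [_ cu [g gu ga]] <-]; rewrite lee_fin.
have h1 := H u g cu gu ga x cx; have h2 := H u g cu gu ga y cy.
apply: le_trans (ler_norm _) _.
have := ler_normD (u x - u 0) (u 0 - u y); rewrite subrKA [`|u 0 - u y|]distrC.
have := ler_norm C; lra.
Qed.

End cell_oscillation.

(** * Logarithmic lower bound for the intrinsic metric *)

Section logarithmic_functions.
Context {R : realType} {d : nat}.
Local Notation pt := 'rV[R]_d.
Local Notation lam := (@leb R d).
Local Notation e_ i := (delta_mx ord0 i : pt).
Hypothesis d_gt1 : (1 < d)%N.

Definition sqsum (x : pt) : R := \sum_j x ord0 j ^+ 2.

Lemma sqsum_ge0 x : 0 <= sqsum x.
Proof. by apply: sumr_ge0 => j _; exact: sqr_ge0. Qed.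

Lemma coord_le_sqsum (x : pt) j : x ord0 j ^+ 2 <= sqsum x.
Proof. by rewrite /sqsum (bigD1 j)//= lerDl; apply: sumr_ge0 => k _; exact: sqr_ge0. Qed.

Lemma differentiable_sqsum x : differentiable sqsum x.
Proof.
rewrite /sqsum; elim: (index_enum _) => [|j s IH].
  have -> : (fun y : pt => \sum_(j <- [::]) y ord0 j ^+ 2) = cst 0.
    by apply/funext => y; rewrite big_nil.
  exact: differentiable_cst.
have -> : (fun y : pt => \sum_(j0 <- j :: s) y ord0 j0 ^+ 2) =
    (fun y : pt => y ord0 j) * (fun y : pt => y ord0 j) + (fun y : pt => \sum_(j0 <- s) y ord0 j0 ^+ 2).
  by apply/funext => y; rewrite big_cons expr2.
apply: differentiableD => //.
by apply: differentiableM; exact: differentiable_coord.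
Qed.

Lemma sqsum_line x i t : sqsum (t *: e_ i + x) = sqsum x + (2 * x ord0 i * t + t ^+ 2).
Proof.
rewrite /sqsum (bigD1 i)//= [in RHS](bigD1 i)//= line_coord eqxx.
have -> : \sum_(j | j != i) (t *: e_ i + x) ord0 j ^+ 2 = \sum_(j | j != i) x ord0 j ^+ 2.
  by apply: eq_bigr => j /negbTE ji; rewrite line_coord ji.
ring.
Qed.

Section profile.
Variables (c L : R).
Hypotheses (c0 : 0 < c) (L0 : 0 < L).

(* [c (L - ln (1 + z))] up to a quadratic truncation, which makes it C^1 with
   bounded support. *)
Definition log_profile (z : R) : R := c / (2 * L) * pos (L - ln (1 + z)) ^+ 2.

Definition log_slope (z : R) : R := - (c / L * pos (L - ln (1 + z)) / (1 + z)).

Lemma is_derive_log_profile (z : R) : 0 <= z -> is_derive z 1 log_profile (log_slope z).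
Proof.
move=> z0; have z1 : 0 < 1 + z by rewrite ltr_wpDr.
have d1 : is_derive z 1 (fun t => L - ln (1 + t)) (- (1 + z)^-1).
  have dl := is_derive1_ln z1.
  have ds : is_derive z 1 (fun t : R => 1 + t) 1.
    have := is_derive_shift z 1 (1 : R).
    by rewrite (_ : shift 1 = (fun t : R => 1 + t))//; apply/funext => t; rewrite addrC.
  have dc := @is_derive1_comp _ (@ln R) (fun t : R => 1 + t) z _ _ dl ds.
  have := is_deriveB (is_derive_cst L z 1) dc.
  by rewrite mulr1 sub0r.
have d2 := @is_derive1_comp _ (fun t => pos t ^+ 2) (fun t => L - ln (1 + t)) z _ _ (is_derive_pos2 (L - ln (1 + z))) d1.
have := is_deriveZ (c / (2 * L)) d2.
rewrite (_ : c / (2 * L) *: _ = log_slope z); first by [].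
by rewrite /log_slope /GRing.scale/=; field; rewrite !gt_eqF.
Qed.

Lemma continuous_log_slope (z : R) : 0 <= z -> {for z, continuous log_slope}.
Proof.
move=> z0; have z1 : 0 < 1 + z by rewrite ltr_wpDr.
have c1 : {for z, continuous (fun t : R => 1 + t)}.
  by apply: continuousD; [exact: cst_continuous|exact: cvg_id].
have c2 : {for z, continuous (fun t : R => ln (1 + t))}.
  by apply: (@continuous_comp _ _ _ (fun t : R => 1 + t) (@ln R)) => //; exact: continuous_ln.
have c3 : {for z, continuous (fun t : R => L - ln (1 + t))}.
  by apply: continuousB => //; exact: cst_continuous.
have c4 : {for z, continuous (fun t : R => pos (L - ln (1 + t)))}.
  by apply: (@continuous_comp _ _ _ (fun t : R => L - ln (1 + t)) (@pos R)) => //; exact: continuous_pos.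
have cc : {for z, continuous (fun t : R => c / L)} by exact: cst_continuous.
have c5 : {for z, continuous (fun t : R => (1 + t)^-1)}.
  by apply: continuousV => //; rewrite gt_eqF.
exact: (continuousN (continuousM (continuousM cc c4) c5)).
Qed.

Definition log_cutoff (x : pt) : R := log_profile (sqsum x).

Lemma pderiv_log_cutoff i x : pderiv i log_cutoff x = log_slope (sqsum x) * (2 * x ord0 i).
Proof.
apply: pderiv_line; rewrite /log_cutoff.
under eq_fun do rewrite sqsum_line.
have D : is_derive (0 : R) 1 (fun t => sqsum x + (2 * x ord0 i * t + t ^+ 2)) (2 * x ord0 i).
  apply: (@is_derive_quadratic _ _ _ _ 1) => h.
  rewrite (_ : _ - _ - _ = h ^+ 2); last by rewrite addr0; ring.
  by rewrite ger0_norm ?sqr_ge0// mul1r.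
apply: (@is_derive1_comp _ log_profile (fun t => sqsum x + (2 * x ord0 i * t + t ^+ 2))).
rewrite mulr0 expr0n !addr0; exact/is_derive_log_profile/sqsum_ge0.
Qed.

Lemma log_cutoff_C1_0 : C1_0 log_cutoff.
Proof.
have ex : 1 <= expR L by rewrite -expR0 ler_expR ltW.
split; last first.
  exists (cube (expR L)); first exact: compact_box.
  move=> x /cubeP/existsNP[i /negP]; rewrite -ltNge => xi.
  rewrite /log_cutoff /log_profile pos_le ?expr0n ?mulr0// subr_le0.
  rewrite -[leLHS](expRK L) ler_ln ?posrE ?expR_gt0 ?ltr_wpDr ?sqsum_ge0//.
  have := coord_le_sqsum x i; rewrite -real_normK ?num_real//; nra.
split => [x|i].
  apply: (@differentiable_comp _ _ _ _ sqsum log_profile); first exact: differentiable_sqsum.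
  by apply/derivable1_diffP; have [] := is_derive_log_profile (sqsum_ge0 x).
rewrite (_ : pderiv i log_cutoff = (fun x => log_slope (sqsum x) * (2 * x ord0 i))); last first.
  by apply/funext => x; exact: pderiv_log_cutoff.
move=> x; have c1 : {for x, continuous (fun y : pt => log_slope (sqsum y))}.
  apply: (@continuous_comp _ _ _ sqsum); last exact/continuous_log_slope/sqsum_ge0.
  exact/differentiable_continuous/differentiable_sqsum.
have c2 : {for x, continuous (fun y : pt => 2 * y ord0 i)}.
  have cc : {for x, continuous (fun _ : pt => 2 : R)} by exact: cst_continuous.
  exact: (continuousM cc (@coord_continuous _ _ _ ord0 i x)).
exact: (continuousM c1 c2).
Qed.

(** The squared gradient is [4 |x|^2] times the squared slope, and the slope is at most
    [c / (1 + |x|^2)] in absolute value because the truncation factor [pos (L - ln (1 + |x|^2)) / L]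
    is at most 1. *)
Lemma sqnorm_log_cutoff x : sqnorm (fun i => pderiv i log_cutoff) x <= 4 * c ^+ 2 / (1 + sqsum x).
Proof.
have s0 := sqsum_ge0 x; have s1 : 0 < 1 + sqsum x by rewrite ltr_wpDr.
have -> : sqnorm (fun i => pderiv i log_cutoff) x = log_slope (sqsum x) ^+ 2 * (4 * sqsum x).
  rewrite /sqnorm /sqsum !mulr_sumr; apply: eq_bigr => i _.
  by rewrite pderiv_log_cutoff exprMn exprMn; ring.
have ln0 : 0 <= ln (1 + sqsum x) by rewrite ln_ge0// lerDl.
have P : 0 <= pos (L - ln (1 + sqsum x)) <= L.
  by rewrite /pos le_max lexx ge_max (ltW L0) gerBl.
rewrite /log_slope sqrrN !exprMn.
have -> : c ^+ 2 * L^-1 ^+ 2 * pos (L - ln (1 + sqsum x)) ^+ 2 * (1 + sqsum x)^-1 ^+ 2 * (4 * sqsum x) =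
  4 * c ^+ 2 / (1 + sqsum x) * ((pos (L - ln (1 + sqsum x)) / L) ^+ 2 * (sqsum x / (1 + sqsum x))).
  by field; rewrite !gt_eqF.
have q1 : 0 <= pos (L - ln (1 + sqsum x)) / L <= 1.
  have /andP[P0 P1] := P; rewrite divr_ge0 ?(ltW L0)//= ler_pdivrMr// mul1r//.
have q2 : 0 <= sqsum x / (1 + sqsum x) <= 1.
  by rewrite divr_ge0 ?(ltW s1)//= ler_pdivrMr// mul1r lerDr.
apply: ler_piMr; first by rewrite divr_ge0 ?(ltW s1)// mulr_ge0// sqr_ge0.
case/andP: q1 => q10 q11; case/andP: q2 => q20 q21.
by apply: mulr_ile1; rewrite ?sqr_ge0 ?expr_le1.
Qed.

End profile.

(** Compares path distance with the Euclidean norm: if the least cell containing [x] has index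
    [k.+1], a coordinate exceeds [3 ^+ k]. The factor 9 is the square of the ratio of the two
    scales. *)
Lemma weight2_le_sqsum (x : pt) : carpet x -> weight 2 x <= 9 * @weight_const R d 2 * (1 + sqsum x).
Proof.
move=> cx; have W0 := @weight_const_gt0 R d d_gt1 2.
have s0 := sqsum_ge0 x.
have ex : exists n, `[< cell n x >] by have [n xn] := carpet_cell cx; exists n; exact/asboolP.
have p9 : 3 `^ 2 = 9 :> R by rewrite (@powR_mulrn R 3 2)//; ring.
case: (ex_minnP ex) => -[|k] /asboolP xk kmin; have w := weight_le_cell d_gt1 (ltr0Sn R 1) xk.
  apply: le_trans w _; rewrite expr0; nra.
have [|i xi] := not_cell (k := k) cx.
  by move=> xk'; have := kmin k (asboolT xk'); rewrite ltnn.
apply: le_trans w _; rewrite p9 exprS (mulrCA _ 9) -mulrA ler_pM2l// ler_pM2l//.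
have k0 : 0 < 3 ^+ k :> R by exact: exprn_gt0.
have := coord_le_sqsum x i; rewrite (_ : (9 : R) = 3 ^+ 2); last by ring.
rewrite -exprM mulnC exprM; nra.
Qed.

(** With [W = weight_const 2] this gives [4 * rho_const ^+ 2 * (9 * W) = W^-1 <= 1], which is what
    admissibility of [log_cutoff] requires. *)
Definition rho_const : R := (6 * @weight_const R d 2)^-1.

Lemma rho_const_gt0 : 0 < rho_const.
Proof. by rewrite invr_gt0 mulr_gt0// weight_const_gt0. Qed.

(** [L] is chosen so that the cutoff vanishes at [y], while its value at 0 is [rho_const * L / 2],
    the half being due to the quadratic truncation. As [p <= 2], the gradient bound for the weight
    of exponent 2 is enough. *)
Lemma rho_a_ge (p : R) (y : pt) : 0 < p -> p <= 2 -> carpet y -> 0 < sqsum y ->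
  ((rho_const / 2 * ln (1 + sqsum y))%:E <= rho_a (weight p) 0 y)%E.
Proof.
move=> p0 p2 cy y0; set L := ln (1 + sqsum y).
have L0 : 0 < L by rewrite ln_gt0// ltrDl.
have c0 := rho_const_gt0.
have C10 := log_cutoff_C1_0 rho_const L0.
have W1 : 1 <= @weight_const R d 2.
  rewrite /weight_const (@powR_mulrn R _ 2); last exact/ltW/cell_diam_gt0.
  exact/exprn_ege1/cell_diam_ge1.
apply: ereal_sup_ubound; exists (log_cutoff rho_const L).
  split; first by apply: D_a_C1 => // x; exact: weight_ge1.
    exact/continuous_subspaceT/C1_continuous/C10.1.
  exists (fun i => pderiv i (log_cutoff rho_const L)); first exact: weak_gradient_C1.
  apply: aeW => z cz; apply: le_trans (sqnorm_log_cutoff rho_const L0 z) _.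
  have s1 : 0 < 1 + sqsum z by rewrite ltr_wpDr// sqsum_ge0.
  have w2 := weight2_le_sqsum cz; have wp := le_weight d_gt1 cz p0 p2.
  rewrite -[leLHS]invrK lef_pV2 ?posrE ?weight_gt0//.
    rewrite invf_div; apply: le_trans wp (le_trans w2 _).
    rewrite /rho_const; set W := weight_const 2 in W1 *.
    rewrite ler_pdivlMr; last by rewrite mulr_gt0// exprn_gt0// invr_gt0; lra.
    rewrite mulrAC -[leRHS]mul1r ler_wpM2r ?(ltW s1)//.
    rewrite exprVn (_ : 9 * W * _ = W^-1); last by field; lra.
    by rewrite invf_le1//; lra.
  by rewrite invr_gt0 divr_gt0// mulr_gt0// exprn_gt0.
congr (_%:E); rewrite /log_cutoff /log_profile.
have -> : sqsum 0 = 0 by rewrite /sqsum big1// => j _; rewrite mxE expr0n.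
rewrite addr0 ln1 subr0 -/L subrr [pos 0]pos_le// expr0n mulr0 subr0 pos_ge ?(ltW L0)//.
by field; rewrite gt_eqF.
Qed.

End logarithmic_functions.

(** * The volume growth condition *)

Section volume_growth.
Context {R : realType} {d : nat}.
Local Notation pt := 'rV[R]_d.
Local Notation lam := (@leb R d).
Hypothesis d_gt1 : (1 < d)%N.

Lemma VGC_of_linear_log (a : pt -> R) (x : pt) (K : R) : carpet x -> 0 < K ->
  (forall r, 1 <= r -> (m_a a (rho_ball a x r) < +oo)%E /\
    Num.max 1 (ln (fine (m_a a (rho_ball a x r)))) <= K * r) -> VGC a.
Proof.
move=> cx K0 H; exists x => //; apply/eqP; rewrite -leye_eq.
have -> : +oo%E = (\int[lebesgue_measure]_(r in `[1%R, +oo[) (K^-1)%:E)%E :> \bar R.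
  rewrite integral_cst//= lebesgue_measure_itv/= ltry.
  by rewrite addye// gt0_muley// lte_fin invr_gt0.
have m1 r : 0 < Num.max 1 (ln (fine (m_a a (rho_ball a x r)))) by rewrite lt_max ltr01.
apply: le_integral_ge0 => // r; rewrite /= in_itv/= andbT => r1.
  rewrite !lee_fin invr_ge0 (ltW K0) /= /VGC_integrand.
  have [moo mr] := H r r1; rewrite lt_eqF// ler_pdivlMr// mulrC ler_pdivrMr//.
  by rewrite mulrC.
rewrite /VGC_integrand lee_fin; case: ifP => // _; rewrite divr_ge0 ?(ltW (m1 _))//; lra.
Qed.

Lemma max_ln_le (m : \bar R) (M : R) : (0 <= m)%E -> (m <= M%:E)%E -> 1 <= M ->
  Num.max 1 (ln (fine m)) <= Num.max 1 (ln M).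
Proof.
case: m => [m| |]//; rewrite !lee_fin => m0 mM M1 /=.
rewrite ge_max le_max lexx /= le_max; have [m0'|m0'] := ltP 0 m.
  by rewrite ler_ln ?posrE ?mM ?orbT//; lra.
by rewrite ln0// ln_ge0 ?orbT.
Qed.

Lemma VGC_large (p : R) : 0 < p -> dim_f R d < p -> VGC (@weight R d p).
Proof.
move=> p0 dp; have [C C0 mC] := m_a_carpet_lty d_gt1 p0 dp.
pose K := Num.max 1 (ln (1 + C)).
have K0 : 0 < K by rewrite lt_max ltr01.
apply: (@VGC_of_linear_log _ 0 K) => //; first exact: carpet0.
move=> r r1; split; first by apply: le_lt_trans (mC _) _; rewrite ltry.
apply: (@le_trans _ _ K); last by rewrite ler_peMr// ltW.
apply: max_ln_le; last by rewrite lerDl.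
  by apply: integral_ge0 => x _; rewrite lee_fin weight_inv_ge0.
by apply: le_trans (mC _) _; rewrite lee_fin lerDr.
Qed.

Lemma VGC_small (p : R) : 0 < p -> p <= 2 -> VGC (@weight R d p).
Proof.
move=> p0 p2; have c0 := @rho_const_gt0 R d d_gt1.
pose E r : R := expR (r * (2 / @rho_const R d)).
pose K := 1 + d%:R * (ln 2 + 2 / @rho_const R d).
have ln20 : 0 <= ln 2 :> R by apply: ln_ge0; rewrite ler1n.
have K1 : 1 <= K by rewrite lerDl mulr_ge0// addr_ge0// divr_ge0// ltW.
apply: (@VGC_of_linear_log _ 0 K); [exact: carpet0|lra|].
move=> r r1.
have E1 : 1 <= E r by rewrite -expR0 ler_expR mulr_ge0 ?divr_ge0 ?(ltW c0)//; lra.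
(* In the ball [ln (1 + sqsum y)] is less than [2 r / rho_const], so squared coordinates are at most
   [E r]; since [1 <= E r], so are the coordinates. *)
have sub : rho_ball (weight p) 0 r `<=` (cube (E r) : set pt).
  move=> y yb; have [cy yr] : carpet y /\ (rho_a (weight p) 0 y < r%:E)%E := yb.
  apply/cubeP => j.
  have [y0|y0] := ltP 0 (sqsum y); last first.
    have := coord_le_sqsum y j => yj.
    have : `|y ord0 j| ^+ 2 <= 0 by rewrite real_normK ?num_real//; lra.
    have := normr_ge0 (y ord0 j); nra.
  have := le_lt_trans (rho_a_ge d_gt1 p0 p2 cy y0) yr; rewrite lte_fin => lt1.
  have : ln (1 + sqsum y) < r * (2 / @rho_const R d).
    by rewrite mulrA ltr_pdivlMr// mulrC; lra.
  rewrite -ltr_expR lnK ?posrE ?addr_gt0// -/(E r) => lt2.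
  have yj := coord_le_sqsum y j.
  have : `|y ord0 j| ^+ 2 <= E r by rewrite real_normK ?num_real//; lra.
  have := normr_ge0 (y ord0 j); nra.
have mle : (m_a (weight p) (rho_ball (weight p) (0 : pt) r) <= ((2 * E r) ^+ d)%:E)%E.
  apply: le_trans (le_m_a _ sub) _; first by move=> x; rewrite ltW// weight_gt0.
  apply: le_trans (m_a_le_leb _ (measurable_cube (E r))) _; first by move=> x; exact: weight_ge1.
  apply: le_trans (leb_box_le _ _) _; rewrite lee_fin /=.
  rewrite -[leRHS](_ : \prod_(i < d) (2 * E r) = _); last by rewrite prodr_const card_ord.
  apply: ler_prod => i _; rewrite le_max lexx /= !mxE ge_max; apply/andP; split; lra.
have M1 : 1 <= (2 * E r) ^+ d by apply: exprn_ege1; lra.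
split; first by apply: le_lt_trans mle _; rewrite ltry.
apply: le_trans (max_ln_le _ mle M1) _.
  by apply: integral_ge0 => x _; rewrite lee_fin weight_inv_ge0.
rewrite ge_max; apply/andP; split; first nra.
rewrite lnXn; last lra.
rewrite lnM ?posrE ?expR_gt0// expRK -[_ *+ d]mulr_natl /K.
have d0 : 0 <= d%:R :> R by [].
have q0 : 0 <= 2 / @rho_const R d by rewrite divr_ge0// ltW.
move: (2 / rho_const) (ln 2) q0 ln20 (d%:R) d0 => a b a0 b0 D D0.
have : D * (b + r * a) <= D * ((b + a) * r) by apply: ler_wpM2l => //; nra.
nra.
Qed.

(** For radii above the bound [C] of the metric the ball is the whole carpet, of infinite mass, and
    the integrand is 0. On the remaining bounded range the integrand is at most [r], its denominator
    being at least 1. *)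
Lemma not_VGC (p : R) : 2 < p -> p <= dim_f R d -> ~ VGC (@weight R d p).
Proof.
move=> p2 pd [x cx]; have p0 : 0 < p by lra.
have [C C0 rC] := rho_a_bounded d_gt1 p2.
move=> H; have : (+oo%E <= ((C + 1) * (C + 1 - 1))%:E :> \bar R)%E; last by [].
rewrite -[leLHS]H -(integral_itv_cst (C + 1)); last by rewrite lerDr.
apply: le_integral_restrict => r; rewrite /patch.
have -> : point = 0%E :> \bar R by [].
case: ifPn => [|_]; last by case: ifP => _; rewrite !lexx ?lee_fin//=; lra.
rewrite inE/= in_itv/= andbT => r1.
have i0 : 0 <= VGC_integrand (weight p) x r.
  rewrite /VGC_integrand; case: ifP => // _; rewrite divr_ge0//; first lra.
  by rewrite le_max ler01.
rewrite !lee_fin i0 /=.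
have [rC'|rC'] := leP r (C + 1).
  rewrite mem_set/=; last by rewrite in_itv/= r1.
  rewrite lee_fin /VGC_integrand; case: ifP => // _; first lra.
  apply: le_trans rC'; rewrite ler_piMr//; first lra.
  by rewrite invf_le1 ?le_max ?lexx// lt_max ltr01.
rewrite memNset; last by rewrite /= in_itv/= r1 leNgt rC'.
rewrite lee_fin /VGC_integrand.
have -> : rho_ball (weight p) x r = @carpet R d.
  apply/seteqP; split => [y []//|y cy]; split => //=.
  by apply: le_lt_trans (rC x y cx cy) _; rewrite lte_fin; lra.
by rewrite m_a_carpet_infty// eqxx.
Qed.

Lemma VGC_iff (p : R) : 0 < p -> VGC (@weight R d p) <-> p <= 2 \/ dim_f R d < p.
Proof.
move=> p0; split => [H|[]]; last 2 first; [exact: VGC_small|exact: VGC_large|].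
have [p2|p2] := leP p 2; first by left.
by have [dp|dp] := ltP (dim_f R d) p; [right|case: (not_VGC p2 dp H)].
Qed.

End volume_growth.

(** * Occupation times *)

Section occupation.
Context {R : realType} {d : nat}.
Local Notation pt := 'rV[R]_d.
Local Notation lam := (@leb R d).
Context (h : R -> pt -> pt -> R).
Context {dO : measure_display} {Omega : measurableType dO}.
Context (P : pt -> probability Omega R) (W : R -> Omega -> pt).
Hypothesis hW : reflecting_BM h P W.

Lemma measurable_position t i : 0 <= t -> measurable_fun setT (fun w => W t w ord0 i).
Proof.
move=> t0; apply: (measurability _ (RGenOInfty.measurableE R)) => //.
move=> _ [_ [c ->] <-]; rewrite setTI.
have -> : (fun w => W t w ord0 i) @^-1` `]c, +oo[%classic = W t @^-1` [set y : pt | c < y ord0 i].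
  by apply/seteqP; split => w /=; rewrite in_itv/= andbT.
apply: (bm_meas hW) => //.
have -> : [set y : pt | c < y ord0 i] = (fun y : pt => y ord0 i) @^-1` [set z | c < z] by [].
by apply: open_comp => [y _|]; [exact: coord_continuous|exact: open_gt].
Qed.

(** Times are clamped at 0 to get a function on the whole product, while [bm_meas] and [bm_cont]
    concern nonnegative times. *)
Definition path_coord i (z : measurableTypeR R * Omega) : R := W (Num.max 0 z.1) z.2 ord0 i.

Definition grid n (s : R) : R := (Num.truncn (Num.max 0 s * 2 ^+ n))%:R / 2 ^+ n.

Lemma grid_ge0 n s : 0 <= grid n s.
Proof. by rewrite divr_ge0// exprn_ge0. Qed.

Lemma grid_close n s : `|Num.max 0 s - grid n s| <= 2 ^- n.
Proof.
have p2 : 0 < 2 ^+ n :> R by exact: exprn_gt0.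
have m0 : 0 <= Num.max 0 s :> R by rewrite le_max lexx.
have := truncn_itv (mulr_ge0 m0 (ltW p2)); set k := Num.truncn _ => /andP[k1 k2].
have g : grid n s * 2 ^+ n = k%:R by rewrite /grid divfK ?gt_eqF.
rewrite -(ler_pM2r p2) mulVf ?gt_eqF// -[X in _ * X <= _](gtr0_norm p2) -normrM mulrBl g.
by rewrite ger0_norm ?subr_ge0//; move: k2; rewrite -natr1; lra.
Qed.

Lemma measurable_path_grid n i :
  measurable_fun setT (fun z : measurableTypeR R * Omega => W (grid n z.1) z.2 ord0 i).
Proof.
pose I k : set (measurableTypeR R * Omega) := [set z | Num.truncn (Num.max 0 z.1 * 2 ^+ n : R) = k].
have mI k : measurable (I k).
  pose f (z : measurableTypeR R * Omega) : R := Num.max 0 z.1 * 2 ^+ n.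
  have mf : measurable_fun setT f.
    apply: measurable_funM => //.
    by apply: measurable_maxr => //; exact: measurable_fst.
  have -> : I k = setT `&` f @^-1` `[k%:R, k.+1%:R[%classic.
    rewrite setTI; apply/seteqP; split => z /=; rewrite in_itv/= /f => H.
      by rewrite -H truncn_itv// mulr_ge0 ?exprn_ge0// le_max lexx.
    exact: truncn_def.
  exact: mf.
have -> : [set: measurableTypeR R * Omega] = \bigcup_k I k.
  by apply/seteqP; split => z // _; exists (Num.truncn (Num.max 0 z.1 * 2 ^+ n : R)).
apply/measurable_fun_bigcup => // k.
apply: (eq_measurable_fun (fun z => W (k%:R / 2 ^+ n) z.2 ord0 i)).
  by move=> z; rewrite inE /I /grid /= => ->.
apply: measurable_funTS; apply: (@measurableT_comp _ _ _ _ _ _ (fun w => W (k%:R / 2 ^+ n) w ord0 i)).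
  by apply: measurable_position; rewrite divr_ge0// exprn_ge0.
exact: measurable_snd.
Qed.

(** Joint measurability in time and path, on which Tonelli's theorem rests: by continuity of paths
    the values at the dyadic times [grid n] converge, and these are measurable on each of countably
    many time slabs. *)
Lemma measurable_path_coord i : measurable_fun setT (path_coord i).
Proof.
apply: (@measurable_fun_cvg _ _ _ _ (fun n z => W (grid n z.1) z.2 ord0 i)) => //.
  by move=> n; exact: measurable_path_grid.
move=> z _; rewrite /path_coord.
have m0 : 0 <= Num.max 0 z.1 :> R by rewrite le_max lexx.
have cW : {within `[0, +oo[%classic, continuous (W ^~ z.2)} by exact: bm_cont hW _.
have /subspace_continuousP/(_ (Num.max 0 z.1)) := cW.
rewrite /= in_itv/= andbT => /(_ m0) cz.
have ci : {for (W (Num.max 0 z.1) z.2), continuous (fun y : pt => y ord0 i)} by exact: coord_continuous.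
have := cvg_comp _ _ cz ci => /cvgrPdist_le H; apply/cvgrPdist_le => e e0.
have := H e e0; rewrite near_withinE near_nbhs => /nbhs_ballP[r /= r0 rH].
have := @cvg_geometric R 1 2^-1; rewrite ger0_norm; last lra.
move=> /(_ _)/cvgrPdist_lt/(_ r r0) G; near=> n.
apply: (rH (grid n z.1)); last by rewrite /= in_itv/= grid_ge0.
have -> : ball (Num.max 0 z.1) r (grid n z.1) = (`|Num.max 0 z.1 - grid n z.1| < r) :> Prop by [].
apply: le_lt_trans (grid_close n z.1) _.
have : `|0 - geometric 1 2^-1 n| < r.
  near: n; apply: G; lra.
by rewrite /geometric/= mul1r sub0r normrN exprVn ger0_norm ?invr_ge0 ?exprn_ge0.
Unshelve. all: by end_near. Qed.

Definition inside k : set (measurableTypeR R * Omega) :=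
  [set z | forall i, path_coord i z <= 3 ^+ k].

Lemma measurable_inside k : measurable (inside k).
Proof.
have -> : inside k = \bigcap_(i in [set: 'I_d]) [set z | path_coord i z <= 3 ^+ k].
  by apply/seteqP; split => z h1 i; [move=> _; exact: h1|exact: (h1 i I)].
apply: fin_bigcap_measurable => // i _.
have -> : [set z | path_coord i z <= 3 ^+ k] = setT `&` path_coord i @^-1` `]-oo, 3 ^+ k]%classic.
  by rewrite setTI; apply/seteqP; split => z /=; rewrite in_itv.
exact: measurable_path_coord.
Qed.

Lemma insideP k s w : 0 <= s -> inside k (s, w) <-> cell k (W s w).
Proof.
move=> s0; have cW := bm_carpet hW w s0.
have E i : path_coord i (s, w) = W s w ord0 i by rewrite /path_coord /=; case: ltgtP s0 => // <-.
split => [H|[_ H]]; first by split => // i; rewrite -E; exact: H.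
by move=> i; rewrite E; exact: H.
Qed.

Definition occupation (J : set R) k (w : Omega) : \bar R :=
  (\int[lebesgue_measure]_s (\1_J s * \1_(inside k) (s, w))%:E)%E.

Definition occ_fun (J : set R) k (z : measurableTypeR R * Omega) : \bar R :=
  (\1_J z.1 * \1_(inside k) z)%:E.

Lemma measurable_occ_fun (J : set (measurableTypeR R)) k : measurable J ->
  measurable_fun setT (occ_fun J k).
Proof.
move=> mJ; apply/measurable_EFinP; apply: measurable_funM.
  apply: (@measurableT_comp _ _ _ _ _ _ (\1_J : measurableTypeR R -> R)).
    exact: measurable_indic.
  exact: measurable_fst.
by apply: measurable_indic; exact: measurable_inside.
Qed.

Lemma occ_fun_ge0 (J : set R) k z : (0 <= occ_fun J k z)%E.
Proof. by rewrite lee_fin mulr_ge0. Qed.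

Lemma measurable_occupation (J : set (measurableTypeR R)) k : measurable J ->
  measurable_fun setT (occupation J k).
Proof.
move=> mJ.
exact: (@measurable_fun_fubini_tonelli_G _ _ _ _ R lebesgue_measure _ (measurable_occ_fun k mJ) (@occ_fun_ge0 J k)).
Qed.

Lemma integral_occupation (x : pt) (J : set (measurableTypeR R)) k : measurable J ->
  (forall s, J s -> 0 <= s) ->
  (\int[P x]_w occupation J k w =
   \int[lebesgue_measure]_(s in J) P x (W s @^-1` cell k))%E.
Proof.
move=> mJ J0.
have := @fubini_tonelli _ _ _ _ R lebesgue_measure (P x) _ (measurable_occ_fun k mJ) (@occ_fun_ge0 J k).
rewrite /occupation /occ_fun /= => <-.
rewrite [RHS]integral_mkcond; apply: eq_integral => s _; rewrite /patch /occ_fun /=.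
case: ifPn => [/set_mem Js|sJ]; last first.
  rewrite indicE (negbTE sJ); apply: integral0_eq => w _; by rewrite mul0r.
have E : W s @^-1` cell k = [set w | inside k (s, w)].
  by apply/seteqP; split => w /insideP; apply; exact: J0.
have mE : measurable [set w | inside k (s, w)].
  have -> : [set w | inside k (s, w)] = xsection (inside k) s.
    by apply/seteqP; split => w; rewrite /xsection/= inE.
  by apply: measurable_xsection; exact: measurable_inside.
rewrite E -[X in P x X]setIT -integral_indic//.
apply: eq_integral => w _; rewrite indicE mem_set// mul1r; congr (_%:E).
Qed.

End occupation.

(** An arbitrary nonnegative [f] is dominated by the measurable function equal to [K] on [Z] and to
    +oo off it. Meant for the integrand of the Markov property. *)
Lemma integral_le_almost_surely {R : realType} {dT : measure_display} {T : measurableType dT}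
    (mu : probability T R) (Z : set T) (f : T -> \bar R) (K : R) :
  measurable Z -> mu Z = 1%E -> 0 <= K -> (forall w, (0 <= f w)%E) ->
  (forall w, Z w -> (f w <= K%:E)%E) -> (\int[mu]_w f w <= K%:E)%E.
Proof.
move=> mZ Z1 K0 f0 fK; have mZC := measurableC mZ.
pose g w : \bar R := if w \in Z then K%:E else +oo%E.
have g0 w : (0 <= g w)%E by rewrite /g; case: ifP.
have gZ : {in Z, g =1 cst K%:E} by move=> w; rewrite /g => ->.
have gC : {in ~` Z, g =1 cst +oo%E}.
  by move=> w; rewrite in_setC /g => /negbTE ->.
have -> : K%:E = (\int[mu]_w g w)%E.
  rewrite -(setvU Z) ge0_integral_setU//=; last first.
  - by apply/disj_setPS; rewrite setICl.
  - apply/measurable_funU => //; split.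
      by apply: (eq_measurable_fun (cst +oo%E)) => // w wZ; rewrite gC.
    by apply: (eq_measurable_fun (cst K%:E)) => // w wZ; rewrite gZ.
  have -> : (\int[mu]_(x in Z) g x = K%:E)%E.
    rewrite (eq_integral (cst K%:E) _ gZ); transitivity (K%:E * mu Z)%E.
      exact: integral_cst.
    by rewrite Z1 mule1.
  have -> : (\int[mu]_(x in ~` Z) g x = 0)%E; last by rewrite add0e.
  rewrite (eq_integral (cst +oo%E) _ gC); transitivity (+oo * mu (~` Z))%E.
    exact: integral_cst.
  by rewrite probability_setC// Z1 subee// mule0.
apply: le_integral_ge0 => // w _; rewrite f0 /= /g.
by case: ifPn => [/set_mem/fK//|_]; rewrite leey.
Qed.

(** * Upper bounds for the kernel *)

Section kernel_bounds.
Context {R : realType} {d : nat}.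
Local Notation pt := 'rV[R]_d.
Local Notation lam := (@leb R d).
Local Notation N := (@children R d).
Hypothesis d_gt1 : (1 < d)%N.
Let d_gt0 : (0 < d)%N. Proof. exact: ltnW. Qed.
Context (h : R -> pt -> pt -> R).

Section transition_probabilities.
Context {dO : measure_display} {Omega : measurableType dO}.
Context (P : pt -> probability Omega R) (W : R -> Omega -> pt).
Hypothesis hW : reflecting_BM h P W.

Lemma start_measurable (x : pt) : measurable (W 0 @^-1` [set x]).
Proof.
rewrite -[X in measurable X]setCK; apply: measurableC; rewrite preimage_setC.
apply: (bm_meas hW) => //; rewrite openC; apply: accessible_closed_set1.
exact/hausdorff_accessible/norm_hausdorff.
Qed.

(** The Markov property at time 0: the path starts almost surely at [x], so the inner integral is
    almost surely the one bounded by [K]. *)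
Lemma prob_le (x : pt) t (B : set pt) (K : R) : carpet x -> 0 < t -> <<s open >> B -> 0 <= K ->
  (\int[lam]_(y in @carpet R d `&` B) (h t x y)%:E <= K%:E)%E ->
  (P x (W t @^-1` B) <= K%:E)%E.
Proof.
move=> cx t0 oB K0 hK.
have T0 : natural_filtration W 0 [set: Omega].
  by rewrite -(setD0 setT); apply: sigma_algebraCD; exact: sigma_algebra0.
have := bm_markov hW cx (lexx 0) t0 T0 oB; rewrite setTI add0r => ->.
have hk := bm_hk hW.
apply: (integral_le_almost_surely (start_measurable x) (bm_start hW cx) K0).
  move=> w; apply: integral_ge0 => y [cy _]; rewrite lee_fin (hk_ge0 hk)//.
  exact: (bm_carpet hW).
by move=> w /= ->.
Qed.

End transition_probabilities.

Section heat_kernel_bound.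
Context (dw : R).
Hypothesis dw2 : 2 < dw.

(** The set is bounded by [r + r ^+ 2 / t], so [sup] is a true supremum: for [z > 1] the subtracted
    term is dropped, and for [z <= 1] the difference is a nonnegative quadratic form. *)
Lemma Phi_ge (r t s : R) : 0 <= r -> 0 < t -> 0 < s -> r / s - t / Psi dw s <= Phi dw r t.
Proof.
move=> r0 t0 s0; apply: ub_le_sup; last by exists s.
exists (r + r ^+ 2 / t) => _ [z /= z0 <-].
have rt : 0 <= r ^+ 2 / t by rewrite divr_ge0 ?sqr_ge0// ltW.
rewrite /Psi; case: ifPn => [z1|]; last first.
  rewrite -ltNge => z1; have zd : 0 < z `^ dw by rewrite powR_gt0.
  have : r / z <= r by rewrite ler_pdivrMr// ler_peMr// ltW.
  have : 0 <= t / z `^ dw by rewrite divr_ge0// ltW.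
  lra.
have : r / z - t / z ^+ 2 <= r ^+ 2 / t; last by lra.
rewrite -subr_ge0.
have -> : r ^+ 2 / t - (r / z - t / z ^+ 2) = (r ^+ 2 * z ^+ 2 - r * t * z + t ^+ 2) / (t * z ^+ 2).
  by field; rewrite !gt_eqF.
rewrite divr_ge0 ?mulr_ge0 ?sqr_ge0 ?(ltW t0)//; nra.
Qed.

Variables (c1 c2 : R).
Hypotheses (c10 : 0 < c1) (c20 : 0 < c2).
Hypothesis hU : forall t x y, 0 < t -> carpet x -> carpet y -> h t x y <= hk_bound dw c1 c2 t x y.

Lemma dX_ge0 (x y : pt) : carpet x -> carpet y -> 0 <= dX x y.
Proof.
by move=> cx cy; apply: le_trans (coord_le_dX d_gt1 (Ordinal d_gt0) cx cy).
Qed.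

Lemma vol_ge0 (x : pt) r : 0 <= vol x r.
Proof. by rewrite fine_ge0. Qed.

(** Any single [s] in the supremum defining [Phi] bounds the kernel. It is taken to be [1 + t] when
    no decay in space is wanted, 1 for times in a fixed interval, and [3 ^+ k.+1] for times of order
    [th ^+ k]. *)
Lemma kernel_le (t s v D : R) (x y : pt) : 0 < t -> carpet x -> carpet y -> 0 < s -> 0 < v ->
  v <= vol x (Psi_inv dw (c1 * t)) -> D <= dX x y ->
  h t x y <= v^-1 * expR (t / Psi dw s - c2 * D / s).
Proof.
move=> t0 cx cy s0 v0 vv DD; apply: le_trans (hU t0 cx cy) _.
rewrite /hk_bound; apply: ler_pM; rewrite ?invr_ge0 ?vol_ge0 ?expR_ge0//.
  by rewrite lef_pV2 ?posrE//; exact: lt_le_trans vv.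
rewrite ler_expR lerNl opprB.
have cd0 : 0 <= c2 * dX x y by rewrite mulr_ge0 ?dX_ge0// ltW.
apply: le_trans (Phi_ge cd0 t0 s0); rewrite lerD2r ler_pdivrMr// divfK ?gt_eqF//.
by rewrite ler_pM2l.
Qed.

Let th : R := 3 `^ dw.

Lemma Psi_inv_exp (m : nat) (t : R) : 1 < c1 * t -> th ^+ m <= t ->
  c1 `^ dw^-1 * 3 ^+ m <= Psi_inv dw (c1 * t).
Proof.
move=> t1 tm; rewrite /Psi_inv ifF; last by apply/negbTE; rewrite -ltNge.
have dw0 : 0 < dw by apply: lt_trans dw2.
have -> : 3 ^+ m = (th ^+ m) `^ dw^-1 :> R.
  by rewrite /th -powR_exp3 -powRrM mulfV ?gt_eqF// powRr1// exprn_ge0.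
rewrite -powRM ?exprn_ge0 ?powR_ge0// ?(ltW c10)//.
apply: ge0_ler_powR; rewrite ?nnegrE ?invr_ge0 ?(ltW dw0)//.
- by rewrite mulr_ge0 ?(ltW c10)// exprn_ge0// powR_ge0.
- lra.
- by rewrite ler_pM2l.
Qed.

Lemma Psi_inv_ge (del t : R) : 0 < del -> del <= t ->
  Num.min 1 (Num.sqrt (c1 * del)) <= Psi_inv dw (c1 * t).
Proof.
move=> d0 dt; rewrite /Psi_inv; case: ifPn => [_|].
  by rewrite ge_min; apply/orP; right; apply: ler_wsqrtr; rewrite ler_pM2l.
rewrite -ltNge => t1; rewrite ge_min; apply/orP; left.
rewrite -(powRr0 (c1 * t)); apply: ler_powR; first exact: ltW.
by rewrite invr_ge0; have := dw2; lra.
Qed.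

End heat_kernel_bound.
End kernel_bounds.

(** * Time spent in a cell *)

Section time_integrals.
Context {R : realType}.
Variables (th N : R).
Hypotheses (th2 : 2 <= th) (thN : th < N).

Lemma exp_unbounded (a : R) : exists n, a < th ^+ n.
Proof.
exists (Num.truncn `|a|).+1; apply: le_lt_trans (ler_norm a) _.
apply: lt_le_trans (_ : (Num.truncn `|a|).+1%:R <= _).
  by have /andP[] := truncn_itv (normr_ge0 a).
elim: (Num.truncn `|a|).+1 => [|n IH]; first by rewrite expr0.
have := th2; have t1 : 1 <= th ^+ n by apply: exprn_ege1; have := th2; lra.
rewrite -natr1 exprS; nra.
Qed.

Lemma exp_bracket (M : nat) (s : R) : th ^+ M <= s -> exists j, th ^+ (M + j) <= s <= th ^+ (M + j).+1.
Proof.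
move=> Ms; have [n sn] := exp_unbounded s.
have ex : exists n, s < th ^+ n by exists n.
case: (ex_minnP ex) => -[|m] sm mmin.
  have : th ^+ 0 <= th ^+ M by rewrite expr0; apply: exprn_ege1; have := th2; lra.
  by move: sm Ms; lra.
have ms : th ^+ m <= s.
  by rewrite leNgt; apply/negP => /mmin; rewrite ltnn.
have Mm : (M <= m)%N.
  rewrite -ltnS ltnNge; apply/negP => mM.
  have : th ^+ m.+1 <= th ^+ M by apply: ler_weXn2l => //; have := th2; lra.
  by move: sm Ms; lra.
by exists (m - M)%N; rewrite subnKC// ms ltW.
Qed.

Lemma integral_0_itv_indic (c b : R) : 0 <= c -> 0 <= b ->
  (\int[lebesgue_measure]_s (c * \1_(`[0%R, b]%classic : set (measurableTypeR R)) s)%:E = (c * b)%:E)%E.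
Proof.
move=> c0 b0; transitivity (c%:E * @lebesgue_measure R `[0%R, b]%classic)%E.
  by apply: integral_scaled_indic => //; exact: measurable_itv.
rewrite lebesgue_measure_itv/= lte_fin.
by case: ltgtP b0 => //= [b0|<-] _; rewrite ?mulr0 ?mule0// oppr0 adde0 -EFinM.
Qed.

(** Times are cut at [del], at [th ^+ M] and at all later powers of [th]. Each piece is enlarged
    down to 0, hence costs its right end point, and the tail is geometric of ratio [th / N]. *)
Lemma time_integral_le (f : R -> \bar R) (M : nat) (del B A : R) : 0 <= del -> 0 <= B -> 0 <= A ->
  (forall s, 0 <= s -> (0 <= f s <= 1)%E) ->
  (forall s, del <= s <= th ^+ M -> (f s <= B%:E)%E) ->
  (forall m s, (M <= m)%N -> th ^+ m <= s -> (f s <= (A * N ^- m)%:E)%E) ->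
  (\int[lebesgue_measure]_(s in `[0%R, +oo[) f s <=
    (del + B * th ^+ M + A * th * (th / N) ^+ M / (1 - th / N))%:E)%E.
Proof.
move=> del0 B0 A0 f01 fB fA.
have t0 : 0 < th by have := th2; lra.
have N0 : 0 < N by have := thN; lra.
have q1 : 0 <= th / N < 1 by rewrite divr_ge0 ?(ltW t0) ?(ltW N0)//= ltr_pdivrMr// mul1r.
pose J b : set (measurableTypeR R) := `[0%R, b]%classic.
pose u1 s : \bar R := (1 * \1_(J del) s)%:E.
pose u2 s : \bar R := (B * \1_(J (th ^+ M)) s)%:E.
pose c j := A * N ^- (M + j).
have c0 j : 0 <= c j by rewrite mulr_ge0// invr_ge0 exprn_ge0// ltW.
pose v j s : \bar R := (c j * \1_(J (th ^+ (M + j).+1)) s)%:E.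
have Jin b s : 0 <= s -> s <= b -> \1_(J b) s = 1 :> R.
  by move=> s0 sb; rewrite indicE mem_set// /J /= in_itv/= s0.
have mJ b : measurable (J b) by exact: measurable_itv.
have mi (e b : R) : measurable_fun setT (fun s : measurableTypeR R => (e * \1_(J b) s)%:E).
  by apply/measurable_EFinP; apply: measurable_funM => //; exact: measurable_indic.
have v0 j s : (0 <= v j s)%E by rewrite lee_fin mulr_ge0.
have u10 s : (0 <= u1 s)%E by rewrite lee_fin mulr_ge0.
have u20 s : (0 <= u2 s)%E by rewrite lee_fin mulr_ge0.
have V0 s : (0 <= \sum_(j <oo) v j s)%E by apply: nneseries_ge0 => j _ _; exact: v0.
have mV : measurable_fun setT (fun s => \sum_(j <oo) v j s)%E.
  by apply: ge0_emeasurable_sum => // j _; exact: mi.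
apply: (@le_trans _ _ (\int[lebesgue_measure]_s (u1 s + (u2 s + \sum_(j <oo) v j s)))%E).
  apply: le_integral_ge0 => // s; last by rewrite !adde_ge0.
  rewrite /= in_itv/= andbT => s0; have /andP[fs0 fs1] := f01 s s0; rewrite fs0 /=.
  have [sd|sd] := leP s del.
    apply: le_trans fs1 _; rewrite -[leLHS]adde0; apply: leeD; last by rewrite adde_ge0.
    by rewrite /u1 Jin// mulr1.
  have [sM|sM] := leP s (th ^+ M).
    rewrite -[leLHS]add0e; apply: leeD => //; rewrite -[leLHS]adde0; apply: leeD => //.
    by rewrite /u2 Jin// mulr1; apply: fB; rewrite (ltW sd).
  have [j /andP[j1 j2]] := exp_bracket (ltW sM).
  rewrite -[leLHS]add0e; apply: leeD => //; rewrite -[leLHS]add0e; apply: leeD => //.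
  apply: (@le_trans _ _ (v j s)).
    by rewrite /v Jin// mulr1; apply: fA => //; exact: leq_addr.
  apply: (@nneseries_term _ (fun j => c j * \1_(J (th ^+ (M + j).+1)) s) j) => i.
  by rewrite mulr_ge0.
have mu1 : measurable_fun setT u1 by exact: mi.
have mu2 : measurable_fun setT u2 by exact: mi.
have muV : measurable_fun setT (fun s => u2 s + \sum_(j <oo) v j s)%E by exact: emeasurable_funD.
have uV0 s : (0 <= u2 s + \sum_(j <oo) v j s)%E by rewrite adde_ge0.
rewrite ge0_integralD// ge0_integralD//.
rewrite !integral_0_itv_indic ?exprn_ge0 ?(ltW t0)// integral_nneseries//; last by move=> j; exact: mi.
rewrite mul1r -addrA !EFinD leeD2l// leeD2l//.
apply: (@le_trans _ _ (\sum_(j <oo) (A * th * (th / N) ^+ (M + j))%:E)%E).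
  apply: lee_nneseries => [j _|j _].
    by move=> _; apply: integral_ge0 => s _; exact: v0.
  rewrite integral_0_itv_indic ?exprn_ge0 ?(ltW t0)// lee_fin /c exprS expr_div_n.
  by rewrite le_eqVlt; apply/orP; left; apply/eqP; ring.
by apply: tail_nneseries => //; rewrite mulr_ge0// ltW.
Qed.

End time_integrals.

Section cell_probabilities.
Context {R : realType} {d : nat}.
Local Notation pt := 'rV[R]_d.
Local Notation lam := (@leb R d).
Local Notation N := (@children R d).
Hypothesis d_gt1 : (1 < d)%N.
Let d_gt0 : (0 < d)%N. Proof. exact: ltnW. Qed.
Context (h : R -> pt -> pt -> R).
Context {dO : measure_display} {Omega : measurableType dO}.
Context (P : pt -> probability Omega R) (W : R -> Omega -> pt).
Hypothesis hW : reflecting_BM h P W.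
Context (dw : R).
Hypothesis dw2 : 2 < dw.
Hypothesis dwf : dw < dim_f R d.
Variables (c1 c2 : R).
Hypotheses (c10 : 0 < c1) (c20 : 0 < c2).
Hypothesis hU : forall t x y, 0 < t -> carpet x -> carpet y -> h t x y <= hk_bound dw c1 c2 t x y.

Let th : R := 3 `^ dw.

Lemma powR3_walk_gt9 : 9 < 3 `^ dw.
Proof.
apply: le_lt_trans (powR3_lt dw2); rewrite (@powR_mulrn R 3 2)//; lra.
Qed.

Lemma powR3_walk_lt : 3 `^ dw < N.
Proof. by rewrite -(powR3_dim d_gt1); exact: powR3_lt. Qed.

Let th9 : 9 < th. Proof. exact: powR3_walk_gt9. Qed.
Let thN : th < N. Proof. exact: powR3_walk_lt. Qed.
Let N0 : 0 < N. Proof. exact: children_gt0. Qed.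

(** The Borel set that replaces a cell in the Markov property: paths stay in the carpet, so both
    have the same preimage, and the complement of [coord_ub] is visibly open. *)
Definition coord_ub k : set pt := [set y | forall i, y ord0 i <= 3 ^+ k].

Lemma open_coord_ubC k : open (~` coord_ub k).
Proof.
have -> : ~` coord_ub k = \bigcup_i [set y : pt | 3 ^+ k < y ord0 i].
  apply/seteqP; split => [y /existsNP[i /negP]|y [i _ /= yi] /(_ i)].
    by rewrite -ltNge => yi; exists i.
  by rewrite leNgt yi.
apply: bigcup_open => i _.
have -> : [set y : pt | 3 ^+ k < y ord0 i] = (fun y : pt => y ord0 i) @^-1` [set z | 3 ^+ k < z] by [].
by apply: open_comp => [y _|]; [exact: coord_continuous|exact: open_gt].
Qed.

Lemma cell_preimage t k : 0 <= t -> W t @^-1` cell k = W t @^-1` coord_ub k.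
Proof.
move=> t0; apply/seteqP; split => [w [_ H]//|w H]; split => //.
exact: (bm_carpet hW).
Qed.

Lemma borel_coord_ub k : <<s open >> (coord_ub k).
Proof.
rewrite -(setCK (coord_ub k)) -setTD; apply: sigma_algebraCD.
by apply: sub_sigma_algebra; exact: open_coord_ubC.
Qed.

Lemma measurable_cell_preimage t k : 0 <= t -> measurable (W t @^-1` cell k).
Proof.
move=> t0; rewrite cell_preimage// -[X in measurable X]setCK preimage_setC.
by apply: measurableC; apply: (bm_meas hW) => //; exact: open_coord_ubC.
Qed.

Lemma prob_cell_le (x : pt) t k (C : R) : carpet x -> 0 < t -> 0 <= C ->
  (forall y, cell k y -> h t x y <= C) -> (P x (W t @^-1` cell k) <= (C * N ^+ k)%:E)%E.
Proof.
move=> cx t0 C0 hC; rewrite cell_preimage ?(ltW t0)//.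
apply: (prob_le hW) => //.
- exact: borel_coord_ub.
- by rewrite mulr_ge0// exprn_ge0// ltW.
apply: (@le_trans _ _ (\int[lam]_(y in @cell R d k) C%:E)%E).
  apply: le_integral_ge0 => // y yk.
  by rewrite !lee_fin (hk_ge0 (bm_hk hW))//=; [exact: hC|have [] := yk].
have mk : measurable (@cell R d k : set (leb_space R d)) by exact: measurable_cell.
apply: (@le_trans _ _ (C%:E * lam (cell k))%E).
  by rewrite le_eqVlt; apply/orP; left; apply/eqP; exact: integral_cst.
by rewrite EFinM; apply: lee_wpmul2l; [rewrite lee_fin|exact: leb_cell_le].
Qed.

(** When [th ^+ m <= t] the volume in the kernel bound has radius at least a constant times
    [3 ^+ m], hence is at least a multiple of [N ^+ m]. From [m0] on, [1 < c1 * t] and [Psi_inv] is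
    a power. *)
Lemma on_diagonal : exists m0 : nat, exists2 C : R, 0 <= C &
  forall m k t (x : pt), (m0 <= m)%N -> th ^+ m <= t -> carpet x ->
    (P x (W t @^-1` cell k) <= (C * N ^+ k * N ^- m)%:E)%E.
Proof.
have th2 : 2 <= th by move: th9; lra.
have [m0 hm0] := exp_unbounded th2 c1^-1.
have cc0 : 0 < c1 `^ dw^-1 by rewrite powR_gt0.
have [v v0 hv] := vol_ge d_gt1 cc0.
exists m0; exists (v^-1 * expR 1); first by rewrite mulr_ge0 ?expR_ge0// invr_ge0 ltW.
move=> m k t x m0m mt cx.
have tm0 : th ^+ m0 <= t by apply: le_trans mt; apply: ler_weXn2l => //; lra.
have t1 : 1 < c1 * t.
  by rewrite -(mulfV (lt0r_neq0 c10)) ltr_pM2l//; exact: lt_le_trans tm0.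
have t0 : 0 < t by apply: lt_le_trans tm0; rewrite exprn_gt0//; lra.
have vN : 0 < v * N ^+ m by rewrite mulr_gt0// exprn_gt0.
have -> : v^-1 * expR 1 * N ^+ k / N ^+ m = ((v * N ^+ m)^-1 * expR 1) * N ^+ k.
  by field; rewrite expf_neq0 ?gt_eqF.
apply: prob_cell_le => //; first by rewrite mulr_ge0 ?expR_ge0// invr_ge0 ltW.
move=> y [cy _].
(* With [s = 1 + t] one has [Psi s >= t], so the exponent is at most 1. *)
have s0 : 0 < 1 + t by rewrite addr_gt0.
apply: le_trans (kernel_le d_gt1 c20 hU (s := 1 + t) (v := v * N ^+ m) (D := 0) t0 cx cy s0 vN _ _) _.
- by apply: hv => //; exact: Psi_inv_exp.
- exact: dX_ge0.
rewrite ler_wpM2l ?invr_ge0 ?(ltW vN)// ler_expR mulr0 mul0r subr0.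
rewrite /Psi ifF; last by apply/negbTE; rewrite -ltNge ltrDl.
rewrite ler_pdivrMr ?powR_gt0// mul1r.
apply: (@le_trans _ _ ((1 + t) `^ 1)); first by rewrite powRr1 ?(ltW s0)// lerDr.
by apply: ler_powR; rewrite ?lerDl ?(ltW t0)//; move: dw2; lra.
Qed.

(** For times in a bounded interval away from 0 the volume is bounded below, and [s = 1] makes the
    kernel exponentially small in the gap between [x] and the cell in coordinate [i]. *)
Lemma off_diagonal (del T eta : R) k : 0 < del -> 0 < eta ->
  exists rho, forall t (x : pt) i, del <= t <= T -> carpet x -> rho <= x ord0 i ->
    (P x (W t @^-1` cell k) <= eta%:E)%E.
Proof.
move=> d0 e0; pose c := Num.min 1 (Num.sqrt (c1 * del)).
have c0 : 0 < c by rewrite lt_min ltr01 sqrtr_gt0 mulr_gt0.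
have [v v0 hv] := vol_ge d_gt1 c0.
have Nk : 0 < N ^+ k by rewrite exprn_gt0.
pose eta' := eta * v / N ^+ k; have e0' : 0 < eta' by rewrite divr_gt0// mulr_gt0.
(* The solution [rho] of [T - c2 * (rho - 3 ^+ k) = ln eta']. *)
exists (3 ^+ k + (T - ln eta') / c2) => t x i /andP[dt tT] cx xi.
have t0 : 0 < t by exact: lt_le_trans dt.
have -> : eta = (v^-1 * eta') * N ^+ k by rewrite /eta'; field; rewrite !gt_eqF.
apply: prob_cell_le => //; first by rewrite mulr_ge0 ?(ltW e0')// invr_ge0 ltW.
move=> y [cy yk].
apply: le_trans (kernel_le d_gt1 c20 hU (s := 1) (v := v) (D := x ord0 i - 3 ^+ k) t0 cx cy ltr01 v0 _ _) _.
- rewrite -[v]mulr1 -(expr0 N); apply: hv => //; rewrite expr0 mulr1.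
  exact: Psi_inv_ge.
- apply: le_trans (coord_le_dX d_gt1 i cx cy); apply: le_trans (ler_norm _).
  by rewrite lerD2l lerN2.
rewrite ler_wpM2l ?invr_ge0 ?(ltW v0)// -[leRHS]lnK ?posrE// ler_expR.
rewrite /Psi lexx expr1n !divr1.
have : T - ln eta' <= c2 * (x ord0 i - 3 ^+ k).
  by rewrite mulrC -ler_pdivrMr//; lra.
lra.
Qed.

Definition occupation_time k (x : pt) : \bar R :=
  (\int[lebesgue_measure]_(s in `[0%R, +oo[) P x (W s @^-1` cell k))%E.

(** Times up to [th ^+ (m0 + k)] count in full. Later ones give [N ^+ k] times a geometric tail, of
    order [N ^+ k * (th / N) ^+ k = th ^+ k]. *)
Lemma occupation_time_le : exists2 C : R, 0 <= C & forall k (x : pt), carpet x ->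
  (occupation_time k x <= (C * th ^+ k)%:E)%E.
Proof.
have th2 : 2 <= th by move: th9; lra.
have [m0 [C C0 hC]] := on_diagonal.
have q1 : 0 < 1 - th / N by rewrite subr_gt0 ltr_pdivrMr// mul1r.
exists (th ^+ m0 + C * th * (th / N) ^+ m0 / (1 - th / N)).
  rewrite addr_ge0 ?exprn_ge0 ?divr_ge0 ?mulr_ge0 ?exprn_ge0 ?divr_ge0 ?(ltW q1) ?(ltW N0)//; lra.
move=> k x cx.
have A0 : 0 <= C * N ^+ k by rewrite mulr_ge0// exprn_ge0// ltW.
apply: le_trans (time_integral_le th2 thN (M := m0 + k) (lexx 0) ler01 A0 _ _ _) _.
- by move=> s s0; rewrite measure_ge0 probability_le1//; exact: measurable_cell_preimage.
- by move=> s /andP[s0 _]; rewrite probability_le1//; exact: measurable_cell_preimage.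
- by move=> m s mk ms; apply: hC => //; apply: leq_trans mk; exact: leq_addr.
rewrite lee_fin add0r mul1r mulrDl -exprD lerD2l !exprD.
rewrite le_eqVlt; apply/orP; left; apply/eqP; rewrite !expr_div_n; field.
by rewrite !expf_neq0 ?gt_eqF// subr_gt0.
Qed.

Lemma geometric_small (a q e : R) : 0 <= q < 1 -> 0 < e -> exists n0, forall n, (n0 <= n)%N -> a * q ^+ n <= e.
Proof.
move=> /andP[q0 q1] e0; have := @cvg_geometric R a q; rewrite ger0_norm// => /(_ q1).
move=> /cvgrPdist_le/(_ e e0)[n0 _ H]; exists n0 => n n0n.
have := H n n0n; rewrite /geometric/= sub0r normrN; apply: le_trans; exact: ler_norm.
Qed.

(** [M] is fixed before [rho]: the part after [th ^+ M] is small uniformly in [x], the part between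
    [eps / 3] and [th ^+ M] is small for far [x] by [off_diagonal], and the initial part is at most
    its length. *)
Lemma occupation_time_small (eps : R) k : 0 < eps -> exists rho, forall (x : pt) i,
  carpet x -> rho <= x ord0 i -> (occupation_time k x <= eps%:E)%E.
Proof.
move=> e0; have th2 : 2 <= th by move: th9; lra.
have th0 : 0 < th by move: th9; lra.
have [m0 [C C0 hC]] := on_diagonal.
have q1 : 0 <= th / N < 1 by rewrite divr_ge0 ?(ltW th0) ?(ltW N0)//= ltr_pdivrMr// mul1r.
have A0 : 0 <= C * N ^+ k by rewrite mulr_ge0// exprn_ge0// ltW.
have e3 : 0 < eps / 3 by rewrite divr_gt0.
have [n0 hn0] := geometric_small (C * N ^+ k * th / (1 - th / N)) q1 e3.
pose M := (m0 + n0)%N; have thM : 0 < th ^+ M by rewrite exprn_gt0.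
have B0 : 0 < eps / 3 / th ^+ M by rewrite divr_gt0.
have [rho hrho] := off_diagonal (th ^+ M) k e3 B0.
exists rho => x i cx xi.
apply: le_trans (time_integral_le th2 thN (M := M) (ltW e3) (ltW B0) A0 _ _ _) _.
- by move=> s s0; rewrite measure_ge0 probability_le1//; exact: measurable_cell_preimage.
- by move=> s sM; apply: hrho cx xi.
- by move=> m s mk ms; apply: hC => //; apply: leq_trans mk; exact: leq_addr.
rewrite lee_fin divfK ?gt_eqF//.
have := hn0 M (leq_addl _ _).
rewrite (_ : _ * (th / N) ^+ M = C * N ^+ k * th * (th / N) ^+ M / (1 - th / N)); last by rewrite mulrAC.
lra.
Qed.

End cell_probabilities.

(** * Stochastic completeness *)

Section incompleteness.
Context {R : realType} {d : nat}.
Local Notation pt := 'rV[R]_d.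
Local Notation lam := (@leb R d).
Local Notation N := (@children R d).
Hypothesis d_gt1 : (1 < d)%N.
Let d_gt0 : (0 < d)%N. Proof. exact: ltnW. Qed.
Context (h : R -> pt -> pt -> R).
Context {dO : measure_display} {Omega : measurableType dO}.
Context (P : pt -> probability Omega R) (W : R -> Omega -> pt).
Hypothesis hW : reflecting_BM h P W.
Context (dw : R).
Hypothesis dw2 : 2 < dw.
Hypothesis dwf : dw < dim_f R d.
Variables (c1 c2 : R).
Hypotheses (c10 : 0 < c1) (c20 : 0 < c2).
Hypothesis hU : forall t x y, 0 < t -> carpet x -> carpet y -> h t x y <= hk_bound dw c1 c2 t x y.

Let half_line : set (measurableTypeR R) := `[0%R, +oo[%classic.

Let mhalf : measurable half_line. Proof. exact: measurable_itv. Qed.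

Let half_ge0 s : half_line s -> 0 <= s.
Proof. by rewrite /half_line /= in_itv/= andbT. Qed.

Lemma le_occupation_time j k (x : pt) : (j <= k)%N ->
  (occupation_time P W j x <= occupation_time P W k x)%E.
Proof.
move=> jk; apply: le_integral_ge0 => // s; rewrite /= in_itv/= andbT => s0.
rewrite measure_ge0/= le_measure ?inE//; try exact: (measurable_cell_preimage hW).
by move=> w; exact: le_cell.
Qed.

Section clock_bound.
Variable p : R.
Hypothesis dwp : dw < p.

Let p0 : 0 < p. Proof. by move: dw2 dwp; lra. Qed.

(** Bounds the clock at all times at once, since the inverse weight at a point is at most the term
    of the least cell containing it. *)
Definition clock_majorant (w : Omega) : \bar R :=
  (\sum_(k <oo) (3 `^ p * (3 `^ p) ^- k)%:E * occupation W half_line k w)%E.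

Let occ_ge0 k w : (0 <= occupation W half_line k w)%E.
Proof. by apply: integral_ge0 => s _; rewrite lee_fin mulr_ge0. Qed.

Lemma clock_majorant_ge0 w : (0 <= clock_majorant w)%E.
Proof. by apply: nneseries_ge0 => k _ _; rewrite mule_ge0// lee_fin. Qed.

Lemma additive_functional_le s w :
  (additive_functional W (weight p) s w <= clock_majorant w)%E.
Proof.
pose f k (u : measurableTypeR R) : \bar R :=
  ((3 `^ p * (3 `^ p) ^- k)%:E * occ_fun W half_line k (u, w))%E.
have mf k : measurable_fun setT (f k).
  apply: measurable_funeM.
  exact: (measurableT_comp (measurable_occ_fun hW k mhalf) (pair2_measurable w)).
have f0 k u : (0 <= f k u)%E by rewrite mule_ge0 ?lee_fin// occ_fun_ge0.
apply: (@le_trans _ _ (\int[lebesgue_measure]_u (\sum_(k <oo) f k u))%E).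
  apply: le_integral_ge0 => // [u|u _]; last by apply: nneseries_ge0.
  rewrite /= in_itv/= => /andP[u0 us].
  rewrite lee_fin weight_inv_ge0/=.
  have [k xk wk] := weight_inv_cell d_gt1 p0 (bm_carpet hW w u0).
  apply: (@le_trans _ _ (f k u)).
    rewrite /f /occ_fun /= -EFinM lee_fin !indicE !mem_set ?mulr1//.
      exact/(insideP hW _ _ u0).
    by rewrite /half_line /= in_itv/= andbT.
  have := @nneseries_term R (fun k => 3 `^ p * (3 `^ p) ^- k * (\1_half_line u * \1_(inside W k) (u, w))) k.
  by apply=> j; rewrite !mulr_ge0.
rewrite integral_nneseries//; apply: lee_nneseries => [k _|k _].
  by move=> _; apply: integral_ge0.
rewrite /f ge0_integralZl_EFin//; last 2 first.
- by move=> u _; exact: occ_fun_ge0.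
- exact: (measurableT_comp (measurable_occ_fun hW k mhalf) (pair2_measurable w)).
Qed.

Lemma expected_clock (x : pt) : (\int[P x]_w clock_majorant w =
  \sum_(k <oo) (3 `^ p * (3 `^ p) ^- k)%:E * occupation_time P W k x)%E.
Proof.
rewrite integral_nneseries//; last 2 first.
- by move=> k; apply: measurable_funeM; exact: (measurable_occupation hW _ mhalf).
- by move=> k w _; rewrite mule_ge0// lee_fin.
apply: eq_eseriesr => k _; rewrite ge0_integralZl_EFin//; last exact: (measurable_occupation hW _ mhalf).
by rewrite (integral_occupation hW x k mhalf half_ge0).
Qed.

Lemma expected_clock_small (eps : R) : 0 < eps -> exists rho, forall (x : pt) i,
  carpet x -> rho <= x ord0 i -> (\int[P x]_w clock_majorant w <= eps%:E)%E.
Proof.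
move=> e0; pose th : R := 3 `^ dw; pose q : R := (3 `^ p)^-1.
have th0 : 0 < th by exact: powR3_gt0.
have tp : th < 3 `^ p by exact: powR3_lt.
have pp0 : 0 < 3 `^ p :> R by exact: powR3_gt0.
have q0 : 0 < q by rewrite invr_gt0.
have tq : 0 <= th * q < 1 by rewrite mulr_ge0 ?(ltW th0) ?(ltW q0)//= ltr_pdivrMr// mul1r.
(* The terms decay like [(th * q) ^+ k = r ^+ k * r ^+ k]: one factor sums the series, the other
   makes the cells beyond [K] contribute little. The cells up to [K] are handled through the
   occupation time of cell [K]. *)
pose r := Num.sqrt (th * q).
have r0 : 0 <= r by exact: sqrtr_ge0.
have r2 : r ^+ 2 = th * q by rewrite sqr_sqrtr//; case/andP: tq.
have r1 : r < 1.
  by rewrite ltNge; apply/negP => r1; case/andP: tq => _; rewrite -r2; nra.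
have th9 := powR3_walk_gt9 dw2.
have qr : q <= r.
  have : q <= r ^+ 2 by rewrite r2; move: th9; rewrite -/th; nra.
  nra.
have [C C0 hC] := occupation_time_le d_gt1 hW dw2 dwf c10 c20 hU.
pose e1 := eps * (1 - r) / (2 * 3 `^ p).
have e10 : 0 < e1 by rewrite !divr_gt0// ?mulr_gt0// subr_gt0.
have rr : 0 <= r < 1 by rewrite r0.
have [K hK] := geometric_small C rr e10.
have [rho hrho] := occupation_time_small d_gt1 hW dw2 dwf c10 c20 hU K e10.
exists rho => x i cx xi; rewrite expected_clock.
apply: (@le_trans _ _ (\sum_(k <oo) (3 `^ p * (e1 + C * r ^+ K) * r ^+ k)%:E)%E).
  apply: lee_nneseries => [k _|k _].
    move=> _; rewrite mule_ge0 ?lee_fin//; apply: integral_ge0 => s _; exact: measure_ge0.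
  have rk : 0 <= r ^+ k by exact: exprn_ge0.
  have pk : 3 `^ p * (3 `^ p) ^- k = 3 `^ p * q ^+ k :> R by rewrite exprVn.
  have CK0 : 0 <= C * r ^+ K by rewrite mulr_ge0// exprn_ge0.
  have [kK|Kk] := leqP k K.
    have G : (occupation_time P W k x <= e1%:E)%E.
      exact: le_trans (le_occupation_time _ kK) (hrho x i cx xi).
    apply: (@le_trans _ _ ((3 `^ p * (3 `^ p) ^- k)%:E * e1%:E)%E).
      by apply: lee_wpmul2l => //; rewrite lee_fin.
    rewrite -EFinM lee_fin pk -!mulrA ler_pM2l// [leLHS]mulrC.
    apply: ler_pM; rewrite ?(ltW e10) ?exprn_ge0 ?(ltW q0)//; first by rewrite lerDl.
    by apply: lerXn2r => //; rewrite ?nnegrE ?(ltW q0).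
  apply: (@le_trans _ _ ((3 `^ p * (3 `^ p) ^- k)%:E * (C * th ^+ k)%:E)%E).
    by apply: lee_wpmul2l; [rewrite lee_fin|exact: hC].
  rewrite -EFinM lee_fin pk.
  have -> : 3 `^ p * q ^+ k * (C * th ^+ k) = 3 `^ p * C * (r ^+ k * r ^+ k).
    by rewrite -exprMn -expr2 r2 exprMn; ring.
  rewrite -!mulrA ler_pM2l// mulrA; apply: ler_wpM2r => //.
  rewrite -[leLHS]add0r; apply: lerD; first exact: ltW.
  apply: ler_wpM2l => //; apply: ler_wiXn2l => //; [exact: ltW|exact: ltnW].
apply: le_trans (geometric_nneseries _ rr) _.
  by rewrite mulr_ge0 ?(ltW pp0)// addr_ge0 ?(ltW e10)// mulr_ge0// exprn_ge0.
rewrite lee_fin ler_pdivrMr ?subr_gt0//.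
have := hK K (leqnn K) => CK.
apply: (@le_trans _ _ (3 `^ p * (e1 + e1))).
  by rewrite ler_pM2l// lerD2l.
by rewrite /e1 le_eqVlt; apply/orP; left; apply/eqP; field; rewrite gt_eqF.
Qed.

(** If the process is alive at time [t], the clock passes [t], hence so does its majorant; Markov's
    inequality bounds this probability by 1/2. *)
Lemma time_changed_semigroup_lt1 (t : R) (x : pt) : 0 < t ->
  (\int[P x]_w clock_majorant w <= (t / 2)%:E)%E ->
  time_changed_semigroup P W (weight p) t (cst 1) x < 1.
Proof.
move=> t0 Ex; rewrite /time_changed_semigroup /Rintegral.
set I := integral _ _ _.
have I0 : (0 <= I)%E by apply: integral_ge0 => w _; case: time_changed.
have I1 : (I <= 2^-1%:E)%E.
  apply: (@le_trans _ _ (\int[P x]_w ((t^-1)%:E * clock_majorant w))%E).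
    apply: le_integral_ge0 => // w _; last first.
      by rewrite mule_ge0 ?clock_majorant_ge0// lee_fin invr_ge0 ltW.
    rewrite /time_changed; case: ifPn => [/set0P[s [s0 ts]]|_]; last first.
      by rewrite lexx/= mule_ge0 ?clock_majorant_ge0// lee_fin invr_ge0 ltW.
    rewrite lee_fin ler01/= -[leLHS](_ : t^-1%:E * t%:E = _)%E; last first.
      by rewrite -EFinM mulVf ?gt_eqF.
    apply: lee_wpmul2l; first by rewrite lee_fin invr_ge0 ltW.
    exact: le_trans (ltW ts) (additive_functional_le _ _).
  rewrite ge0_integralZl_EFin//; last 3 first.
  - by move=> w _; exact: clock_majorant_ge0.
  - apply: ge0_emeasurable_sum => [k w _ _|k _].
      by rewrite mule_ge0// lee_fin.
    by apply: measurable_funeM; exact: (measurable_occupation hW _ mhalf).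
  - by rewrite invr_ge0 ltW.
  apply: (@le_trans _ _ ((t^-1)%:E * (t / 2)%:E)%E).
    by apply: lee_wpmul2l => //; rewrite lee_fin invr_ge0 ltW.
  by rewrite -EFinM mulKf ?gt_eqF.
move: I0 I1; case: I => [r| |]//=; rewrite !lee_fin => _ r1; lra.
Qed.

Lemma m_a_shell_gt0 i k : (0 < m_a (weight p) (@shell R d i k))%E.
Proof.
pose c : R := (@weight_const R d p * (3 `^ p) ^+ k.+1)^-1.
have Wc : 0 < @weight_const R d p * (3 `^ p) ^+ k.+1.
  by rewrite mulr_gt0 ?weight_const_gt0// exprn_gt0// powR3_gt0.
have sc (x : pt) : shell i k x -> cell k.+1 x.
  by move=> /(shell_sub d_gt1)[].
have ms : measurable (@shell R d i k : set (leb_space R d)) by exact: measurable_shell.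
apply: (@lt_le_trans _ _ (c%:E * lam (shell i k))%E).
  apply: mule_gt0; first by rewrite lte_fin invr_gt0.
  apply: lt_le_trans (leb_shell_ge _ i k) => //.
  by rewrite lte_fin mulr_gt0 ?invr_gt0 ?exprn_gt0// children_gt0.
apply: (@le_trans _ _ (\int[lam]_(x in shell i k) c%:E)%E).
  by rewrite le_eqVlt; apply/orP; left; apply/eqP; rewrite -integral_cst.
apply: le_integral_ge0 => [x xs|x xs|x _]; last by rewrite lee_fin weight_inv_ge0.
  by split => //; exact: cell_sub_carpet (sc x xs).
rewrite !lee_fin invr_ge0 (ltW Wc)/= lef_pV2 ?posrE ?weight_gt0//.
exact: (weight_le_cell d_gt1 p0 (sc x xs)).
Qed.

(** An exceptional null set would contain a whole shell far from the origin, but shells have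
    positive mass. The time [t] is the one given by the assumed completeness. *)
Lemma not_stochastically_complete : ~ stochastically_complete (weight p) P W.
Proof.
move=> [t t0 [Z [mZ Z0 sZ]]].
have t20 : 0 < t / 2 by rewrite divr_gt0.
have [rho hrho] := expected_clock_small t20.
pose i : 'I_d := Ordinal d_gt0.
have three2 : 2 <= 3 :> R by lra.
have [k rk] := exp_unbounded three2 rho.
have := m_a_shell_gt0 i k.
suff -> : m_a (weight p) (@shell R d i k) = 0%E by rewrite ltxx.
apply/eqP; rewrite eq_le; apply/andP; split; last first.
  by apply: integral_ge0 => x _; rewrite lee_fin weight_inv_ge0.
rewrite -Z0; apply: le_m_a => [x|x xs]; first by rewrite ltW// weight_gt0.
apply: sZ => /= H; have [xk xi] := shell_sub d_gt1 xs.
have cx := cell_sub_carpet xk.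
have xr : rho <= x ord0 i.
  by apply: le_trans (ltW rk) _; apply: le_trans xi; rewrite ler_peMl ?exprn_ge0//; lra.
by have := time_changed_semigroup_lt1 t0 (hrho x i cx xr); rewrite (H cx) ltxx.
Qed.

End clock_bound.
End incompleteness.

Lemma integral_probability_cst {R : realType} {dT : measure_display} {T : measurableType dT}
  (mu : probability T R) (c : \bar R) : (\int[mu]_w c = c)%E.
Proof.
transitivity (c * mu setT)%E; last by rewrite probability_setT mule1.
exact: integral_cst.
Qed.

(** * Completeness for [p <= dw] *)

Section completeness.
Context {R : realType} {d : nat}.
Local Notation pt := 'rV[R]_d.
Local Notation lam := (@leb R d).
Local Notation N := (@children R d).
Hypothesis d_gt1 : (1 < d)%N.
Context (h : R -> pt -> pt -> R).
Context {dO : measure_display} {Omega : measurableType dO}.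
Context (P : pt -> probability Omega R) (W : R -> Omega -> pt).
Hypothesis hW : reflecting_BM h P W.
Context (dw : R).
Hypothesis dw2 : 2 < dw.
Variables (c1 c2 : R).
Hypotheses (c10 : 0 < c1) (c20 : 0 < c2).
Hypothesis hU : forall t x y, 0 < t -> carpet x -> carpet y -> h t x y <= hk_bound dw c1 c2 t x y.

Let th : R := 3 `^ dw.
Let th9 : 9 < th. Proof. exact: powR3_walk_gt9. Qed.
Let th0 : 0 < th. Proof. by move: th9; lra. Qed.
Let N0 : 0 < N. Proof. exact: children_gt0. Qed.
(** [Q > N]: a polynomial decay of order [d.+1] in space, extracted from the exponential, already
    beats the growth of the volumes of cells. *)
Let Q : R := 3 ^+ d.+1.
Let Q0 : 0 < Q. Proof. exact: exprn_gt0. Qed.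

Let NQ : 0 <= N / Q < 1.
Proof.
rewrite divr_ge0 ?(ltW N0) ?(ltW Q0)//= ltr_pdivrMr// mul1r /Q /children exprS.
have : 0 < 3 ^+ d :> R by rewrite exprn_gt0.
lra.
Qed.

Lemma expRN_le (z : R) (n : nat) : 0 < z -> expR (- z) <= n.+1`!%:R / z ^+ n.+1.
Proof.
move=> z0; rewrite expRN; have zn : 0 < z ^+ n.+1 by rewrite exprn_gt0.
have f0 : 0 < n.+1`!%:R :> R by rewrite ltr0n fact_gt0.
rewrite -[leRHS]invrK lef_pV2 ?posrE ?expR_gt0 ?invr_gt0 ?divr_gt0// invf_div.
by apply: le_trans (expR_ge1Dxn n (ltW z0)); rewrite lerDr.
Qed.

Lemma exit_bound : exists A m0, 0 <= A /\ forall (x : pt), carpet x -> exists k1, forall k l s y j,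
  (m0 <= k)%N -> (k1 < k)%N -> th ^+ k <= s <= 2 * th ^+ k -> carpet y -> (k + l <= j)%N ->
  (exists i, 3 ^+ j < y ord0 i) -> h s x y <= A * N ^- k * Q ^+ k * Q ^- j.
Proof.
have th2 : 2 <= th by move: th9; lra.
have [m0 hm0] := exp_unbounded th2 c1^-1.
have cc0 : 0 < c1 `^ dw^-1 by rewrite powR_gt0.
have [v v0 hv] := vol_ge d_gt1 cc0.
pose A := v^-1 * expR 1 * (d.+1`!%:R * (6 / c2) ^+ d.+1).
exists A, m0; split.
  rewrite !mulr_ge0 ?invr_ge0 ?(ltW v0) ?expR_ge0 ?exprn_ge0 ?divr_ge0 ?(ltW c20)//.
move=> x cx; have [k1 xk1] := carpet_cell cx; exists k1.
move=> k l s y j m0k k1k /andP[ks sk] cy kj [i yi].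
have tm0 : th ^+ m0 <= s by apply: le_trans ks; apply: ler_weXn2l => //; lra.
have thk : 0 < th ^+ k by rewrite exprn_gt0.
have s0 : 0 < s by exact: lt_le_trans ks.
have s1 : 1 < c1 * s.
  by rewrite -(mulfV (lt0r_neq0 c10)) ltr_pM2l//; exact: lt_le_trans tm0.
have vN : 0 < v * N ^+ k by rewrite mulr_gt0// exprn_gt0.
have sg : 0 < 3 ^+ k.+1 :> R by rewrite exprn_gt0.
(* [x] lies in cell [k1] with [k1 < k <= j], so its coordinates are at most a third of [3 ^+ j]. *)
have D : 3 ^+ j / 2 <= dX x y.
  apply: le_trans (coord_le_dX d_gt1 i cx cy); rewrite distrC; apply: le_trans (ler_norm _).
  have [_ /(_ i) xi] := xk1.
  have : 3 ^+ k1.+1 <= 3 ^+ j :> R.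
    by apply: ler_weXn2l => //; [lra|apply: leq_trans kj; apply: leq_trans k1k (leq_addr _ _)].
  rewrite exprS; have : 0 < 3 ^+ k1 :> R by rewrite exprn_gt0.
  lra.
(* At this scale [Psi] equals [th ^+ k.+1], which exceeds the time, and the exponent is at most
   [1 - z] with [z] of order [3 ^+ j / 3 ^+ k]. *)
apply: le_trans (kernel_le d_gt1 c20 hU (s := 3 ^+ k.+1) (v := v * N ^+ k) s0 cx cy sg vN _ D) _.
  by apply: hv => //; exact: Psi_inv_exp.
have PsiE : Psi dw (3 ^+ k.+1) = th ^+ k.+1.
  rewrite /Psi ifF; first by rewrite powR_exp3.
  by apply/negbTE; rewrite -ltNge exprn_egt1//; lra.
pose z := c2 / 6 * (3 ^+ j / 3 ^+ k).
have z0 : 0 < z by rewrite mulr_gt0 ?divr_gt0 ?exprn_gt0.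
have E1 : s / Psi dw (3 ^+ k.+1) - c2 * (3 ^+ j / 2) / 3 ^+ k.+1 <= 1 - z.
  apply: lerD; first by rewrite PsiE ler_pdivrMr ?exprn_gt0// mul1r exprS; nra.
  rewrite lerN2 /z exprS le_eqVlt; apply/orP; left; apply/eqP; field.
  by rewrite gt_eqF ?exprn_gt0.
apply: (@le_trans _ _ ((v * N ^+ k)^-1 * (expR 1 * expR (- z)))).
  by rewrite ler_pM2l ?invr_gt0// -expRD ler_expR.
have zE : d.+1`!%:R / z ^+ d.+1 = d.+1`!%:R * (6 / c2) ^+ d.+1 * Q ^+ k * Q ^- j.
  rewrite /z /Q -!exprM ![(d.+1 * _)%N]mulnC !exprM !expr_div_n exprMn !expr_div_n.
  by field; rewrite !expf_neq0 ?gt_eqF ?exprn_gt0.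
have := expRN_le d z0; rewrite zE => ez.
apply: (@le_trans _ _ ((v * N ^+ k)^-1 * (expR 1 * (d.+1`!%:R * (6 / c2) ^+ d.+1 * Q ^+ k * Q ^- j)))).
  by rewrite ler_pM2l ?invr_gt0// ler_pM2l ?expR_gt0.
by rewrite /A invfM le_eqVlt; apply/orP; left; apply/eqP; ring.
Qed.

(** Summing [exit_bound] over the layers outside cell [k + l] leaves a multiple of [(N / Q) ^+ l],
    the powers indexed by [k] cancelling. So [l] depends on [eps] alone, and only [k0] on the
    starting point. *)
Lemma stay_probability (eps : R) : 0 < eps -> exists l, forall x : pt, carpet x ->
  exists k0, forall k s, (k0 <= k)%N -> th ^+ k <= s <= 2 * th ^+ k ->
    ((1 - eps)%:E <= P x (W s @^-1` cell (k + l)))%E.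
Proof.
move=> e0; have [A [m0 [A0 hA]]] := exit_bound.
have [l hl] := geometric_small (A * N / (1 - N / Q)) NQ e0.
exists l => x cx; have [k1 hk1] := hA x cx; exists (m0 + k1.+1)%N => k s kk ks.
have m0k : (m0 <= k)%N by apply: leq_trans kk; exact: leq_addr.
have k1k : (k1 < k)%N by apply: leq_trans kk; exact: leq_addl.
have s0 : 0 < s by have /andP[ks1 _] := ks; apply: lt_le_trans ks1; rewrite exprn_gt0.
pose n := (k + l)%N.
have PC : (P x (W s @^-1` (~` coord_ub n)) <= eps%:E)%E.
  apply: (prob_le hW) => //.
  - by apply: sub_sigma_algebra; exact: open_coord_ubC.
  - exact: ltW.
  pose c i := A * N ^- k * Q ^+ k * Q ^- (n + i).
  have c0 i : 0 <= c i by rewrite !mulr_ge0 ?invr_ge0 ?exprn_ge0// ltW.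
  apply: le_trans (@integral_le_cells _ _ d_gt1 _ _ c (fun i => (n + i).+1) c0 _) _.
    move=> y [cy yn]; rewrite lee_fin (hk_ge0 (bm_hk hW))//=.
    have ex : exists m, `[< cell m y >] by have [m ym] := carpet_cell cy; exists m; exact/asboolP.
    case: (ex_minnP ex) => m /asboolP ym mmin.
    have nm : (n < m)%N.
      rewrite ltnNge; apply/negP => mn; apply: yn.
      by have [_] := le_cell mn ym.
    case: m ym mmin nm => // m ym mmin nm.
    have [|i yi] := not_cell (k := m) cy.
      by move=> ym'; have := mmin _ (asboolT ym'); rewrite ltnn.
    have mE : (n + (m - n))%N = m by rewrite subnKC.
    apply: (@le_trans _ _ (c (m - n)%N * \1_(cell (n + (m - n)).+1) y)%:E).
      rewrite mE indicE mem_set// mulr1 lee_fin /c mE.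
      by apply: (hk1 k l) => //; exists i.
    apply: (@nneseries_term _ (fun i => c i * \1_(cell (n + i).+1) y)) => i'.
    by rewrite mulr_ge0.
  have q0 : 0 <= N / Q by case/andP: NQ.
  apply: (@le_trans _ _ (\sum_(i <oo) (A * N * (N / Q) ^+ (l + i))%:E)%E).
    apply: lee_nneseries => [i _|i _]; first by move=> _; rewrite lee_fin mulr_ge0// exprn_ge0// ltW.
    rewrite lee_fin /c /n exprS !exprD !expr_div_n !invfM.
    rewrite le_eqVlt; apply/orP; left; apply/eqP; field.
    by rewrite !expf_neq0 ?gt_eqF.
  apply: le_trans (tail_nneseries _ _ NQ) _; first by rewrite mulr_ge0// ltW.
  by rewrite lee_fin; have := hl l (leqnn _); rewrite mulrAC.
have mC : measurable (W s @^-1` (~` coord_ub n)).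
  by apply: (bm_meas hW); [exact: ltW|exact: open_coord_ubC].
rewrite (cell_preimage hW) ?(ltW s0)// -/n -[X in P x X]setCK preimage_setC.
rewrite probability_setC// EFinB; apply: leeB => //.
Qed.

Definition window k : set (measurableTypeR R) := `[th ^+ k, 2 * th ^+ k]%classic.

Lemma windowP k s : window k s <-> th ^+ k <= s <= 2 * th ^+ k.
Proof. by rewrite /window /= in_itv. Qed.

Lemma measurable_window k : measurable (window k).
Proof. exact: measurable_itv. Qed.

Lemma thX_gt0 k : 0 < th ^+ k. Proof. exact: exprn_gt0. Qed.

Lemma window_inj j k s : window j s -> window k s -> j = k.
Proof.
suff lt j' k' : (j' < k')%N -> window j' s -> window k' s -> False.
  by move=> js ks; case: (ltngtP j k) => // jk; [case: (lt _ _ jk js ks)|case: (lt _ _ jk ks js)].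
move=> jk /windowP/andP[_ s1] /windowP/andP[s2 _].
have : th ^+ j'.+1 <= th ^+ k' by apply: ler_weXn2l => //; move: th9; lra.
by rewrite exprS; have := thX_gt0 j'; move: th9; nra.
Qed.

Lemma lebesgue_window k : @lebesgue_measure R (window k) = (th ^+ k)%:E.
Proof.
have t0 := thX_gt0 k.
rewrite /window lebesgue_measure_itv/= lte_fin ltr_pMl// (_ : (1 < 2) = true); last by rewrite ltr1n.
by rewrite -EFinB; congr (_%:E); ring.
Qed.

Lemma occupation_window_le k n w : (occupation W (window k) n w <= (th ^+ k)%:E)%E.
Proof.
apply: (@le_trans _ _ (\int[lebesgue_measure]_s (1 * \1_(window k) s)%:E)%E).
  apply: le_integral_ge0 => // s _.
  have i1 : \1_(inside W n) (s, w) <= 1 :> R by rewrite indicE lern1 leq_b1.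
  by rewrite !lee_fin mulr_ge0//= mul1r; apply: ler_piMr.
rewrite le_eqVlt; apply/orP; left; apply/eqP.
transitivity (1%:E * @lebesgue_measure R (window k))%E; last by rewrite lebesgue_window mul1e.
by apply: integral_scaled_indic => //; exact: measurable_window.
Qed.

Lemma expected_occupation_ge (x : pt) (q : R) k n : 0 <= q ->
  (forall s, th ^+ k <= s <= 2 * th ^+ k -> (q%:E <= P x (W s @^-1` cell n))%E) ->
  ((q * th ^+ k)%:E <= \int[P x]_w occupation W (window k) n w)%E.
Proof.
move=> q0 H; have t0 := thX_gt0 k.
rewrite (integral_occupation hW); last 2 first.
- exact: measurable_window.
- by move=> s /windowP/andP[s1 _]; apply: le_trans s1; exact: ltW.
apply: (@le_trans _ _ (\int[lebesgue_measure]_(s in `[(th ^+ k)%R, (2 * th ^+ k)%R]) q%:E)%E).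
  by rewrite integral_itv_cst; [rewrite lee_fin; nra|lra].
apply: le_integral_ge0 => // s.
by rewrite /= in_itv/= => sk; rewrite lee_fin q0; exact: H.
Qed.

Section slow_weight.
Variable p : R.
Hypotheses (p0 : 0 < p) (pdw : p <= dw).

(** The factor [th ^- k] normalises a window of length [th ^+ k], so that each term is at most 1. *)
Definition window_sum k0 l K (w : Omega) : \bar R :=
  (\sum_(i < K) (th ^- (k0 + i))%:E * occupation W (window (k0 + i)) (k0 + i + l) w)%E.

(** As [p <= dw], the weight on cell [k + l] is at most [weight_const p * th ^+ l * th ^+ k]; the
    last factor is the one already in [window_sum]. *)
Definition clock_rate l : R := (@weight_const R d p * th ^+ l)^-1.

Lemma clock_rate_gt0 l : 0 < clock_rate l.
Proof. by rewrite invr_gt0 mulr_gt0 ?weight_const_gt0// thX_gt0. Qed.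

Let thV_ge0 k : 0 <= th ^- k.
Proof. by rewrite invr_ge0 ltW// thX_gt0. Qed.

Let occ_ge0 J n w : (0 <= occupation W J n w)%E.
Proof. by apply: integral_ge0 => s _; rewrite lee_fin mulr_ge0. Qed.

Lemma window_sum_clock k0 l K w : ((clock_rate l)%:E * window_sum k0 l K w <=
  additive_functional W (weight p) (2 * th ^+ (k0 + K)) w)%E.
Proof.
have r0 := clock_rate_gt0 l.
pose f (i : 'I_K) (u : measurableTypeR R) : \bar R :=
  ((clock_rate l * th ^- (k0 + i))%:E * occ_fun W (window (k0 + i)) (k0 + i + l) (u, w))%E.
have coef i : 0 <= clock_rate l * th ^- (k0 + i) by rewrite mulr_ge0// ltW.
have f0 i u : (0 <= f i u)%E by rewrite mule_ge0 ?lee_fin// occ_fun_ge0.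
have mo i := measurableT_comp (measurable_occ_fun hW (k0 + i + l) (measurable_window (k0 + i)))
  (pair2_measurable w).
have mf i : measurable_fun setT (f i) by apply: measurable_funeM; exact: mo.
have -> : ((clock_rate l)%:E * window_sum k0 l K w = \int[lebesgue_measure]_u (\sum_(i < K) f i u))%E.
  rewrite ge0_integral_sum// /window_sum ge0_sume_distrr; last first.
    by move=> i _; rewrite mule_ge0// lee_fin.
  apply: eq_bigr => i _; rewrite muleA -EFinM /f ge0_integralZl_EFin//; last exact: mo.
  by move=> u _; exact: occ_fun_ge0.
apply: le_integral_restrict => u; rewrite /patch in_setT.
have -> : point = 0%E :> \bar R by [].
apply/andP; split; first by apply: sume_ge0 => i _.
have [[i ui]|nui] := pselect (exists i : 'I_K, window (k0 + i) u); last first.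
  rewrite big1; first by case: ifP => _ //; rewrite lee_fin weight_inv_ge0.
  move=> i _; rewrite /f /occ_fun /= indicE memNset ?mul0r ?mule0// => ui.
  by apply: nui; exists i.
rewrite (bigD1 i)//= big1 ?adde0; last first.
  move=> j ji; rewrite /f /occ_fun /= indicE memNset ?mul0r ?mule0// => uj.
  move/negP : ji; apply; apply/eqP/val_inj => /=.
  by have /eqP := window_inj uj ui; rewrite eqn_add2l => /eqP.
have /windowP/andP[u1 u2] := ui.
have u0 : 0 <= u by apply: le_trans u1; exact/ltW/thX_gt0.
rewrite mem_set; last first.
  rewrite /= in_itv/= u0/=; apply: le_trans u2 _; rewrite ler_pM2l//.
  by apply: ler_weXn2l; [move: th9; lra|rewrite leq_add2l ltnW].
rewrite /f /occ_fun /= -EFinM lee_fin indicE mem_set// mul1r indicE.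
have [uin|uin] := boolP ((u, w) \in inside W (k0 + i + l)); last by rewrite mulr0 weight_inv_ge0.
move: uin; rewrite inE => /(insideP hW _ _ u0) cw.
rewrite mulr1 /clock_rate -invfM lef_pV2 ?posrE ?weight_gt0//; last first.
  by rewrite !mulr_gt0 ?weight_const_gt0 ?thX_gt0.
apply: le_trans (weight_le_cell d_gt1 p0 cw) _.
rewrite -mulrA -exprD [(l + _)%N]addnC ler_pM2l ?weight_const_gt0//.
apply: lerXn2r; rewrite ?nnegrE ?(ltW th0) ?powR_ge0//.
exact: powR3_le.
Qed.

Lemma measurable_window_sum k0 l K : measurable_fun setT (window_sum k0 l K).
Proof.
apply: emeasurable_sum => i; apply: measurable_funeM.
by apply: (measurable_occupation hW); exact: measurable_window.
Qed.

Lemma window_sum_ge0 k0 l K w : (0 <= window_sum k0 l K w)%E.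
Proof. by apply: sume_ge0 => i _; rewrite mule_ge0// lee_fin. Qed.

Lemma window_sum_le k0 l K w : (window_sum k0 l K w <= K%:R%:E)%E.
Proof.
apply: (@le_trans _ _ (\sum_(i < K) 1%:E)%E); last first.
  by rewrite sumEFin lee_fin sumr_const card_ord.
apply: lee_sum => i _; apply: (@le_trans _ _ ((th ^- (k0 + i))%:E * (th ^+ (k0 + i))%:E)%E).
  by apply: lee_wpmul2l; [rewrite lee_fin|exact: occupation_window_le].
by rewrite -EFinM mulVf// gt_eqF// thX_gt0.
Qed.

Lemma expected_window_sum (x : pt) q k0 l K : 0 <= q ->
  (forall k s, (k0 <= k)%N -> th ^+ k <= s <= 2 * th ^+ k ->
    (q%:E <= P x (W s @^-1` cell (k + l)))%E) ->
  ((K%:R * q)%:E <= \int[P x]_w window_sum k0 l K w)%E.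
Proof.
move=> q0 H; rewrite ge0_integral_sum//; last 2 first.
- move=> i; apply: measurable_funeM.
  by apply: (measurable_occupation hW); exact: measurable_window.
- by move=> i w _; rewrite mule_ge0// lee_fin.
apply: (@le_trans _ _ (\sum_(i < K) q%:E)%E).
  by rewrite sumEFin lee_fin sumr_const card_ord mulr_natl.
apply: lee_sum => i _; rewrite ge0_integralZl_EFin//; last first.
  by apply: (measurable_occupation hW); exact: measurable_window.
apply: (@le_trans _ _ ((th ^- (k0 + i))%:E * (q * th ^+ (k0 + i))%:E)%E).
  by rewrite -EFinM lee_fin mulrCA mulVf ?mulr1// gt_eqF// thX_gt0.
apply: lee_wpmul2l; first by rewrite lee_fin.
by apply: expected_occupation_ge => // s; apply: H; exact: leq_addr.
Qed.

(** [window_sum] is at most [K] with expectation at least [K (1 - eps)], so it exceeds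
    [1 / clock_rate] with probability at least [1 - eps - 1 / (K clock_rate)], and [K] is taken so
    large that the last term is at most [eps]. *)
Lemma clock_passes (eps : R) (x : pt) : 0 < eps <= 1 -> carpet x -> exists E : set Omega,
  [/\ measurable E, ((1 - 2 * eps)%:E <= P x E)%E &
      forall w, E w -> clock_passed W (weight p) 1 w !=set0].
Proof.
move=> /andP[e0 e1] cx; have [l hl] := stay_probability e0; have [k0 hk0] := hl x cx.
have r0 := clock_rate_gt0 l.
pose K := (Num.truncn ((clock_rate l * eps)^-1)).+1.
have KP : (clock_rate l * eps)^-1 <= K%:R.
  have re0 : 0 <= (clock_rate l * eps)^-1 by rewrite invr_ge0 mulr_ge0 ?(ltW r0) ?(ltW e0).
  by apply/ltW; have /andP[] := truncn_itv re0.
pose S := window_sum k0 l K.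
pose E := [set w | ((clock_rate l)^-1%:E < S w)%E].
have mE : measurable E.
  have := emeasurable_fun_o_infty measurableT (measurable_window_sum k0 l K) (clock_rate l)^-1%:E.
  by rewrite setTI.
exists E; split => // [|w Ew]; last first.
  exists (2 * th ^+ (k0 + K)); split; first by rewrite mulr_ge0// ltW// thX_gt0.
  apply: lt_le_trans (window_sum_clock k0 l K w).
  rewrite -[ltLHS](_ : (clock_rate l)%:E * (clock_rate l)^-1%:E = _)%E; last first.
    by rewrite -EFinM mulfV// gt_eqF.
  by rewrite lte_pmul2l.
have q0 : 0 <= 1 - eps by lra.
have lower := expected_window_sum K q0 hk0.
have K0 : 0 < K%:R :> R by rewrite ltr0n.
have upper : (\int[P x]_w S w <= (clock_rate l)^-1%:E + K%:R%:E * P x E)%E.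
  apply: (@le_trans _ _ (\int[P x]_w ((clock_rate l)^-1%:E + (K%:R * \1_E w)%:E))%E).
    apply: le_integral_ge0 => // w _; last first.
      by rewrite adde_ge0 ?lee_fin ?mulr_ge0// invr_ge0 ltW.
    rewrite window_sum_ge0/=; have [Ew|Ew] := pselect (E w).
      rewrite indicE mem_set// mulr1; apply: le_trans (window_sum_le _ _ _ _) _.
      by rewrite -[leLHS]add0e; apply: leeD => //; rewrite lee_fin invr_ge0 ltW.
    rewrite indicE memNset// mulr0 adde0 leNgt; exact/negP.
  have m2 : measurable_fun setT (fun w => (K%:R * \1_E w : R)%:E).
    by apply/measurable_EFinP; apply: measurable_funM => //; exact: measurable_indic.
  have c0 : (0 <= (clock_rate l)^-1%:E)%E by rewrite lee_fin invr_ge0 ltW.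
  rewrite ge0_integralD//.
  rewrite le_eqVlt; apply/orP; left; apply/eqP; congr (_ + _)%E; last exact: integral_scaled_indic.
  exact: integral_probability_cst.
have fE : P x E \is a fin_num by exact: fin_num_measure.
have := le_trans lower upper; rewrite -(fineK fE) -EFinM -EFinD !lee_fin.
set e := fine _ => le1.
have re : (clock_rate l)^-1 <= K%:R * eps by rewrite -ler_pdivrMr// -invfM.
rewrite -(ler_pM2l K0) (_ : K%:R * (1 - 2 * eps) = K%:R * (1 - eps) - K%:R * eps).
  by rewrite lerBlDr (le_trans le1)// addrC lerD2l.
by rewrite -mulrBr; congr (_ * _); lra.
Qed.

Lemma time_changed_semigroup1 (x : pt) : carpet x ->
  time_changed_semigroup P W (weight p) 1 (cst 1) x = 1.
Proof.
move=> cx; rewrite /time_changed_semigroup /Rintegral.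
set I := integral _ _ _.
have I1 : (I <= 1%:E)%E.
  apply: (@le_trans _ _ (\int[P x]_w (cst 1%:E w))%E).
    by apply: le_integral_ge0 => // w _; case: time_changed => [y|]; rewrite !lee_fin ?lexx ler01.
  by rewrite integral_probability_cst.
have Ige eps : 0 < eps <= 1 -> ((1 - 2 * eps)%:E <= I)%E.
  move=> e01; have [E [mE PE passed]] := clock_passes e01 cx.
  apply: le_trans PE _.
  rewrite -[X in P x X]setIT -(integral_indic _ measurableT)//.
  apply: le_integral_ge0 => // w _; last by case: time_changed.
  rewrite indicE; case: (boolP (w \in E)) => [/set_mem/passed pw|_].
    by move/set0P : pw => pw; rewrite /time_changed pw !lee_fin ler01 lexx.
  by rewrite lexx/=; case: time_changed.
(* The case of [eps = 1] serves only to exclude the value -oo. *)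
have := Ige 1; move: I1 Ige; case: I => [r| |]//=; last by move=> _ _ /(_ _); rewrite ltr01 lexx => /(_ isT).
rewrite lee_fin => r1 Ige _; apply/eqP; rewrite eq_le r1/=.
apply/ler_addgt0Pr => e e0.
have e' : 0 < Num.min 1 (e / 2) <= 1 by rewrite lt_min ltr01 divr_gt0//= ge_min lexx.
have := Ige _ e'; rewrite lee_fin.
have : Num.min 1 (e / 2) <= e / 2 by rewrite ge_min lexx orbT.
lra.
Qed.

Lemma stochastically_complete_le : stochastically_complete (weight p) P W.
Proof.
exists 1 => //; exists set0; split => //; first exact: m_a0.
by move=> x /= nx; apply: nx => cx; exact: time_changed_semigroup1.
Qed.

End slow_weight.
End completeness.

Theorem theorem7p2 (R : realType) (d : nat) (hd : (3 <= d)%N)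
    (h : R -> 'rV[R]_d -> 'rV[R]_d -> R)
    (dO : measure_display) (Omega : measurableType dO)
    (P : 'rV[R]_d -> probability Omega R) (W : R -> Omega -> 'rV[R]_d)
    (hW : reflecting_BM h P W)
    (dw : R) (hdw : walk_dimension h dw) (hdwf : 2 < dw < dim_f R d)
    (p : R) (hp : 0 < p) :
  [/\ stochastically_complete (weight p) P W <-> p <= dw,
      VGC (@weight R d p) <-> p <= 2 \/ dim_f R d < p &
      2 < p < dw ->
        stochastically_complete (weight p) P W /\ ~ VGC (@weight R d p)].
Proof.
have d_gt1 : (1 < d)%N by exact: ltnW.
have /andP[dw2 dwf] := hdwf.
have [c1 [c2 [c3 [c4 [c10 c20 _ _ bounds]]]]] := hdw.
have hU t x y : 0 < t -> carpet x -> carpet y -> h t x y <= hk_bound dw c1 c2 t x y.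
  by move=> t0 cx cy; have /andP[] := bounds t x y t0 cx cy.
have complete : p <= dw -> stochastically_complete (weight p) P W.
  exact: (stochastically_complete_le d_gt1 hW dw2 c10 c20 hU hp).
have vgc := VGC_iff d_gt1 hp.
split => //.
  split => [H|]; last exact: complete.
  rewrite leNgt; apply/negP => dwp.
  exact: (not_stochastically_complete d_gt1 hW dw2 dwf c10 c20 hU dwp H).
move=> /andP[p2 pdw]; split; first exact/complete/ltW.
by move=> /vgc[|]; lra.
Qed.
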